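(* The satisfiability problem of $\mathrm{GRA}_2(e,s,\neg,\dot\cap,\exists)$ is $\textsc{NexpTime}$-complete.
   Context: AD-relations. $A^0=\{\epsilon\}$, with $\epsilon$ the empty tuple. A $k$-ary AD-relation over a set $A$ is a pair $(R,k)$ with $R\subseteq A^k$, $k\ge 0$; $t\in(R,k)$ means $t\in R$. Vocabularies contain only relation symbols (arity $\ge 0$, countably infinitely many available for each arity). Models have nonempty domains; $A$ is the domain of $\mathfrak{A}$. Terms. $\mathrm{GRA}(e,s,\neg,\dot\cap,\exists)$ is the set of terms built from relation symbols and the constant $e$ by the unary operators $s,\neg,\exists$ and the binary operator $\dot\cap$. $\mathrm{GRA}_2(e,s,\neg,\dot\cap,\exists)$ is the set of those terms of $\mathrm{GRA}(e,s,\neg,\dot\cap,\exists)$ in which all relation symbols have arity at most $2$. Each term $\mathcal{T}$ defines in each model $\mathfrak{A}$ an AD-relation $\mathcal{T}^{\mathfrak{A}}$ of arity $\mathit{ar}(\mathcal{T})$. Let $k=\mathit{ar}(\mathcal{T})$, $\ell=\mathit{ar}(\mathcal{S})$, $m=\max\{k,\ell\}$. - $R^{\mathfrak{A}}$ is the interpretation of $R$, paired with the arity of $R$; $e^{\mathfrak{A}}=(\{(a,a)\mid a\in A\},2)$. - If $k\ge2$: $(s\mathcal{T})^{\mathfrak{A}}=(\{(a_1,\dots,a_{k-2},a_k,a_{k-1})\mid(a_1,\dots,a_k)\in\mathcal{T}^{\mathfrak{A}}\},k)$; if $k\le1$: $(s\mathcal{T})^{\mathfrak{A}}=\mathcal{T}^{\mathfrak{A}}$.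 - $(\neg\mathcal{T})^{\mathfrak{A}}=(\{t\in A^k\mid t\notin\mathcal{T}^{\mathfrak{A}}\},k)$. - Suffix intersection: $(\mathcal{T}\,\dot\cap\,\mathcal{S})^{\mathfrak{A}}=(\{(a_1,\dots,a_m)\in A^m\mid(a_{m-k+1},\dots,a_m)\in\mathcal{T}^{\mathfrak{A}}\text{ and }(a_{m-\ell+1},\dots,a_m)\in\mathcal{S}^{\mathfrak{A}}\},m)$, where $(a_{m+1},a_m)$ denotes $\epsilon$. - If $k\ge1$: $(\exists\mathcal{T})^{\mathfrak{A}}=(\{(a_1,\dots,a_{k-1})\mid(a_1,\dots,a_k)\in\mathcal{T}^{\mathfrak{A}}\text{ for some }a_k\in A\},k-1)$; if $k=0$: $(\exists\mathcal{T})^{\mathfrak{A}}=\mathcal{T}^{\mathfrak{A}}$. Satisfiability problem for a set $\mathcal{G}$ of terms: on input $\mathcal{T}\in\mathcal{G}$, answer yes iff there exists a model $\mathfrak{A}$ such that $\mathcal{T}^{\mathfrak{A}}$ is not the empty AD-relation $(\varnothing,\mathit{ar}(\mathcal{T}))$. *)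

(* Defs.v *)
From HB Require Import structures.
From mathcomp Require Import all_boot all_order all_algebra.
Set Implicit Arguments.
Unset Strict Implicit.
Unset Printing Implicit Defensive.
Import GRing.Theory.

Record adrel (A : Type) := ADRel {
  adarity : nat;
  adset : adarity.-tuple A -> Prop
}.

Definition ad_mem (A : Type) (t : seq A) (r : adrel A) : Prop :=
  exists2 u : (adarity r).-tuple A, adset u & tval u = t.

Definition ad_empty (A : Type) (k : nat) : adrel A :=
  @ADRel A k (fun _ => False).

Definition ad_e (A : Type) : adrel A :=
  @ADRel A 2 (fun t => exists a : A, tval t = [:: a; a]).

Definition ad_s (A : Type) (r : adrel A) : adrel A :=
  if 2 <= adarity r then
    @ADRel A (adarity r) (fun t => exists (u : seq A) (a b : A),
      ad_mem (u ++ [:: a; b]) r /\ tval t = u ++ [:: b; a])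
  else r.

Definition ad_neg (A : Type) (r : adrel A) : adrel A :=
  @ADRel A (adarity r) (fun t => ~ adset t).

Definition ad_cap (A : Type) (r1 r2 : adrel A) : adrel A :=
  let m := maxn (adarity r1) (adarity r2) in
  @ADRel A m (fun t => ad_mem (drop (m - adarity r1) t) r1
                    /\ ad_mem (drop (m - adarity r2) t) r2).

Definition ad_ex (A : Type) (r : adrel A) : adrel A :=
  if 0 < adarity r then
    @ADRel A (adarity r).-1 (fun t => exists a : A, ad_mem (rcons t a) r)
  else r.

(* Bit strings serve as the names of the countably many relation symbols of
   each arity, so that a symbol is written down literally as its name. *)
Record relsym := RelSym { symarity : nat; symname : seq bool }.

Inductive term :=
| Rel of relsym
| Eqt
| Swap of term
| Neg of term
| Cap of term & term
| Ex of term.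

Fixpoint ar (T : term) : nat :=
  match T with
  | Rel R => symarity R
  | Eqt => 2
  | Swap T1 => ar T1
  | Neg T1 => ar T1
  | Cap T1 T2 => maxn (ar T1) (ar T2)
  | Ex T1 => (ar T1).-1
  end.

Fixpoint symbols (T : term) : seq relsym :=
  match T with
  | Rel R => [:: R]
  | Eqt => [::]
  | Swap T1 | Neg T1 | Ex T1 => symbols T1
  | Cap T1 T2 => symbols T1 ++ symbols T2
  end.

Definition GRA2 (T : term) : Prop := all (fun R => symarity R <= 2) (symbols T).

(* A model interprets every relation symbol; the symbols that do not occur in
   a term have no influence on its value. *)
Record model := Model {
  dom : Type;
  dom_nonempty : inhabited dom;
  interp : forall R : relsym, (symarity R).-tuple dom -> Prop
}.

Fixpoint denot (M : model) (T : term) : adrel (dom M) :=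
  match T with
  | Rel R => ADRel (@interp M R)
  | Eqt => ad_e (dom M)
  | Swap T1 => ad_s (denot M T1)
  | Neg T1 => ad_neg (denot M T1)
  | Cap T1 T2 => ad_cap (denot M T1) (denot M T2)
  | Ex T1 => ad_ex (denot M T1)
  end.

Lemma adarity_denot (M : model) (T : term) : adarity (denot M T) = ar T.
Proof.
elim: T => [R||T IH|T IH|T IH S IHS|T IH] //=.
- by rewrite /ad_s; case: ifP.
- by rewrite IH IHS.
- by rewrite /ad_ex; case: ifP => /=; rewrite IH //; case: (ar T).
Qed.

Definition satisfiable (T : term) : Prop :=
  exists M : model, denot M T <> ad_empty (dom M) (ar T).

Inductive letter := LR | Lbar | L0 | L1 | Le | Ls | Lneg | Lcap | Lex.

Definition letters := [:: LR; Lbar; L0; L1; Le; Ls; Lneg; Lcap; Lex].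

Definition letter_code (l : letter) : 'I_9 :=
  match l with
  | LR => @Ordinal 9 0 isT
  | Lbar => @Ordinal 9 1 isT
  | L0 => @Ordinal 9 2 isT
  | L1 => @Ordinal 9 3 isT
  | Le => @Ordinal 9 4 isT
  | Ls => @Ordinal 9 5 isT
  | Lneg => @Ordinal 9 6 isT
  | Lcap => @Ordinal 9 7 isT
  | Lex => @Ordinal 9 8 isT
  end.

Definition letter_decode (i : 'I_9) : letter := nth LR letters i.

Lemma letter_codeK : cancel letter_code letter_decode.
Proof. by case. Qed.

HB.instance Definition _ := Countable.copy letter (can_type letter_codeK).
HB.instance Definition _ : isFinite letter := CanIsFinite letter_codeK.

Definition bit_letter (b : bool) : letter := if b then L1 else L0.

(* Polish notation. The symbol of arity k named w is written R|...|w, with k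
   bars; the name extends up to the next letter that is not a bit. *)
Fixpoint encode (T : term) : seq letter :=
  match T with
  | Rel R => LR :: nseq (symarity R) Lbar
               ++ map bit_letter (symname R)
  | Eqt => [:: Le]
  | Swap T1 => Ls :: encode T1
  | Neg T1 => Lneg :: encode T1
  | Cap T1 T2 => Lcap :: encode T1 ++ encode T2
  | Ex T1 => Lex :: encode T1
  end.

Definition no_bit_ahead (u : seq letter) : bool :=
  if u is x :: _ then (x != L0) && (x != L1) else true.

Lemma encode_no_bit_ahead (T : term) (u : seq letter) :
  no_bit_ahead (encode T ++ u).
Proof. by case: T. Qed.

Lemma bits_cat_inj (w1 w2 : seq bool) (u1 u2 : seq letter) :
  no_bit_ahead u1 -> no_bit_ahead u2 ->
  map bit_letter w1 ++ u1 = map bit_letter w2 ++ u2 -> w1 = w2 /\ u1 = u2.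
Proof.
move=> h1 h2; elim: w1 w2 => [|b1 w1 IH] [|b2 w2] //=.
- by move=> e; move: h1; rewrite e /=; case: b2 {e}.
- by move=> e; move: h2; rewrite -e /=; case: b1 {e}.
- by case: b1 b2 => [] [] //= [] /IH [-> ->].
Qed.

Lemma bars_cat_inj (k1 k2 : nat) (w1 w2 : seq bool) (u1 u2 : seq letter) :
  no_bit_ahead u1 -> no_bit_ahead u2 ->
  head LR u1 <> Lbar -> head LR u2 <> Lbar ->
  nseq k1 Lbar ++ map bit_letter w1 ++ u1 =
  nseq k2 Lbar ++ map bit_letter w2 ++ u2 -> [/\ k1 = k2, w1 = w2 & u1 = u2].
Proof.
move=> h1 h2 b1 b2; elim: k1 k2 => [|k1 IH] [|k2] /=.
- by move=> /bits_cat_inj [] // -> ->.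
- by case: w1 => [|[] w1] //= e; case: b1; rewrite e.
- by case: w2 {IH} => [|[] w2] //= e; case: b2; rewrite -e.
- by case=> /IH [-> -> ->].
Qed.

Lemma encode_head (T : term) (u : seq letter) : head LR (encode T ++ u) <> Lbar.
Proof. by case: T. Qed.

Lemma encode_cat_inj (T1 T2 : term) (u1 u2 : seq letter) :
  no_bit_ahead u1 -> no_bit_ahead u2 ->
  head LR u1 <> Lbar -> head LR u2 <> Lbar ->
  encode T1 ++ u1 = encode T2 ++ u2 -> T1 = T2 /\ u1 = u2.
Proof.
elim: T1 T2 u1 u2 => [[k1 w1]||S1 IH|S1 IH|S1 IH S1' IH'|S1 IH]
  [[k2 w2]||S2|S2|S2 S2'|S2] u1 u2 h1 h2 b1 b2 //=.
- by rewrite -!catA; case=> /bars_cat_inj [] // -> -> ->.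
- by case.
- by case=> /IH [] // -> ->.
- by case=> /IH [] // -> ->.
- rewrite -!catA => -[] /IH [].
  1-2: exact: encode_no_bit_ahead.
  1-2: exact: encode_head.
  by move=> -> /IH' [] // -> ->.
- by case=> /IH [] // -> ->.
Qed.

Lemma encode_inj : injective encode.
Proof.
move=> T1 T2 e; have := @encode_cat_inj T1 T2 [::] [::].
by rewrite !cats0 => /(_ isT isT) [].
Qed.

Definition language (S : finType) := seq S -> Prop.

Definition sat_problem (G : term -> Prop) : language letter :=
  fun x => exists T : term, [/\ G T, satisfiable T & encode T = x].

Inductive dir := MLeft | MStay | MRight.

Definition shift (z : int) (d : dir) : int :=
  match d with MLeft => z - 1 | MStay => z | MRight => z + 1 end%R.

(* Nondeterministic machine with finitely many two-way infinite tapes. A cell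
   contains an element of [option G], where [None] is the blank. Tape [ord0] is
   the input tape and tape [ord_max] the output tape. *)
Record machine (G : finType) := Machine {
  ntapes : nat;
  state : finType;
  start : state;
  accepting : pred state;
  trans : state -> {ffun 'I_ntapes.+1 -> option G} ->
    pred (state * {ffun 'I_ntapes.+1 -> option G * dir})
}.

Definition tape (G : finType) := int -> option G.

Record config (G : finType) (M : machine G) := Config {
  cstate : state M;
  ctape : 'I_(ntapes M).+1 -> tape G;
  chead : 'I_(ntapes M).+1 -> int
}.

Definition tape_of (G : finType) (w : seq G) : tape G :=
  fun z => if z is Posz i then nth None (map some w) i else None.

Definition init_config (G : finType) (M : machine G) (w : seq G) : config M :=
  @Config G M (start M)
    (fun i => if i == ord0 then tape_of w else tape_of [::])
    (fun _ => 0%R).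

Definition scanned (G : finType) (M : machine G) (c : config M) :
    {ffun 'I_(ntapes M).+1 -> option G} :=
  [ffun i => ctape c i (chead c i)].

Definition apply_action (G : finType) (M : machine G) (c : config M)
    (a : state M * {ffun 'I_(ntapes M).+1 -> option G * dir}) : config M :=
  @Config G M a.1
    (fun i z => if z == chead c i then (a.2 i).1 else ctape c i z)
    (fun i => shift (chead c i) (a.2 i).2).

Inductive reaches (G : finType) (M : machine G) (c : config M) :
    nat -> config M -> Prop :=
| reaches0 : reaches c 0 c
| reachesS n d a : reaches c n d -> trans (cstate d) (scanned d) a ->
    reaches c n.+1 (apply_action d a).

Definition halted (G : finType) (M : machine G) (c : config M) : Prop :=
  forall a, ~~ trans (cstate c) (scanned c) a.

Definition accepts (G : finType) (M : machine G) (w : seq G) : Prop :=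
  exists n c, [/\ reaches (init_config M w) n c, halted c
                & accepting (cstate c)].

Definition halts_within (G : finType) (M : machine G) (w : seq G) (t : nat) :
    Prop :=
  forall n c, reaches (init_config M w) n c -> n <= t.

Definition deterministic (G : finType) (M : machine G) : Prop :=
  forall q s a b, trans (m := M) q s a -> trans (m := M) q s b -> a = b.

Definition outputs (G : finType) (M : machine G) (w v : seq G) : Prop :=
  exists n c, [/\ reaches (init_config M w) n c, halted c
                & forall z, ctape c ord_max z = tape_of v z].

Definition bigO (T f : nat -> nat) : Prop :=
  exists c n0, forall n, n0 <= n -> T n <= c * f n.

(* The maps [i] and [o] include the input and the output alphabet into the tape
   alphabet. *)
Definition NTIME (f : nat -> nat) (S : finType) (L : language S) : Prop :=
  exists (G : finType) (i : S -> G) (M : machine G) (T : nat -> nat),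
    [/\ injective i, bigO T f,
        forall x, halts_within M (map i x) (T (size x))
      & forall x, L x <-> accepts M (map i x)].

Definition NEXPTIME (S : finType) (L : language S) : Prop :=
  exists k, NTIME (fun n => 2 ^ (n ^ k)) L.

Definition polytime_computable (S D : finType) (f : seq S -> seq D) : Prop :=
  exists (G : finType) (i : S -> G) (o : D -> G) (M : machine G)
         (T : nat -> nat) (k : nat),
    [/\ injective i, injective o & deterministic M]
    /\ [/\ bigO T (fun n => n ^ k),
           forall x, halts_within M (map i x) (T (size x))
         & forall x, outputs M (map i x) (map o (f x))].

Definition polytime_reducible (S D : finType) (L : language S)
    (L' : language D) : Prop :=
  exists2 f : seq S -> seq D,
    polytime_computable f & forall x, L x <-> L' (f x).

Definition NEXPTIME_hard (D : finType) (L' : language D) : Prop :=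
  forall (S : finType) (L : language S), NEXPTIME L -> polytime_reducible L L'.

Definition NEXPTIME_complete (D : finType) (L : language D) : Prop :=
  NEXPTIME L /\ NEXPTIME_hard L.

(* Main.v *)
(* Membership: identifying a unary or nullary term with a set of pairs that
   depends on the last components only, a term becomes a formula with two
   variables, so the small model property of two-variable logic bounds the size of
   a model by an exponential. A machine guesses the number of elements, the true
   atoms and the truth values of the subterms [Ex t] at each element. A term is
   then evaluated at a pair of elements by reading its prefix encoding from right
   to left with a stack, and the guess is verified by local checks.

   Hardness: a run is a sequence of steps, the elements of the model; each carries
   its time and its head positions in binary, and a record of what is scanned,
   written and done. Two variables suffice to compare a scanned letter with the
   one last written on the cell, since each step also carries the time of the
   previous visit of the cell, and "no visit in between" is a condition on two
   steps. The input is written on the tape by the first steps of the run. *)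
Require Import Defs.
From HB Require Import structures.
From mathcomp Require Import all_boot all_order all_algebra zify.
From mathcomp Require Import boolp.
Set Implicit Arguments.
Unset Strict Implicit.
Unset Printing Implicit Defensive.
Import Order.TTheory GRing.Theory Num.Theory.

(** * A small stack language *)

(** Both directions require a concrete machine: a verifier for membership, a printer of formulas for
    hardness. Both are written in a language of stacks whose only loop consumes a stack, so that a
    bound on the lengths of loops yields a bound on time; nondeterminism is a single block of
    guesses between two deterministic programs. A subterm is addressed by the suffix of the input
    that starts with it, and the pass that evaluates the input also checks its syntax. In the
    hardness proof nothing forces a time to be borne by a single element. The conditions are
    therefore universal over pairs, and a run is read off by choosing one element for each time.
    Head positions are stored modulo [2 ^ m], but a run is extracted only for half that many times,
    so that distinct positions have distinct residues. The formula has to be printable by simple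
    loops: predicates are indexed in unary, and conditions that recur over the bits of a number are
    contexts with the hole at the end, which Polish notation turns into prefixes. *)

Definition upd (X : Type) (s : nat -> X) (i : nat) (v : X) : nat -> X :=
  fun j => if j == i then v else s j.

Lemma upd_same (X : Type) (s : nat -> X) i v : upd s i v i = v.
Proof. by rewrite /upd eqxx. Qed.

Lemma upd_other (X : Type) (s : nat -> X) i v j : j != i -> upd s i v j = s j.
Proof. by rewrite /upd => /negbTE ->. Qed.

Lemma upd_id (X : Type) (s : nat -> X) i : upd s i (s i) = s.
Proof. by apply: funext => j; rewrite /upd; case: eqP => [->|]. Qed.

Lemma upd_upd (X : Type) (s : nat -> X) i v w : upd (upd s i v) i w = upd s i w.
Proof. by apply: funext => j; rewrite /upd; case: eqP. Qed.

Lemma updC (X : Type) (s : nat -> X) i v j w : i != j ->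
  upd (upd s i v) j w = upd (upd s j w) i v.
Proof.
move=> ij; apply: funext => k; rewrite /upd; case: eqP => // ->.
by rewrite eq_sym (negbTE ij).
Qed.

Section Language.
Variable G : finType.

Definition store := nat -> seq G.

(** The only loop consumes a stack, so every program terminates. Branches and loop bodies are
    functions of the letter read, which is thereby kept in the finite control. *)
Inductive cmd :=
| Skip
| Push of nat & G
| Pop of nat
| Seq of cmd & cmd
| Case of nat & (option G -> cmd)
| For of nat & (G -> cmd).

Fixpoint run (c : cmd) (s : store) : store :=
  match c with
  | Skip => s
  | Push i g => upd s i (g :: s i)
  | Pop i => upd s i (behead (s i))
  | Seq c1 c2 => run c2 (run c1 s)
  | Case i f => run (f (ohead (s i))) s
  | For i f =>
    (fix loop l s :=
      if l is g :: l' then loop l' (run (f g) (upd s i l')) else s) (s i) s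
  end.

(** The local fixpoint of [run] under a name, for inductions on the list; [lcost] and [lsafe] below
    serve the same purpose. *)
Fixpoint loop (i : nat) (f : G -> cmd) (l : seq G) (s : store) : store :=
  if l is g :: l' then loop i f l' (run (f g) (upd s i l')) else s.

Lemma runFor i f s : run (For i f) s = loop i f (s i) s.
Proof. by rewrite /=; elim: (s i) {2 4}s => //= g l IH s'. Qed.

(** Counts machine steps exactly: a push moves and then writes, and a loop spends one step per round
    to pop and one to find the stack empty. *)
Fixpoint cost (c : cmd) (s : store) : nat :=
  match c with
  | Skip | Pop _ => 1
  | Push _ _ => 2
  | Seq c1 c2 => cost c1 s + cost c2 (run c1 s)
  | Case i f => (cost (f (ohead (s i))) s).+1
  | For i f =>
    (fix loop l s :=
      if l is g :: l' then
        (cost (f g) (upd s i l') + loop l' (run (f g) (upd s i l'))).+1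
      else 1) (s i) s
  end.

Fixpoint lcost (i : nat) (f : G -> cmd) (l : seq G) (s : store) : nat :=
  if l is g :: l' then
    (cost (f g) (upd s i l') + lcost i f l' (run (f g) (upd s i l'))).+1
  else 1.

Lemma costFor i f s : cost (For i f) s = lcost i f (s i) s.
Proof. by rewrite /=; elim: (s i) {2 4}s => //= g l IH s'; rewrite IH. Qed.

(* All loops executed by [c] from [s] make at most [B] rounds. *)
Fixpoint safe (B : nat) (c : cmd) (s : store) : Prop :=
  match c with
  | Skip | Pop _ | Push _ _ => True
  | Seq c1 c2 => safe B c1 s /\ safe B c2 (run c1 s)
  | Case i f => safe B (f (ohead (s i))) s
  | For i f => size (s i) <= B /\
    (fix loop l s :=
      if l is g :: l' then
        safe B (f g) (upd s i l') /\ loop l' (run (f g) (upd s i l'))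
      else True) (s i) s
  end.

Fixpoint lsafe B (i : nat) (f : G -> cmd) (l : seq G) (s : store) : Prop :=
  if l is g :: l' then
    safe B (f g) (upd s i l') /\ lsafe B i f l' (run (f g) (upd s i l'))
  else True.

Lemma safeFor B i f s :
  safe B (For i f) s <-> size (s i) <= B /\ lsafe B i f (s i) s.
Proof.
rewrite /=; set a := (size _ <= _); suff H l s' : (fix loop l s :=
      if l is g :: l' then
        safe B (f g) (upd s i l') /\ loop l' (run (f g) (upd s i l'))
      else True) l s' <-> lsafe B i f l s' by split=> -[? /H].
by elim: l s' => //= g l IH s'; split=> -[? /IH].
Qed.

(** The exponent depends on the program alone, since [G] is finite and the exponents of the branches
    have a maximum [E]. A loop of at most [B] rounds with a body of cost [(B + 2) ^ E] costs at most
    [B * ((B + 2) ^ E + 1) + 1], which two further factors [B + 2] absorb. *)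
Lemma cost_bound c : exists e, forall B s, safe B c s -> cost c s <= B.+2 ^ e.
Proof.
have mono B e e' : e <= e' -> B.+2 ^ e <= B.+2 ^ e' by rewrite leq_exp2l.
have pos B e : 0 < B.+2 ^ e by rewrite expn_gt0.
elim: c => [|i g|i|c1 [e1 H1] c2 [e2 H2]|i f H|i f H].
- by exists 0.
- by exists 1.
- by exists 0.
- exists (maxn e1 e2).+1 => B s [/H1 h1 /H2 h2] /=.
  have m1 := mono B _ _ (leq_maxl e1 e2); have m2 := mono B _ _ (leq_maxr e1 e2).
  by rewrite expnS; nia.
- have [e He] := fin_all_exists H; exists (\max_o e o).+1 => B s /= /He h.
  have := leq_trans h (mono B _ _ (@leq_bigmax _ e (ohead (s i)))).
  have := pos B (\max_o e o); rewrite expnS.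
  by move: (_ ^ _) (cost _ _) => X c; nia.
- have [e He] := fin_all_exists H; exists (\max_o e o).+2 => B s.
  rewrite safeFor costFor => -[sB]; set E := \max_o e o.
  suff step l s' : lsafe B i f l s' -> lcost i f l s' <= size l * (B.+2 ^ E).+1 + 1.
    move/step; have := pos B E; rewrite !expnS.
    by move: (_ ^ _) (lcost _ _ _ _) => X c; nia.
  elim: l s' => //= g l IH s' [/He h /IH]; move/leq_trans: h => /(_ _ (mono B _ _ (@leq_bigmax _ e g))).
  by rewrite -/E; move: (_ ^ _) (lcost _ _ _ _) (cost _ _) => X c c'; nia.
Qed.

(** [run] iterates over the stack as it was when the loop began, whereas a machine pops the actual
    stack in each round; the two agree when the body leaves that stack alone. *)
Fixpoint frozen (i : nat) (c : cmd) : Prop :=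
  match c with
  | Skip => True
  | Push j _ | Pop j => j != i
  | Seq c1 c2 => frozen i c1 /\ frozen i c2
  | Case _ f => forall o, frozen i (f o)
  | For j f => j != i /\ forall g, frozen i (f g)
  end.

Fixpoint wf (K : nat) (c : cmd) : Prop :=
  match c with
  | Skip => True
  | Push i _ | Pop i => i < K
  | Seq c1 c2 => wf K c1 /\ wf K c2
  | Case i f => i < K /\ forall o, wf K (f o)
  | For i f => i < K /\ forall g, wf K (f g) /\ frozen i (f g)
  end.

Lemma frozen_run i c s : frozen i c -> run c s i = s i.
Proof.
elim: c s => [|j g|j|c1 H1 c2 H2|j f H|j f H] s //=.
- by move=> ne; rewrite upd_other // eq_sym.
- by move=> ne; rewrite upd_other // eq_sym.
- by case=> h1 h2; rewrite H2 // H1.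
- by move=> h; rewrite H.
- case=> ne h; rewrite -/(run (For j f) s) runFor.
  by elim: (s j) {2 3}s => //= g l IH s'; rewrite IH H // upd_other // eq_sym.
Qed.

(* A push is [AUp] followed by [AWrite], since a machine writes before it moves. *)
Inductive act := ANone | AUp of nat | AWrite of nat & G | APop of nat.

Definition rstore := nat -> seq (option G).

Definition raw (s : store) : rstore := fun i => map some (s i).

Lemma raw_upd s i l : raw (upd s i l) = upd (raw s) i (map some l).
Proof. by apply: funext => j; rewrite /raw /upd; case: eqP. Qed.

Definition aact (a : act) (r : rstore) : rstore :=
  match a with
  | ANone => r
  | AUp i => upd r i (None :: r i)
  | AWrite i g => upd r i (Some g :: behead (r i))
  | APop i => if r i is Some _ :: l then upd r i l else r
  end.

Definition okact (K : nat) (a : act) (r : rstore) : Prop :=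
  match a with
  | ANone => True
  | AUp i | APop i => i < K
  | AWrite i _ => i < K /\ 0 < size (r i)
  end.

Definition tops (K : nat) (r : rstore) : nat -> option G :=
  fun i => if i < K then head None (r i) else None.

(** Control points. At a branching or a loop, [None] is the test itself; the letter that it reads is
    remembered by the dependent pair that selects the branch. *)
Fixpoint label (c : cmd) : finType :=
  match c with
  | Skip | Pop _ => unit
  | Push _ _ => bool
  | Seq c1 c2 => (label c1 + label c2)%type
  | Case _ f => option {o : option G & label (f o)}
  | For _ f => option {g : G & label (f g)}
  end.

Fixpoint entry (c : cmd) : label c :=
  match c return label c with
  | Skip | Pop _ => tt
  | Push _ _ => false
  | Seq c1 c2 => inl (entry c1)
  | Case _ f => None
  | For _ f => None
  end.

(* One step from a label, given the tops of the stacks: the action and the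
   next label, [None] being the end of the command. *)
Fixpoint nxt (c : cmd) (tp : nat -> option G) : label c -> act * option (label c) :=
  match c return label c -> act * option (label c) with
  | Skip => fun _ => (ANone, None)
  | Pop i => fun _ => (APop i, None)
  | Push i g => fun b => if b then (AWrite i g, None) else (AUp i, Some true)
  | Seq c1 c2 => fun l =>
    match l with
    | inl l1 => let: (a, o) := nxt tp l1 in
        (a, Some (if o is Some l' then inl l' else inr (entry c2)))
    | inr l2 => let: (a, o) := nxt tp l2 in (a, omap inr o)
    end
  | Case i f => fun l =>
    if l is Some (existT o l1) then
      let: (a, o') := nxt tp l1 in
      (a, omap (fun l' => Some (existT (fun o => label (f o)) o l')) o')
    else (ANone, Some (Some (existT (fun o => label (f o)) (tp i) (entry (f (tp i))))))
  | For i f => fun l =>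
    if l is Some (existT g l1) then
      let: (a, o') := nxt tp l1 in
      (a, Some (omap (existT (fun g => label (f g)) g) o'))
    else if tp i is Some g then
      (APop i, Some (Some (existT (fun g => label (f g)) g (entry (f g)))))
    else (ANone, None)
  end.

Inductive creach (K : nat) (c : cmd) (l : label c) (r : rstore) :
  nat -> option (label c) -> rstore -> Prop :=
| creach0 : creach K l r 0 (Some l) r
| creachS n l1 r1 : creach K l r n (Some l1) r1 ->
    okact K (nxt (tops K r1) l1).1 r1 ->
    creach K l r n.+1 (nxt (tops K r1) l1).2 (aact (nxt (tops K r1) l1).1 r1).

Lemma creachS' K c (l : label c) r n l1 r1 a o :
  creach K l r n (Some l1) r1 -> nxt (tops K r1) l1 = (a, o) -> okact K a r1 ->
  creach K l r n.+1 o (aact a r1).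
Proof. by move=> h e ok; have := creachS h; rewrite e; apply. Qed.

Lemma creach_trans K c (l : label c) r n l1 r1 n' o r2 :
  creach K l r n (Some l1) r1 -> creach K l1 r1 n' o r2 ->
  creach K l r (n + n') o r2.
Proof.
move=> h; elim=> [|n2 l2 r3 _ IH ok]; first by rewrite addn0.
by rewrite addnS; apply: creachS.
Qed.

(** Embeds the run of a subcommand into the command around it: [h] carries its labels over, and [ex]
    is where control goes when the subcommand ends. *)
Lemma creach_map K c c' (h : label c -> label c') (ex : option (label c'))
    (l : label c) r n o r' :
  (forall tp l1, nxt tp (h l1) =
     ((nxt tp l1).1, if (nxt tp l1).2 is Some l' then Some (h l') else ex)) ->
  creach K l r n o r' ->
  creach K (h l) r n (if o is Some l' then Some (h l') else ex) r'.
Proof.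
move=> H; elim=> [|n1 l1 r1 _ IH ok]; first exact: creach0.
by apply: creachS' IH _ ok; rewrite H.
Qed.

Lemma raw_pop (s : store) i :
  raw (upd s i (behead (s i))) = aact (APop i) (raw s).
Proof.
rewrite raw_upd /=; have -> : raw s i = map some (s i) by [].
case e: (s i) => [|g l] //=.
by rewrite -{2}(upd_id (raw s) i) /raw e.
Qed.

Lemma cmd_creach K c s : wf K c ->
  creach K (entry c) (raw s) (cost c s) None (raw (run c s)).
Proof.
elim: c s => [|i g|i|c1 H1 c2 H2|i f H|i f H] s.
- by move=> _; apply: (@creachS' K Skip _ _ 0 tt _ ANone None (creach0 _ _ _)).
- move=> iK; rewrite [run _ _]/= raw_upd.
  have -> : upd (raw s) i [seq Some i | i <- g :: s i] =
    aact (AWrite i g) (aact (AUp i) (raw s)).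
    by rewrite /= upd_upd upd_same.
  apply: (@creachS' K (Push i g) _ _ 1 true _ (AWrite i g) None) => //; last by rewrite /= upd_same.
  by apply: (@creachS' K (Push i g) _ _ 0 false _ (AUp i) _ (creach0 _ _ _)).
- move=> iK; rewrite [run _ _]/= raw_pop.
  by apply: (@creachS' K (Pop i) _ _ 0 tt _ (APop i) None (creach0 _ _ _)).
- case=> w1 w2 /=.
  apply: (@creach_trans K (Seq c1 c2) _ _ _ (inr (entry c2)) (raw (run c1 s))).
    apply: (@creach_map K c1 (Seq c1 c2) inl (Some (inr (entry c2)))
      _ _ _ None _ _ (H1 s w1)) => tp l1 /=.
    by case: (nxt tp l1) => a [].
  apply: (@creach_map K c2 (Seq c1 c2) inr None _ _ _ None _ _ (H2 _ w2)) => tp l1 /=.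
  by case: (nxt tp l1) => a [].
- case=> iK w /=; set o := ohead _.
  have to : tops K (raw s) i = o.
    by rewrite /tops iK /o /raw; case: (s i).
  have e : @creach K (Case i f) None (raw s) 1
      (Some (Some (existT (fun o => label (f o)) o (entry (f o))))) (raw s).
    by apply: (@creachS' K (Case i f) _ _ 0 None _ ANone _ (creach0 _ _ _)) => //=; rewrite to.
  rewrite -add1n; apply: creach_trans e _.
  apply: (@creach_map K (f o) (Case i f)
    (fun l => Some (existT (fun o => label (f o)) o l)) None
    _ _ _ None _ _ (H o s (w o))) => tp l1 /=.
  by case: (nxt tp l1) => a [].
- case=> iK w; rewrite runFor costFor.
  suff gen l s' : s' i = l ->
      @creach K (For i f) None (raw s') (lcost i f l s') None (raw (loop i f l s')).
    exact: gen.
  elim: l s' => [|g l IH] s' e /=.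
    by apply: (@creachS' K (For i f) _ _ 0 None _ ANone _ (creach0 _ _ _)) => //=; rewrite /tops iK /raw e.
  have e1 : @creach K (For i f) None (raw s') 1
      (Some (Some (existT (fun g => label (f g)) g (entry (f g))))) (raw (upd s' i l)).
    have -> : raw (upd s' i l) = aact (APop i) (raw s').
      by rewrite -raw_pop e.
    by apply: (@creachS' K (For i f) _ _ 0 None _ (APop i) _ (creach0 _ _ _)) => //=; rewrite /tops iK /raw e.
  rewrite -add1n; apply: creach_trans e1 _.
  have [wg fg] := w g.
  apply: (@creach_trans K (For i f) _ _ _ None (raw (run (f g) (upd s' i l)))).
    apply: (@creach_map K (f g) (For i f)
      (fun l => Some (existT (fun g => label (f g)) g l)) (Some None)
      _ _ _ None _ _ (H g _ wg)) => tp l1 /=.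
    by case: (nxt tp l1) => a [].
  (* The body has not touched stack [i], so the rest [l] is still there for the next round. *)
  by apply: IH; rewrite frozen_run // upd_same.
Qed.

End Language.

(** * Compilation to Turing machines *)

Definition dir_code (d : dir) : 'I_3 :=
  match d with
  | MLeft => @Ordinal 3 0 isT | MStay => @Ordinal 3 1 isT | MRight => @Ordinal 3 2 isT
  end.

Lemma dir_codeK : cancel dir_code (fun i : 'I_3 => nth MLeft [:: MLeft; MStay; MRight] i).
Proof. by case. Qed.

HB.instance Definition _ := Countable.copy dir (can_type dir_codeK).
HB.instance Definition _ : isFinite dir := CanIsFinite dir_codeK.

(** * Computations of nondeterministic machines *)

Section Runs.
Variables (G : finType) (M : machine G).

Lemma reaches_trans (c d : config M) n e n' :
  reaches c n d -> reaches d n' e -> reaches c (n + n') e.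
Proof.
move=> h; elim=> [|n2 e2 a _ IH tr]; first by rewrite addn0.
by rewrite addnS; apply: reachesS.
Qed.

(** Termination within [t] steps together with a property of all final configurations, in a form
    that can be built backwards from the end of a computation. *)
Fixpoint all_runs (Q : config M -> Prop) (t : nat) (c : config M) : Prop :=
  (halted c -> Q c) /\
  forall a, trans (cstate c) (scanned c) a ->
    if t is t'.+1 then all_runs Q t' (apply_action c a) else False.

Lemma all_runs_reaches Q t c n d :
  all_runs Q t c -> reaches c n d -> n <= t /\ all_runs Q (t - n) d.
Proof.
move=> h; elim=> [|n2 e a _ [le IH] tr]; first by rewrite subn0.
move: IH; case E: (t - n2) => [|t'] [_ /(_ _ tr)] // H.
have -> : t - n2.+1 = t' by lia.
by split=> //; lia.
Qed.

Lemma all_runs_halted Q t c : all_runs Q t c -> halted c -> Q c.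
Proof. by case: t => [|t] []. Qed.

Lemma all_runs_det Q t c a :
  trans (cstate c) (scanned c) a ->
  (forall b, trans (cstate c) (scanned c) b -> b = a) ->
  all_runs Q t (apply_action c a) -> all_runs Q t.+1 c.
Proof. by move=> tr u h; split=> [/(_ a)|b /u ->]; rewrite ?tr. Qed.

Lemma all_runs_leq Q t t' c : t <= t' -> all_runs Q t c -> all_runs Q t' c.
Proof.
elim: t t' c => [|t IH] [|t'] c //= le [h1 h2]; split=> // a /h2 //.
exact: IH.
Qed.

(** The second component expresses that every computation from [c] passes through [d]: what is known
    of all computations from [d] transfers to [c], at the price of [n] steps. *)
Definition det_reach (c : config M) n d :=
  reaches c n d /\ forall Q t, all_runs Q t d -> all_runs Q (n + t) c.

Lemma det_reach_trans c n d n' e :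
  det_reach c n d -> det_reach d n' e -> det_reach c (n + n') e.
Proof.
case=> r1 a1 [r2 a2]; split; first exact: reaches_trans r1 r2.
by move=> Q t /a2 /a1; rewrite addnA.
Qed.

Lemma det_reach0 c : det_reach c 0 c.
Proof. by split=> //; apply: reaches0. Qed.

Lemma det_reach1 c a :
  (forall b, trans (cstate c) (scanned c) b <-> b = a) ->
  det_reach c 1 (apply_action c a).
Proof.
move=> H; split; first by apply: reachesS (reaches0 _) _; rewrite H.
move=> Q t h; rewrite add1n; apply: all_runs_det h; first by rewrite H.
by move=> b /H.
Qed.

End Runs.

(** * The machine of a program *)

Section Compile.
Variables (G : finType) (k : nat) (ch : pred G).
Variables (c1 : cmd G) (rg ry : nat) (c2 : cmd G) (rf : nat).
Let K := k.+2.

(** The control runs [c1], trades each letter of stack [rg] for a guessed letter satisfying [ch] on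
    stack [ry], runs [c2], and accepts when stack [rf] is not empty. With an empty [ch] the machine
    is deterministic. *)
Inductive mstate :=
| Setup | Run1 of label c1 | GLoop | GUp | GWrite | Run2 of label c2 | Exit
| Fin of bool.

Definition mstate_code (q : mstate) : ('I_5 + (label c1 + (label c2 + bool)))%type :=
  match q with
  | Setup => inl (@Ordinal 5 0 isT) | GLoop => inl (@Ordinal 5 1 isT)
  | GUp => inl (@Ordinal 5 2 isT) | GWrite => inl (@Ordinal 5 3 isT)
  | Exit => inl (@Ordinal 5 4 isT)
  | Run1 l => inr (inl l) | Run2 l => inr (inr (inl l))
  | Fin b => inr (inr (inr b))
  end.

Definition mstate_decode (x : ('I_5 + (label c1 + (label c2 + bool)))%type) : mstate :=
  match x with
  | inl i => nth Setup [:: Setup; GLoop; GUp; GWrite; Exit] i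
  | inr (inl l) => Run1 l | inr (inr (inl l)) => Run2 l
  | inr (inr (inr b)) => Fin b
  end.

Lemma mstate_codeK : cancel mstate_code mstate_decode.
Proof. by case. Qed.

HB.instance Definition _ := Countable.copy mstate (can_type mstate_codeK).
HB.instance Definition _ : isFinite mstate := CanIsFinite mstate_codeK.

(* The head of tape [i] scans the top of stack [i]. The stack of tape 0 grows to
   the left, so that the input is initially a stack with its first letter on top;
   the other stacks grow to the right. *)
Definition updir (i : nat) : dir := if i == 0 then MLeft else MRight.
Definition downdir (i : nat) : dir := if i == 0 then MRight else MLeft.

Definition tact (a : act G) (x : option G) (i : nat) : option G * dir :=
  match a with
  | ANone => (x, MStay)
  | AUp j => (x, if i == j then updir i else MStay)
  | AWrite j g => (if i == j then Some g else x, MStay)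
  | APop j => if (i == j) && (x != None) then (None, downdir i) else (x, MStay)
  end.

Definition tacts (a : act G) (sc : {ffun 'I_K -> option G}) :
    {ffun 'I_K -> option G * dir} :=
  [ffun i => tact a (sc i) i].

Definition stops (sc : {ffun 'I_K -> option G}) : nat -> option G :=
  fun i => if insub i is Some j then sc j else None.

(** [Setup] moves the heads of the tapes other than 0 to cell -1, which is where the head of an
    empty stack stands. *)
Definition mtrans (q : mstate) (sc : {ffun 'I_K -> option G}) :
    pred (mstate * {ffun 'I_K -> option G * dir}) := fun b =>
  let tp := stops sc in
  match q with
  | Setup => b == (Run1 (entry c1),
      [ffun i : 'I_K => (sc i, if i == 0 :> nat then MStay else MLeft)])
  | Run1 l => b == (if (nxt tp l).2 is Some l' then Run1 l' else GLoop,
                    tacts (nxt tp l).1 sc)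
  | GLoop => b == (if tp rg is Some _ then GUp else Run2 (entry c2),
                   tacts (APop G rg) sc)
  | GUp => b == (GWrite, tacts (AUp G ry) sc)
  | GWrite => [exists g, ch g && (b == (GLoop, tacts (AWrite ry g) sc))]
  | Run2 l => b == (if (nxt tp l).2 is Some l' then Run2 l' else Exit,
                    tacts (nxt tp l).1 sc)
  | Exit => b == (Fin (tp rf != None), tacts (ANone G) sc)
  | Fin _ => false
  end.

Definition compiled : machine G :=
  @Machine G k.+1 mstate Setup (fun q => if q is Fin b then b else false) mtrans.

Lemma compiled_deterministic : ch =1 pred0 -> deterministic compiled.
Proof.
move=> ch0 q sc a b; rewrite /trans /=; case: q => //=;
  do ?[by move=> /eqP -> /eqP -> | by move=> l /eqP -> /eqP ->].
by case/existsP=> g; rewrite ch0.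
Qed.

Definition cell (i : nat) (l : seq (option G)) (h z : int) : option G :=
  if (if i == 0 then (z - h)%R else (h - z)%R) is Posz n then nth None l n else None.

(** For the tapes other than 0 the height of the stack determines the head position, so that the
    bottom lies on cell 0; this places the output correctly. *)
Definition rep (r : rstore G) (c : config compiled) : Prop :=
  forall i : 'I_K, (forall z, ctape c i z = cell i (r i) (chead c i) z) /\
    (i != 0 :> nat -> chead c i = (Posz (size (r i)) - 1)%R).

Lemma rep_scanned r c (i : 'I_K) : rep r c -> scanned c i = head None (r i).
Proof.
move=> /(_ i) [H _]; rewrite ffunE H /cell subrr if_same /=.
by case: (r i).
Qed.

Lemma rep_tops r c : rep r c -> stops (scanned c) = tops K r.
Proof.
move=> H; apply: funext => i; rewrite /stops /tops.
by case: insubP => [j -> <-|/negbTE ->] //; rewrite (rep_scanned _ H).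
Qed.

Lemma rep_act r c q a : rep r c -> okact K a r ->
  rep (aact a r) (apply_action c (q, tacts a (scanned c))).
Proof.
move=> H ok i; have [Hz Hh] := H i; have Hs := rep_scanned i H.
rewrite ffunE in Hs; rewrite /= /tacts !ffunE Hs.
have same (x : seq (option G)) : x = r i ->
  (forall z : int, (if z == chead c i then head None (r i) else ctape c i z) =
   cell i x (shift (chead c i) MStay) z) /\
  (i != 0 :> nat -> shift (chead c i) MStay = (Posz (size x) - 1)%R).
  move=> ->; split=> [z|/Hh] //; case: eqP => [->|_]; rewrite ?Hz //.
  by rewrite /cell subrr if_same; case: (r i).
case: a ok => [|j|j g|j] /=.
- by move=> _; exact: same.
- rewrite /upd; case: (eqVneq (i : nat) j) => [e|_] jK; last exact: same.
  subst j.
  split=> [z|ne]; last by rewrite /updir (negbTE ne) /= Hh //; lia.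
  rewrite {1}/cell Hz /updir /cell; case: eqP => [->|zh].
    case: eqP => _ /=.
      have -> : (chead c i - (chead c i - 1) = Posz 1)%R by lia.
      by case: (r i).
    have -> : (chead c i + 1 - chead c i = Posz 1)%R by lia.
    by case: (r i).
  case: eqP => _ /=.
    case e: (z - chead c i)%R => [n|n].
      by have -> : (z - (chead c i - 1) = Posz n.+1)%R by lia.
    by case e': (z - (chead c i - 1))%R => [[|n']|n'] //; lia.
  case e: (chead c i - z)%R => [n|n].
    by have -> : (chead c i + 1 - z = Posz n.+1)%R by lia.
  by case e': (chead c i + 1 - z)%R => [[|n']|n'] //; lia.
- rewrite /upd; case: (eqVneq (i : nat) j) => [e|_] [jK ri]; last exact: same.
  subst j.
  split=> [z|ne] /=; last by rewrite Hh //; case: (r i) ri.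
  case: eqP => [->|zh]; first by rewrite /cell subrr if_same.
  rewrite Hz /cell.
  have nthb n : nth None (Some g :: behead (r i)) n.+1 = nth None (r i) n.+1.
    by case: (r i) ri => //=.
  case: eqP => _.
    by case e: (z - chead c i)%R => [[|n]|n] //; lia.
  by case e: (chead c i - z)%R => [[|n]|n] //; lia.
- rewrite /upd; case: (eqVneq (i : nat) j) => [e|ne] jK /=; last first.
    case: (r j) => [|[x|] l]; try exact: same.
    by rewrite (negbTE ne); apply: same.
  subst j; case e: (r i) => [|[x|] l] /=;
    try by have := same _ (erefl _); rewrite /= {1}e.
  rewrite eqxx; split=> [z|ne0]; last first.
    by rewrite /downdir (negbTE ne0) /= Hh // e /=; lia.
  rewrite Hz e /downdir /cell; case: eqP => [->|zh].
    case: eqP => _ /=.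
      by have -> : (chead c i - (chead c i + 1) = Negz 0)%R by lia.
    by have -> : (chead c i - 1 - chead c i = Negz 0)%R by lia.
  case: eqP => _ /=.
    case e1: (z - chead c i)%R => [[|n]|n]; first by lia.
      by have -> : (z - (chead c i + 1) = Posz n)%R by lia.
    by have -> : (z - (chead c i + 1) = Negz n.+1)%R by lia.
  case e1: (chead c i - z)%R => [[|n]|n]; first by lia.
    by have -> : (chead c i - 1 - z = Posz n)%R by lia.
  by have -> : (chead c i - 1 - z = Negz n.+1)%R by lia.
Qed.

Lemma det_step (d : config compiled) r q a :
  rep r d -> okact K a r ->
  (forall b, mtrans (cstate d) (scanned d) b = (b == (q, tacts a (scanned d)))) ->
  exists d', [/\ det_reach d 1 d', cstate d' = q & rep (aact a r) d'].
Proof.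
move=> rd ok H; exists (apply_action d (q, tacts a (scanned d))).
split=> //; last exact: rep_act.
by apply: det_reach1 => b; rewrite /= H; split=> /eqP.
Qed.

Lemma det_cmd (c : cmd G) (emb : label c -> mstate) (ex : mstate) s
    (d : config compiled) :
  wf K c ->
  (forall l sc b, mtrans (emb l) sc b =
    (b == (if (nxt (stops sc) l).2 is Some l' then emb l' else ex,
           tacts (nxt (stops sc) l).1 sc))) ->
  cstate d = emb (entry c) -> rep (raw s) d ->
  exists d', [/\ det_reach d (cost c s) d', cstate d' = ex & rep (raw (run c s)) d'].
Proof.
move=> w H sd rd; have := cmd_creach s w.
suff gen l r n o r' : creach K l r n o r' -> cstate d = emb l -> rep r d ->
    exists d', [/\ det_reach d n d',
      cstate d' = (if o is Some l' then emb l' else ex) & rep r' d'].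
  by move=> /gen; apply.
elim=> [|n1 l1 r1 _ IH ok] sl rr; first by exists d; split=> //; exact: det_reach0.
have [d1 [R1 s1 rr1]] := IH sl rr.
have [|d2 [R2 s2 rr2]] := det_step (q := if (nxt (tops K r1) l1).2 is Some l' then emb l' else ex) rr1 ok.
  by move=> b; rewrite s1 H (rep_tops rr1).
exists d2; split=> //; rewrite -addn1; exact: det_reach_trans R1 R2.
Qed.

Definition input_store (w : seq G) : store G := fun i => if i == 0 then w else [::].

Lemma det_setup w : exists d, [/\ det_reach (init_config compiled w) 1 d,
  cstate d = Run1 (entry c1) & rep (raw (input_store w)) d].
Proof.
set c := init_config _ w.
exists (apply_action c (Run1 (entry c1), [ffun i : 'I_K =>
  (scanned c i, if i == 0 :> nat then MStay else MLeft)])); split=> //.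
  by apply: det_reach1 => b /=; split=> /eqP.
move=> i; rewrite /= !ffunE /= -(inj_eq val_inj) /=; split=> [z|ne]; last first.
  by rewrite /raw /input_store (negbTE ne).
set F := (if _ == _ then tape_of w else _).
have -> : (if z == 0%R then F 0%R else F z) = F z by case: eqP => [->|].
rewrite /F /cell /raw /input_store; case: eqP => [i0|_] /=; first by rewrite subr0.
have -> : tape_of [::] z = None :> option G by case: z => // n; rewrite /= nth_nil.
by case: (_ - z)%R => // n; rewrite nth_nil.
Qed.

Hypotheses (wf1 : wf K c1) (wf2 : wf K c2).
Hypotheses (rgK : rg < K) (ryK : ry < K) (rfK : rf < K) (rgy : ry != rg).

Lemma guess_end s (d : config compiled) : s rg = [::] -> cstate d = GLoop -> rep (raw s) d ->
  exists d', [/\ det_reach d 1 d', cstate d' = Run2 (entry c2) & rep (raw s) d'].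
Proof.
move=> e sd rd.
have [//|b|d' [R s' r']] := det_step (q := Run2 (entry c2)) (a := APop G rg) rd.
  by rewrite sd /= (rep_tops rd) /tops rgK /raw e.
by exists d'; split=> //; move: r'; rewrite -raw_pop e [behead _]/= -e upd_id.
Qed.

Lemma guess_step s (d : config compiled) x l : s rg = x :: l -> cstate d = GLoop -> rep (raw s) d ->
  exists d', [/\ det_reach d 2 d', cstate d' = GWrite,
    (forall g, rep (raw (upd (upd s rg l) ry (g :: s ry)))
      (apply_action d' (GLoop, tacts (AWrite ry g) (scanned d')))) &
    forall b, mtrans (cstate d') (scanned d') b ->
      exists2 g, ch g & b = (GLoop, tacts (AWrite ry g) (scanned d'))].
Proof.
move=> e sd rd.
have [//|b|d1 [R1 s1 r1]] := det_step (q := GUp) (a := APop G rg) rd.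
  by rewrite sd /= (rep_tops rd) /tops rgK /raw e.
rewrite -raw_pop e /= in r1.
have [//|b|d2 [R2 s2 r2]] := det_step (q := GWrite) (a := AUp G ry) r1.
  by rewrite s1.
exists d2; split=> //; first exact: det_reach_trans R1 R2.
  move=> g; have := rep_act GLoop (a := AWrite ry g) r2.
  rewrite /= upd_upd upd_same /= => /(_ (conj ryK isT)).
  by rewrite {2}/raw upd_other // [raw (upd _ ry _)]raw_upd.
by move=> b; rewrite s2 => /existsP [g /andP [cg /eqP ->]]; exists g.
Qed.

Lemma guess_some s (d : config compiled) y : cstate d = GLoop -> rep (raw s) d ->
  size y = size (s rg) -> all ch y ->
  exists d', [/\ reaches d (3 * size (s rg)).+1 d', cstate d' = Run2 (entry c2) &
    rep (raw (upd (upd s rg [::]) ry (y ++ s ry))) d'].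
Proof.
move e: (s rg) => l; elim: l s e d y => [|x l IH] s e d y sd rd.
  move=> /size0nil -> _; have [d' [[R _] s' r']] := guess_end e sd rd.
  exists d'; split=> //=; rewrite (_ : upd _ _ _ = s) //.
  by rewrite -e upd_id upd_id.
(* The letter guessed first ends up deepest, so it is the last letter of [y]. *)
case/lastP: y => [//|y g]; rewrite size_rcons all_rcons => -[sy] /andP [cg cy].
have [d1 [[R1 _] s1 r1 _]] := guess_step e sd rd.
have tr : mtrans (cstate d1) (scanned d1) (GLoop, tacts (AWrite ry g) (scanned d1)).
  by rewrite s1; apply/existsP; exists g; rewrite cg eqxx.
have [||d2 [R2 s2 r2]] := IH _ _ _ y _ (r1 g) sy cy.
- by rewrite upd_other 1?eq_sym // upd_same.
- by [].
exists d2; split=> //.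
  have -> : (3 * size (x :: l)).+1 = 2 + (1 + (3 * size l).+1) by rewrite /=; lia.
  apply: reaches_trans R1 _; apply: reaches_trans R2.
  by apply: reachesS (reaches0 _) _.
move: r2; rewrite upd_same cat_rcons (updC _ _ _ _ (i := ry)) //.
by rewrite upd_upd upd_upd (updC _ _ _ _ (i := rg)) 1?eq_sym.
Qed.

Lemma guess_all s (d : config compiled) Q t : cstate d = GLoop -> rep (raw s) d ->
  (s rg <> [::] -> exists g, ch g) ->
  (forall y (d' : config compiled), size y = size (s rg) -> all ch y -> cstate d' = Run2 (entry c2) ->
    rep (raw (upd (upd s rg [::]) ry (y ++ s ry))) d' -> all_runs Q t d') ->
  all_runs Q ((3 * size (s rg)).+1 + t) d.
Proof.
move e: (s rg) => l; elim: l s e d => [|x l IH] s e d sd rd inh H.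
  have [d' [[_ A] s' r']] := guess_end e sd rd.
  apply: A; apply: (H [::]) => //=.
  by rewrite -e upd_id upd_id.
have [d1 [[_ A] s1 r1 tr1]] := guess_step e sd rd.
have -> : (3 * size (x :: l)).+1 + t = 2 + ((3 * size l).+1 + t).+1 by rewrite /=; lia.
apply: A; split.
  (* Without a letter to guess, the machine would halt at this point. *)
  have [//|g cg] := inh; move=> /(_ (GLoop, tacts (AWrite ry g) (scanned d1))) /=.
  by rewrite s1 => /existsP []; exists g; rewrite cg eqxx.
move=> a /tr1 [g cg ->]; apply: (IH (upd (upd s rg l) ry (g :: s ry))).
- by rewrite upd_other 1?eq_sym // upd_same.
- by [].
- exact: r1.
- by move=> _; exists g.
move=> y d' sy cy s' r'; apply: (H (rcons y g)) => //.
- by rewrite size_rcons sy.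
- by rewrite all_rcons cg.
move: r'; rewrite upd_same cat_rcons (updC _ _ _ _ (i := ry)) //.
by rewrite upd_upd upd_upd (updC _ _ _ _ (i := rg)) 1?eq_sym.
Qed.

Definition guess_store (s : store G) (y : seq G) : store G :=
  upd (upd s rg [::]) ry (y ++ s ry).

Definition final (w y : seq G) : store G :=
  run c2 (guess_store (run c1 (input_store w)) y).

Definition final_config (w y : seq G) (d : config compiled) : Prop :=
  [/\ halted d, cstate d = Fin (final w y rf != [::]) & rep (raw (final w y)) d].

Lemma det_final (d : config compiled) w y : cstate d = Run2 (entry c2) ->
  rep (raw (guess_store (run c1 (input_store w)) y)) d ->
  exists d', det_reach d (cost c2 (guess_store (run c1 (input_store w)) y)).+1 d' /\
    final_config w y d'.
Proof.
move=> sd rd; have [//|d1 [R1 s1 r1]] := det_cmd (emb := Run2) (ex := Exit) wf2 _ sd rd.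
have [//|b|d2 [R2 s2 r2]] := det_step (q := Fin (final w y rf != [::])) (a := ANone G) r1.
  rewrite s1 /= (rep_tops r1) /tops rfK -/(final w y) /raw.
  by case: (final w y rf).
exists d2; rewrite -addn1; split; first exact: det_reach_trans R1 R2.
by split=> // a; rewrite /trans /= s2.
Qed.

Let guesses w := run c1 (input_store w) rg.

Theorem compiled_some w y : size y = size (guesses w) -> all ch y ->
  exists n d, reaches (init_config compiled w) n d /\ final_config w y d.
Proof.
move=> sy cy; have [d0 [[R0 _] s0 r0]] := det_setup w.
have [//|d1 [[R1 _] s1 r1]] := det_cmd (emb := Run1) (ex := GLoop) wf1 _ s0 r0.
have [d2 [R2 s2 r2]] := guess_some s1 r1 sy cy.
have [d3 [[R3 _] F]] := det_final s2 r2.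
have R := reaches_trans R0 (reaches_trans R1 (reaches_trans R2 R3)).
by eexists; exists d3; split; first exact: R.
Qed.

Theorem compiled_all w t :
  (guesses w <> [::] -> exists g, ch g) ->
  (forall y, size y = size (guesses w) -> all ch y ->
     cost c2 (guess_store (run c1 (input_store w)) y) <= t) ->
  all_runs (fun d => exists y, [/\ size y = size (guesses w), all ch y & final_config w y d])
    (cost c1 (input_store w) + 3 * size (guesses w) + t + 3) (init_config compiled w).
Proof.
move=> inh ct; have [d0 [[_ A0] s0 r0]] := det_setup w.
have [//|d1 [[_ A1] s1 r1]] := det_cmd (emb := Run1) (ex := GLoop) wf1 _ s0 r0.
set c := cost _ _ in A1 *; set m := size _.
(* One step of setup, three per guessed letter (pop, move, write), one to leave the loop, and one to
   reach the verdict. *)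
have -> : c + 3 * m + t + 3 = 1 + (c + ((3 * m).+1 + t.+1)) by lia.
apply: A0; apply: A1; apply: (guess_all s1 r1) => // y d' sy cy s' r'.
have [d3 [[_ A3] F]] := det_final s' r'.
rewrite -(addn0 t.+1); apply: (@all_runs_leq _ _ _ ((cost c2 (guess_store (run c1 (input_store w)) y)).+1 + 0)).
  by rewrite leq_add2r ltnS ct.
apply: A3; split; first by exists y.
by case: F => h _ _ a tr; have := h a; rewrite tr.
Qed.

End Compile.

Lemma leq_expl m n e : m <= n -> m ^ e <= n ^ e.
Proof. by case: e => // e mn; rewrite leq_exp2r. Qed.

(** * Complexity bounds for compiled programs *)

Section Programs.
Variables (S G : finType) (i : S -> G).
Hypothesis i_inj : injective i.

(** The number of guesses is the height of stack [rg] after [c1]. Loops and guesses are thus bounded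
    by the same [2 ^ (a * (n + 1))], and a fixed power of it is below [2 ^ (n ^ 2)] for large
    [n]. *)
Lemma NEXPTIME_program (L : language S) k c1 rg ry c2 rf a :
  let B n := 2 ^ (a * n.+1) in
  let st x := run c1 (input_store (map i x)) in
  [/\ wf k.+2 c1, wf k.+2 c2 & rg < k.+2] -> [/\ ry < k.+2, rf < k.+2 & ry != rg] ->
  (forall x, safe (B (size x)) c1 (input_store (map i x))) ->
  (forall x, size (st x rg) <= B (size x)) ->
  (forall x y, size y = size (st x rg) ->
    safe (B (size x)) c2 (guess_store rg ry (st x) y)) ->
  (forall x, L x <-> exists2 y, size y = size (st x rg) &
    final c1 rg ry c2 (map i x) y rf <> [::]) ->
  NEXPTIME L.
Proof.
move=> B st [w1 w2 rgK] [ryK rfK rgy] s1 sg s2 HL.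
have [e1 E1] := cost_bound c1; have [e2 E2] := cost_bound c2.
set E := (e1 + e2).+1 * a.+2.
pose T n := (B n).+2 ^ e1 + 3 * B n + (B n).+2 ^ e2 + 3.
have all x : all_runs (fun d => exists y,
    [/\ size y = size (st x rg), all predT y & final_config (map i x) y d])
  (T (size x)) (init_config (compiled k predT c1 rg ry c2 rf) (map i x)).
  apply: all_runs_leq; last first.
    apply: (@compiled_all _ _ _ _ _ _ _ _ w1 w2 rgK ryK rfK rgy _ ((B (size x)).+2 ^ e2)).
      by case: (run _ _ _) => // g; exists g.
    by move=> y sy _; apply/E2/s2.
  rewrite /T !leq_add2r leq_add //; first exact/E1/s1.
  by rewrite leq_mul2l sg.
exists 2, G, i, (compiled k predT c1 rg ry c2 rf), T; split=> //.
(* The summands of [T] have coefficients 1, 3, 1 and 3, which gives 8; from [2 * E] on, the exponent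
   [E * (n + 1)] is at most [n ^ 2]. *)
- exists 8, (2 * E) => n nE.
  have ME : B n <= (B n).+2 ^ (e1 + e2).+1.
    apply: (@leq_trans ((B n).+2 ^ 1)); first by rewrite expn1; lia.
    by rewrite leq_exp2l.
  have M1 : (B n).+2 ^ e1 <= (B n).+2 ^ (e1 + e2).+1 by rewrite leq_exp2l //; lia.
  have M2 : (B n).+2 ^ e2 <= (B n).+2 ^ (e1 + e2).+1 by rewrite leq_exp2l //; lia.
  have M3 : 0 < (B n).+2 ^ (e1 + e2).+1 by rewrite expn_gt0.
  have M4 : (B n).+2 <= 2 ^ (a.+2 * n.+1).
    rewrite -addn2 mulSn mulSn addnA expnD -/(B n) mulnC.
    have P : 0 < B n by rewrite expn_gt0.
    apply: (@leq_trans (B n * 4)); first by lia.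
    by rewrite leq_mul2l (@leq_exp2l 2 2) ?orbT //; lia.
  have M5 : (B n).+2 ^ (e1 + e2).+1 <= 2 ^ (n ^ 2).
    apply: (@leq_trans ((2 ^ (a.+2 * n.+1)) ^ (e1 + e2).+1)); first by rewrite leq_exp2r.
    rewrite -expnM leq_exp2l //; rewrite /E in nE.
    by move: nE; move: (e1 + e2).+1 a.+2 => u v; rewrite expnS expn1; nia.
  by rewrite /T; lia.
- by move=> x n c /(all_runs_reaches (all x)) [].
move=> x; rewrite HL; split=> [[y sy fy]|[n [c [R h ac]]]].
  have [n [d [R [hd sd _]]]] := @compiled_some _ k predT _ _ _ _ rf w1 w2 rgK ryK rfK rgy _ _ sy (all_predT _).
  exists n, d; split=> //; rewrite sd /=; exact/eqP.
have [_ /all_runs_halted/(_ h) [y [sy _ [_ sc _]]]] := all_runs_reaches (all x) R.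
by exists y => //; apply/eqP; move: ac; rewrite sc.
Qed.

Variables (D : finType) (o : D -> G).
Hypothesis o_inj : injective o.

(** The compiled program without a guess: stack 0 is empty when [c] ends, and as counter of the
    guesses it makes the guessing loop exit at once. The output stack has its bottom on cell 0 and
    its top at the right end, whence the reversal. *)
Lemma polytime_program (f : seq S -> seq D) k c a b :
  let B n := a * n.+1 ^ b in
  wf k.+2 c ->
  (forall x, safe (B (size x)) c (input_store (map i x))) ->
  (forall x, run c (input_store (map i x)) 0 = [::]) ->
  (forall x, run c (input_store (map i x)) k.+1 = rev (map o (f x))) ->
  polytime_computable f.
Proof.
move=> B w s1 g0 out.
have [e1 E1] := cost_bound c.
pose T n := (B n).+2 ^ e1 + 4.
have all x : all_runs (fun d => exists y,
    [/\ size y = size (run c (input_store (map i x)) 0), all pred0 y &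
      @final_config G k pred0 c 0 1 (Skip G) 0 (map i x) y d])
  (T (size x)) (init_config (compiled k pred0 c 0 1 (Skip G) 0) (map i x)).
  apply: all_runs_leq; last first.
    apply: (@compiled_all _ _ pred0 c 0 1 (Skip G) 0 w _ _ _ _ _ _ 1) => //.
  by rewrite /= (g0 x) muln0 addn0 /T -addnA leq_add2r; apply/E1/s1.
exists G, i, o, (compiled k pred0 c 0 1 (Skip G) 0), T, (b * e1 + e1).
split; first by split=> //; exact: compiled_deterministic.
split.
- exists ((2 ^ b * (a + 2)) ^ e1 + 4), (a + 3) => n na.
  have n0 : 0 < n by lia.
  have M1 : (B n).+2 <= 2 ^ b * (a + 2) * n ^ b.
    have : n.+1 ^ b <= (2 * n) ^ b by apply: leq_expl; lia.
    have : 0 < (2 * n) ^ b by rewrite expn_gt0; lia.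
    by rewrite /B expnMn; move: (n.+1 ^ b) (n ^ b) (2 ^ b) => X Y Z; nia.
  have M2 : (B n).+2 ^ e1 <= (2 ^ b * (a + 2)) ^ e1 * n ^ (b * e1 + e1).
    apply: (@leq_trans ((2 ^ b * (a + 2) * n ^ b) ^ e1)); first exact: leq_expl.
    by rewrite expnMn -expnM leq_mul2l expnD leq_pmulr ?orbT // expn_gt0 n0.
  have : 0 < n ^ (b * e1 + e1) by rewrite expn_gt0 n0.
  by rewrite /T mulnDl; lia.
- by move=> x n d /(all_runs_reaches (all x)) [].
move=> x; have sy : size (Nil G) = size (run c (input_store (map i x)) 0) by rewrite g0.
have [n [d [R [hd sd rd]]]] :=
  @compiled_some _ k pred0 c 0 1 (Skip G) 0 w I isT isT isT isT (map i x) [::] sy isT.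
exists n, d; split=> // z; have [Hz Hh] := rd ord_max.
rewrite Hz Hh // /cell /=.
have -> : raw (final c 0 1 (Skip G) (map i x) [::]) k.+1 = rev (map some (map o (f x))).
  by rewrite /raw /final /guess_store /= -{1}(g0 x) !upd_id out map_rev.
rewrite size_rev !size_map; set v := f x.
case: z => [j|j].
  case: (ltnP j (size v)) => jv.
    have -> : (Posz (size v) - 1 - Posz j = Posz (size v - j.+1))%R by lia.
    rewrite nth_rev !size_map; last by lia.
    by congr nth; lia.
  case e: (Posz (size v) - 1 - Posz j)%R => [m|m]; first by lia.
  by rewrite /= nth_default // !size_map.
have -> : (Posz (size v) - 1 - Negz j)%R = Posz (size v + j)%N by lia.
by rewrite nth_default // size_rev !size_map; lia.
Qed.

End Programs.

(** * Terms with tuples as lists *)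

Lemma ad_memE (A : Type) k (Q : seq A -> Prop) t :
  ad_mem t (@ADRel A k (fun u => Q u)) <-> size t = k /\ Q t.
Proof.
split=> [[u Qu <-]|[/eqP e Qt]]; first by split=> //; exact: size_tuple.
by exists (Tuple e).
Qed.

Lemma ad_mem_neg (A : Type) (r : adrel A) t :
  ad_mem t (ad_neg r) <-> size t = adarity r /\ ~ ad_mem t r.
Proof.
split=> [[u Qu <-]|[/eqP e Qt]].
  split=> [|[v Qv /val_inj e]]; first exact: size_tuple.
  by apply: Qu; rewrite -e.
by exists (Tuple e) => // Q; apply: Qt; exists (Tuple e).
Qed.

(** Projecting away the last component makes [b] the last one, so [Ex T1] at [(a, b)] quantifies
    over the pairs that begin with [b]. Its value does not depend on [a], and existential subterms
    behave as unary predicates. *)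
Fixpoint sem (M : model) (T : term) (a b : dom M) : Prop :=
  match T with
  | Rel R => ad_mem (drop (2 - symarity R) [:: a; b]) (ADRel (@interp M R))
  | Eqt => a = b
  | Swap T1 => if ar T1 == 2 then sem T1 b a else sem T1 a b
  | Neg T1 => ~ sem T1 a b
  | Cap T1 T2 => sem T1 a b /\ sem T2 a b
  | Ex T1 => exists c, sem T1 b c
  end.

Lemma GRA2_ar T : GRA2 T -> ar T <= 2.
Proof.
elim: T => //= [R|T1 IH1 T2 IH2|T IH]; rewrite /GRA2 /=.
- by rewrite andbT.
- by rewrite all_cat geq_max => /andP [/IH1 -> /IH2].
- by move/IH => /=; lia.
Qed.

Lemma GRA2_Cap T1 T2 : GRA2 (Cap T1 T2) <-> GRA2 T1 /\ GRA2 T2.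
Proof. by rewrite /GRA2 /= all_cat; split=> /andP. Qed.

Lemma size_drop2 (A : Type) k (a b : A) : k <= 2 -> size (drop (2 - k) [:: a; b]) = k.
Proof. by rewrite size_drop /=; lia. Qed.

Lemma semP (M : model) T (a b : dom M) : GRA2 T ->
  sem T a b <-> ad_mem (drop (2 - ar T) [:: a; b]) (denot M T).
Proof.
elim: T a b => [R||T IH|T IH|T1 IH1 T2 IH2|T IH] a b gT //=.
- rewrite /ad_e (ad_memE _ (fun t => exists a, t = [:: a; a])) /=.
  by split=> [->|[_ [c [-> ->]]]] //; split=> //; exists b.
- have IH' := IH _ _ gT; have k2 := @GRA2_ar T gT; rewrite /ad_s adarity_denot.
  case: eqP => [e|ne]; last first.
    case: ifP => [k2'|_]; [by case: ne; apply/eqP; rewrite eqn_leq k2 k2' | exact: IH'].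
  rewrite e /= (ad_memE _ (fun t => exists u a b,
    ad_mem (u ++ [:: a; b]) (denot M T) /\ t = u ++ [:: b; a])) /= IH' e /=.
  split=> [H|[_ [[|x u] [c [d []]]]]]; first by split=> //; exists [::], b, a.
    by move=> H [-> ->].
  by case: u => [|y [|]].
- by rewrite ad_mem_neg size_drop2 ?adarity_denot ?GRA2_ar // IH //; split=> // -[].
- have [g1 g2] := (GRA2_Cap T1 T2).1 gT.
  rewrite /ad_cap !adarity_denot (ad_memE _ (fun t =>
    ad_mem (drop (maxn (ar T1) (ar T2) - ar T1) t) (denot M T1) /\
    ad_mem (drop (maxn (ar T1) (ar T2) - ar T2) t) (denot M T2))).
  have h1 := GRA2_ar g1; have h2 := GRA2_ar g2.
  rewrite !drop_drop IH1 // IH2 // size_drop2 ?geq_max ?h1 //.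
  have -> : maxn (ar T1) (ar T2) - ar T1 + (2 - maxn (ar T1) (ar T2)) = 2 - ar T1 by lia.
  have -> : maxn (ar T1) (ar T2) - ar T2 + (2 - maxn (ar T1) (ar T2)) = 2 - ar T2 by lia.
  by split=> // -[].
- have h := @GRA2_ar T gT; rewrite /ad_ex adarity_denot.
  case: (posnP (ar T)) => [e|n0].
    (* At arity 0 the operator is the identity, and any element serves as the witness. *)
    split=> [[c /(IH _ _ gT)]|H]; first by rewrite e.
    by exists a; apply/(IH _ _ gT); move: H; rewrite e.
  rewrite (ad_memE _ (fun t => exists a, ad_mem (rcons t a) (denot M T))).
  rewrite size_drop2 /=; last by lia.
  have D c : rcons (drop (2 - (ar T).-1) [:: a; b]) c = drop (2 - ar T) [:: b; c].
    by move: n0 h; case: (ar T) => [|[|[|]]].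
  by split=> [[c /(IH _ _ gT) H]|[_ [c]]]; [split=> // |]; exists c; rewrite ?D //;
    apply/(IH _ _ gT); rewrite -D.
Qed.

Lemma denot_nonempty (M : model) T :
  denot M T <> ad_empty (dom M) (ar T) <-> exists t, ad_mem t (denot M T).
Proof.
rewrite -(adarity_denot M T); case: (denot M T) => k P /=; split=> [ne|[t [u Pu _]] e].
  apply: contrapT => no; apply: ne; congr ADRel; apply: funext => u.
  by apply: propext; split=> // Pu; apply: no; exists u, u.
have : ad_mem (tval u) (ADRel P) by exists u.
by move: (tval u) => w; rewrite e => -[].
Qed.

Lemma satisfiable_sem T : GRA2 T ->
  satisfiable T <-> exists (M : model) (a b : dom M), sem T a b.
Proof.
move=> gT; have k2 := GRA2_ar gT; split=> [[M /denot_nonempty [t H]]|[M [a [b]]]].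
  exists M; have [d] := dom_nonempty M.
  suff [a [b e]] : exists a b, t = drop (2 - ar T) [:: a; b].
    by exists a, b; apply/semP; rewrite // -e.
  have st : size t = ar T by case: H => u _ <-; rewrite size_tuple adarity_denot.
  move: k2 st {H}; case: t => [|x [|y [|z w]]]; case: (ar T) => [|[|[|k]]] //= _ _.
  - by exists d, x.
  - by exists x, y.
by move/(semP _ _ gT) => H; exists M; apply/denot_nonempty; eexists; exact: H.
Qed.

(** * The small model property *)

Fixpoint subterms (T : term) : seq term :=
  T :: match T with
  | Rel _ | Eqt => [::]
  | Swap T1 | Neg T1 | Ex T1 => subterms T1
  | Cap T1 T2 => subterms T1 ++ subterms T2
  end.

Fixpoint subterm (t T : term) : Prop :=
  t = T \/ match T with
  | Rel _ | Eqt => False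
  | Swap T1 | Neg T1 | Ex T1 => subterm t T1
  | Cap T1 T2 => subterm t T1 \/ subterm t T2
  end.

Lemma subterm_refl T : subterm T T.
Proof. by case: T => *; left. Qed.

Lemma subterm_trans t u T : subterm t u -> subterm u T -> subterm t T.
Proof.
move=> tu; elim: T => [R||T IH|T IH|T1 IH1 T2 IH2|T IH] /= [e|] //; do ?[by subst u].
- by move/IH; right.
- by move/IH; right.
- by case=> [/IH1|/IH2]; right; [left|right].
- by move/IH; right.
Qed.

Lemma subterm_nth t T : subterm t T ->
  exists2 p, p < size (subterms T) & nth Eqt (subterms T) p = t.
Proof.
elim: T => [R||T IH|T IH|T1 IH1 T2 IH2|T IH] /= [->|] //; try by exists 0.
1,2,4: by move/IH => [p pl <-]; exists p.+1.
case=> [/IH1|/IH2] [p pl <-].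
  by exists p.+1; rewrite /= ?nth_cat ?pl // size_cat ltnS (leq_trans pl) // leq_addr.
exists (size (subterms T1) + p).+1; rewrite /= ?size_cat ?ltnS ?ltn_add2l //.
by rewrite nth_cat ltnNge leq_addr /= addKn.
Qed.

Section SmallModel.
Variables (M : model) (T0 : term).
Let A : choiceType := {classic (dom M)}.
Variable a0 : A.
Let n := size (subterms T0).
Let P := {ffun 'I_n -> bool}.
Let st (p : 'I_n) := nth Eqt (subterms T0) p.

(** The values on the diagonal include those of the subterms [Ex t], so a type tells which witnesses
    an element demands. *)
Definition ty (a : A) : P := [ffun p => `[< @sem M (st p) a a >]].

Lemma tyP a b t : subterm t T0 -> ty a = ty b -> @sem M t a a <-> @sem M t b b.
Proof.
move=> /subterm_nth [p pn e] /ffunP /(_ (Ordinal pn)).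
by rewrite !ffunE /st /= e => H; split=> /asboolP; [rewrite H|rewrite -H] => /asboolP.
Qed.

Definition king (a : A) : bool := `[< forall b, ty b = ty a -> b = a >].

Definition nk (q : P) : bool :=
  `[< exists x : A * A, [/\ x.1 <> x.2, ty x.1 = q & ty x.2 = q] >].

Definition two (q : P) : A * A :=
  if pselect (exists x : A * A, [/\ x.1 <> x.2, ty x.1 = q & ty x.2 = q]) is left e
  then projT1 (cid e) else (a0, a0).

Lemma twoP q : nk q -> [/\ (two q).1 <> (two q).2, ty (two q).1 = q & ty (two q).2 = q].
Proof. by move=> /asboolP e; rewrite /two; case: pselect => // e'; case: cid. Qed.

Lemma nking a : nk (ty a) = ~~ king a.
Proof.
apply/asboolP/negP=> [[[b c] /= [ne eb ec]] /asboolP H|nK].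
  by apply: ne; rewrite (H b) // (H c).
apply: contrapT => H; apply: nK; apply/asboolP => b e; apply: contrapT => ne.
by apply: H; exists (b, a).
Qed.

Definition wit (a : A) (p : 'I_n) : A :=
  if pselect (exists c, @sem M (st p) a c) is left e then projT1 (cid e) else a.

Lemma witP a p : (exists c, @sem M (st p) a c) -> @sem M (st p) a (wit a p).
Proof. by move=> e; rewrite /wit; case: pselect => // e'; case: cid. Qed.

(** The kings with their witnesses. They are listed by types, of which there are [2 ^ n], and this
    bounds their number. *)
Definition court : seq A := undup (flatten [seq
  (if pselect (exists a, ty a = q /\ king a) is left e
   then let a := projT1 (cid e) in a :: [seq wit a p | p <- enum 'I_n] else [::])
  | q <- enum P]).

Lemma size_court : size court <= 2 ^ n * n.+1.
Proof.
have -> : 2 ^ n = size (enum P) by rewrite -cardE card_ffun card_bool card_ord.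
apply: leq_trans (size_undup _) _; elim: (enum P) => //= q l IH.
rewrite size_cat mulSn leq_add //; case: pselect => //= e.
by rewrite size_map size_enum_ord.
Qed.

Lemma king_court a : king a -> a \in court /\ forall p, wit a p \in court.
Proof.
move=> ka; have [e H] : exists e : exists b, ty b = ty a /\ king b, projT1 (cid e) = a.
  have e : exists b, ty b = ty a /\ king b by exists a.
  exists e; case: (cid e) => b /= [eb kb].
  by move/asboolP: ka => /(_ b eb).
have sub x : x \in a :: [seq wit a p | p <- enum 'I_n] -> x \in court.
  move=> xa; rewrite mem_undup; apply/flattenP; exists (a :: [seq wit a p | p <- enum 'I_n]); last by [].
  apply/mapP; exists (ty a); first by rewrite mem_enum.
  case: pselect => [e'|[]]; last by exists a.
  by rewrite (Prop_irrelevance e' e) H.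
split=> [|p]; apply: sub; first exact: mem_head.
by rewrite inE map_f ?orbT // mem_enum.
Qed.

(* As in the proof of Graedel, Kolaitis and Vardi: the court, and three layers of
   copies of one element of each type that is realised twice, a copy for each
   subterm. The witnesses of an element outside the court are taken in the next
   layer, so that no pair receives two requirements. *)
Let D : finType := (seq_sub court + {q : P | nk q} * 'I_n * 'I_3)%type.

Lemma card_dom : #|D| <= 2 ^ (2 * n + 2).
Proof.
rewrite /D card_sum !card_prod !card_ord.
have h1 : #|{: seq_sub court}| <= 2 ^ n * n.+1.
  by rewrite card_seq_sub ?undup_uniq // size_court.
have h2 : #|{: {q : P | nk q}}| <= 2 ^ n.
  by rewrite card_sig (leq_trans (max_card _)) // card_ffun card_bool card_ord.
have h3 : n < 2 ^ n by rewrite ltn_expl.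
apply: leq_trans (leq_add h1 (leq_mul (leq_mul h2 (leqnn n)) (leqnn 3))) _.
rewrite expnD mul2n -addnn expnD (_ : 2 ^ 2 = 4) //.
by move: h3; clear; move: (2 ^ n) => X; nia.
Qed.

Definition orig (d : D) : A :=
  match d with inl c => val c | inr (q, _, _) => (two (val q)).1 end.

(* The pair of elements of [M] whose relations are imposed on [(d, d')], when [d']
   serves as a witness for [d]. *)
Definition over (d d' : D) : option (A * A) :=
  match d' with
  | inl _ => None
  | inr (q', p', j') =>
    let w := wit (orig d) p' in
    if [&& ~~ king (orig d), ty w == val q', w != orig d &
          match d with inl _ => j' == 0 :> nat | inr (_, _, j) => j' == j.+1 %% 3 :> nat end]
    then Some (orig d, w) else None
  end.

Lemma over_excl d d' x : over d d' = Some x -> over d' d = None.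
Proof.
case: d' => [c|[[q' p'] j']] //=; case: d => [c|[[q p] j]] //=.
case: ifP => // /and4P [_ _ _ /eqP e] _; case: ifP => // /and4P [_ _ _ /eqP e'].
by move: (ltn_ord j) (ltn_ord j') e e'; lia.
Qed.

Definition good (d d' : D) (x : A * A) :=
  [/\ x.1 <> x.2, ty x.1 = ty (orig d) & ty x.2 = ty (orig d')].

Lemma over_good d d' x : over d d' = Some x -> good d d' x.
Proof.
case: d' => [c|[[q' p'] j']] //=; case: ifP => // /and4P [_ /eqP e /eqP ne _] [<-].
split=> //=; first exact: nesym.
by have [_ -> _] := twoP (valP q').
Qed.

(** The last case concerns distinct elements that copy the same original. They receive the relations
    between two distinct elements of that type, so that equality keeps its meaning. *)
Definition base (d d' : D) : A * A :=
  if over d d' is Some x then x else if over d' d is Some x then (x.2, x.1)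
  else if orig d != orig d' then (orig d, orig d') else two (ty (orig d)).

Lemma base_good d d' : d != d' -> good d d' (base d d').
Proof.
move=> ne; rewrite /base; case e: (over d d') => [x|]; first exact: over_good.
case e': (over d' d) => [x|].
  by have [? ? ?] := over_good e'; split=> //; exact: nesym.
case: (eqVneq (orig d) (orig d')) => [eo|no] /=; last by split=> //; exact/eqP.
suff /twoP [] : nk (ty (orig d)) by rewrite /good -eo.
have nkr q p j : nk (ty (orig (inr (q, p, j)))).
  by have [_ /= -> _] := twoP (valP q); exact: valP.
case: d d' eo {e e'} ne => [c|[[q p] j]] [c'|[[q' p'] j']] eo ne; try exact: nkr.
  by case/eqP: ne; congr inl; exact: val_inj.
by rewrite eo; exact: nkr.
Qed.

(** [base] respects the exchange of its arguments except in its last case; fixing the orientation by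
    the enumeration rank makes the exchange exact. *)
Definition pair_of (d d' : D) : A * A :=
  if d == d' then (orig d, orig d)
  else if enum_rank d < enum_rank d' then base d d'
  else ((base d' d).2, (base d' d).1).

Lemma pair_of_diag d : pair_of d d = (orig d, orig d).
Proof. by rewrite /pair_of eqxx. Qed.

Lemma pair_of_swap d d' : pair_of d' d = ((pair_of d d').2, (pair_of d d').1).
Proof.
rewrite /pair_of eq_sym; case: eqVneq => [->|ne] //.
have : enum_rank d != enum_rank d' :> nat by rewrite (inj_eq val_inj) (inj_eq enum_rank_inj).
by case: ltngtP => // _ _; case: (base _ _).
Qed.

Lemma pair_of_ty d d' :
  ty (pair_of d d').1 = ty (orig d) /\ ty (pair_of d d').2 = ty (orig d').
Proof.
rewrite /pair_of; case: eqVneq => [->|ne] //.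
case: ifP => _; first by have [] := base_good ne.
by rewrite eq_sym in ne; have [] := base_good ne.
Qed.

Lemma pair_of_eq d d' : d = d' <-> (pair_of d d').1 = (pair_of d d').2.
Proof.
split=> [->|]; first by rewrite pair_of_diag.
rewrite /pair_of; case: eqVneq => [->|ne] //.
case: ifP => _; first by have [] := base_good ne.
by rewrite eq_sym in ne; have [H _ _] := base_good ne; move/esym.
Qed.

Lemma pair_of_base d d' x : d != d' -> base d d' = x -> base d' d = (x.2, x.1) ->
  pair_of d d' = x.
Proof.
move=> ne e e'; rewrite /pair_of (negbTE ne) e e'; case: ifP => _ //.
by case: (x).
Qed.

Lemma pair_of_default d d' : orig d <> orig d' -> over d d' = None ->
  over d' d = None -> pair_of d d' = (orig d, orig d').
Proof.
move=> /eqP ne o o'; apply: pair_of_base; rewrite /base ?o ?o' ?ne 1?eq_sym ?ne //.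
by apply: contraNneq ne => ->.
Qed.

Lemma pair_of_over d d' x : over d d' = Some x -> pair_of d d' = x.
Proof.
move=> o; have o' := over_excl o; apply: pair_of_base; rewrite /base ?o ?o' //.
by apply/eqP => e; move: o o'; rewrite -e => ->.
Qed.

Lemma over_king d d' : king (orig d) -> over d d' = None /\ over d' d = None.
Proof.
move=> kd; split; first by case: d' => // -[[q p] j]; rewrite /= kd.
case: d kd => // -[[q j] p] /= kd.
have := nking (two (val q)).1; rewrite kd /=.
by have [_ -> _] := twoP (valP q); rewrite (valP q).
Qed.

(** A witness equal to the element itself needs no new element. If the witness or the element is a
    king, the witness lies in the court and the pair keeps its original relations, as kings take
    part in no requirement. Otherwise the copy of the type of the witness that is reserved for [p]
    in the next layer receives the relations of the original pair. *)
Lemma pair_of_wit d p : (exists c, @sem M (st p) (orig d) c) ->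
  exists d', @sem M (st p) (pair_of d d').1 (pair_of d d').2.
Proof.
move=> /witP; set w := wit _ _ => sw.
case: (eqVneq w (orig d)) => [e|ne].
  by exists d; rewrite pair_of_diag /= -{2}e.
case kw: (king w).
  have [wC _] := king_court kw; exists (inl (SeqSub wC)).
  have [o o'] := @over_king (inl (SeqSub wC)) d kw.
  by rewrite pair_of_default //=; apply/eqP; rewrite eq_sym.
case kd: (king (orig d)).
  have [_ /(_ p) wC] := king_court kd; exists (inl (SeqSub wC)).
  have [o o'] := @over_king d (inl (SeqSub wC)) kd.
  by rewrite pair_of_default //=; apply/eqP; rewrite eq_sym.
have qw : nk (ty w) by rewrite nking kw.
pose j : 'I_3 := match d with inl _ => ord0 | inr (_, _, j) => inZp j.+1 end.
exists (inr (exist _ (ty w) qw, p, j)).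
rewrite (pair_of_over (x := (orig d, w))) //= -/w kd eqxx ne /=.
by rewrite /j; case: (d) => // -[[q' p'] j'] /=; rewrite eqxx.
Qed.

Definition small_interp (R : relsym) (u : seq D) : Prop :=
  match u with
  | [:: x; y] => @sem M (Rel R) (pair_of x y).1 (pair_of x y).2
  | [:: x] => @sem M (Rel R) (orig x) (orig x)
  | _ => @sem M (Rel R) a0 a0
  end.

Variable d0 : D.

Definition small : model := @Model D (inhabits d0) (fun R u => small_interp R u).

(** The value of [Ex t] depends only on the type of the second component, so it can be moved to the
    diagonal at [orig d']. There [pair_of_wit] supplies witnesses; conversely, the pair imposed on
    [(d', c)] begins with an element of the type of [orig d']. *)
Lemma small_sem t (d d' : D) : GRA2 t -> subterm t T0 ->
  @sem small t d d' <-> @sem M t (pair_of d d').1 (pair_of d d').2.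
Proof.
elim: t d d' => [R||t IH|t IH|t1 IH1 t2 IH2|t IH] d d' gT sT.
- have k2 := GRA2_ar gT; rewrite [X in X <-> _]/= (ad_memE _ (small_interp R)) size_drop2 //.
  have [_ t2] := pair_of_ty d d'.
  have := tyP sT t2; move: k2; rewrite /=.
  case: R {gT sT} => [[|[|[|k]]] w] //= _ H.
  + by split=> [[]|].
  + by split=> [[_ /H]|/H].
  + by split=> [[]|].
- exact: pair_of_eq.
- have sT' : subterm t T0 by apply: subterm_trans sT => /=; right; exact: subterm_refl.
  rewrite /=; case: ifP => _; rewrite (IH _ _ gT sT') //.
  by rewrite (pair_of_swap d d').
- have sT' : subterm t T0 by apply: subterm_trans sT => /=; right; exact: subterm_refl.
  by rewrite /= (IH _ _ gT sT').
- have [g1 g2] := (GRA2_Cap t1 t2).1 gT.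
  have s1 : subterm t1 T0 by apply: subterm_trans sT => /=; right; left; exact: subterm_refl.
  have s2 : subterm t2 T0 by apply: subterm_trans sT => /=; right; right; exact: subterm_refl.
  by rewrite /= (IH1 _ _ g1 s1) (IH2 _ _ g2 s2).
- have sT' : subterm t T0 by apply: subterm_trans sT => /=; right; exact: subterm_refl.
  have [_ t2] := pair_of_ty d d'.
  have E := tyP sT t2.
  have -> : @sem M (Ex t) (pair_of d d').1 (pair_of d d').2 <->
    @sem M (Ex t) (orig d') (orig d') by exact: E.
  split=> [[c /(IH _ _ gT sT') H]|].
    have [t1 _] := pair_of_ty d' c.
    by apply/(tyP sT t1); exists (pair_of d' c).2.
  have [p pn e] := subterm_nth sT'.
  have := @pair_of_wit d' (Ordinal pn); rewrite /st /= e => H /H [c sc].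
  by exists c; apply/(IH _ _ gT sT').
Qed.

Lemma ty_orig a : exists d, ty (orig d) = ty a.
Proof.
case ka: (king a).
  by have [aC _] := king_court ka; exists (inl (SeqSub aC)).
have qa : nk (ty a) by rewrite nking ka.
have n0 : 0 < n by rewrite /n; case: T0.
exists (inr (exist _ (ty a) qa, Ordinal n0, ord0)).
by have [_ /= -> _] := twoP qa.
Qed.

End SmallModel.

Theorem small_model T : GRA2 T -> (exists (M : model) (a b : dom M), sem T a b) ->
  exists (D : finType) (d0 : D) (I : forall R, (symarity R).-tuple D -> Prop),
    #|D| <= 2 ^ (2 * (size (subterms T)).+1 + 2) /\
    exists a b : D, @sem (Model (inhabits d0) I) T a b.
Proof.
move=> gT [M [a [b sab]]].
(* The construction is applied to [Ex T], so that satisfaction by a pair becomes part of the type of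
   a single element. *)
have [d td] := @ty_orig M (Ex T) a a.
exists _, d, (fun R u => @small_interp M (Ex T) a R u); split; first exact: (@card_dom M (Ex T)).
have sT : subterm T (Ex T) by right; exact: subterm_refl.
have := @tyP M (Ex T) _ _ _ (subterm_refl _) td.
have [p pn e] := subterm_nth sT.
case=> _ /(_ (ex_intro _ b sab)) H.
have := @pair_of_wit M (Ex T) a d (Ordinal pn); rewrite /= e => /(_ H) [d' sd'].
exists d, d'; exact/(@small_sem M (Ex T) a).
Qed.

(** * Certificates *)

(* The value of a term at [(i, j)] and at [(j, i)], and its arity: [None],
   [Some false] and [Some true] stand for 0, 1 and 2. *)
Definition item : Type := bool * bool * option bool.

Definition arity_code (k : nat) : option bool :=
  match k with 0 => None | 1 => Some false | _ => Some true end.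

Definition neg_item (a : item) : item := (~~ a.1.1, ~~ a.1.2, a.2).
Definition swap_item (a : item) : item :=
  if a.2 is Some true then (a.1.2, a.1.1, a.2) else a.
Definition cap_item (a b : item) : item :=
  (a.1.1 && b.1.1, a.1.2 && b.1.2,
   match a.2, b.2 with
   | Some true, _ | _, Some true => Some true
   | Some false, _ | _, Some false => Some false
   | None, None => None
   end).
Definition pred_arity (k : option bool) : option bool :=
  if k is Some true then Some false else None.

(* Pending part of a relation symbol, number of its bars, values of the terms
   read, error flag. *)
Record estate := EState {
  ename : seq letter; ebars : nat; estack : seq item; eerror : bool
}.

Section Evaluation.
Variables (h : seq letter -> nat -> nat -> bool) (i j : nat).

(** The oracle [h] is addressed by strings: a relation symbol by its encoding, a subterm [Ex t] by
    the suffix that begins with it. Nullary values are looked up at [(0, 0)] and unary ones on the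
    diagonal, so that they depend on the right components by construction. From right to left, bits
    precede bars, and [LR] must close a name before another operator comes; the flag records
    violations. *)
Definition estep (g : letter) (u : seq letter) (s : estate) : estate :=
  let: EState w b st e := s in
  let e' := e || (w != [::]) in
  match g with
  | L0 | L1 => EState (g :: w) b st (e || (0 < b))
  | Lbar => EState (g :: w) b.+1 st e
  | LR => match b with
    | 0 => EState [::] 0 ((h (g :: w) 0 0, h (g :: w) 0 0, None) :: st) e
    | 1 => EState [::] 0 ((h (g :: w) j j, h (g :: w) i i, Some false) :: st) e
    | 2 => EState [::] 0 ((h (g :: w) i j, h (g :: w) j i, Some true) :: st) e
    | _ => EState [::] 0 st true
    end
  | Le => EState w b ((i == j, i == j, Some true) :: st) e'
  | Ls => if st is a :: st' then EState w b (swap_item a :: st') e'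
          else EState w b st true
  | Lneg => if st is a :: st' then EState w b (neg_item a :: st') e'
            else EState w b st true
  | Lcap => match st with
            | [:: a, a' & st'] => EState w b (cap_item a a' :: st') e'
            | [:: _] => EState w b [::] true
            | [::] => EState w b [::] true
            end
  | Lex => if st is a :: st' then
             EState w b ((h (g :: u) j j, h (g :: u) i i, pred_arity a.2) :: st') e'
           else EState w b st true
  end.

Fixpoint ev (u : seq letter) : estate :=
  if u is g :: u' then estep g u' (ev u') else EState [::] 0 [::] false.

End Evaluation.

Definition top (s : estate) : bool := if estack s is a :: _ then a.1.1 else false.

(** When [u] has been read, the top of the stack is the value of the first term in [u], the argument
    of this [Ex]. *)
Definition check_ex h N x : Prop := forall i u, i < N -> suffix (Lex :: u) x ->
  h (Lex :: u) i i = has (fun c => top (ev h i c u)) (iota 0 N).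

Definition accepted (s : estate) : bool :=
  [&& ename s == [::], top s, size (estack s) == 1 & ~~ eerror s].

Definition check_acc h N x : Prop :=
  exists i j, [/\ i < N, j < N & accepted (ev h i j x)].

Definition rel_letters (R : relsym) : seq letter :=
  nseq (symarity R) Lbar ++ map bit_letter (symname R).

(** * Correct guesses and satisfying models *)

Section Correctness.
Variables (h : seq letter -> nat -> nat -> bool) (x : seq letter).
Variables (M : model) (N : nat) (e : nat -> dom M).
Hypothesis e_inj : forall i j, i < N -> j < N -> e i = e j -> i = j.
Hypothesis e_surj : forall a, exists2 i, i < N & e i = a.
Hypothesis h_rel : forall R i j, symarity R <= 2 -> i < N -> j < N ->
  sem (Rel R) (e i) (e j) <->
  match symarity R with
  | 0 => h (LR :: rel_letters R) 0 0
  | 1 => h (LR :: rel_letters R) j j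
  | _ => h (LR :: rel_letters R) i j
  end.

Definition item_of i j (t : term) : item :=
  (`[< sem t (e i) (e j) >], `[< sem t (e j) (e i) >], arity_code (ar t)).

(** The invariant of the pass from right to left: a pending name with [k] bars and bits [w],
    followed by complete terms whose values form the stack. *)
Definition parsed (k : nat) (w : seq bool) (ts : seq term) u :=
  [/\ u = nseq k Lbar ++ map bit_letter w ++ flatten (map encode ts), all (fun t => `[< GRA2 t >]) ts &
    forall i j, i < N -> j < N ->
      ev h i j u = EState (nseq k Lbar ++ map bit_letter w) k (map (item_of i j) ts) false].

Definition h_ex u := forall t ts i, GRA2 t ->
  u = encode t ++ flatten (map encode ts) -> i < N ->
  h (Lex :: u) i i = `[< exists c, sem t (e i) c >].

Lemma parsed_rel R ts u : symarity R <= 2 ->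
  parsed (symarity R) (symname R) ts u -> parsed 0 [::] (Rel R :: ts) (LR :: u).
Proof.
move=> R2 [-> gts H]; split; first by rewrite /= catA.
  by rewrite /= gts andbT; apply/asboolP; rewrite /GRA2 /= R2.
move=> i j iN jN; rewrite [ev _ _ _ _]/= H //= -/(rel_letters R).
have := h_rel R2 iN jN; have := h_rel R2 jN iN.
rewrite /item_of [ar _]/=; move: R2.
case: (symarity R) => [|[|[|k]]] // _ /asbool_equiv_eq -> /asbool_equiv_eq ->;
  by rewrite !asboolb.
Qed.

Lemma parsed_eqt ts u : parsed 0 [::] ts u -> parsed 0 [::] (Eqt :: ts) (Le :: u).
Proof.
move=> [-> gts H]; split=> [//||i j iN jN]; first by rewrite /= gts andbT; apply/asboolP.
have E a b : a < N -> b < N -> (a == b) = `[< sem Eqt (e a) (e b) >].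
  by move=> aN bN; apply/eqP/asboolP => [->|/(e_inj aN bN)].
by rewrite [ev _ _ _ _]/= H //= {2}(eq_sym i) !E.
Qed.

Lemma asbool_neg (p : Prop) : ~~ `[< p >] = `[< ~ p >].
Proof. by apply/idP/asboolP=> [/asboolP|H] //; apply/asboolP. Qed.

Lemma parsed_neg t ts u : parsed 0 [::] (t :: ts) u ->
  parsed 0 [::] (Neg t :: ts) (Lneg :: u).
Proof.
move=> [-> /= /andP [gt gts] H]; split=> [//||i j iN jN]; first by rewrite /= gts andbT.
by rewrite [ev _ _ _ _]/= H //= /neg_item /item_of /= !asbool_neg.
Qed.

Lemma parsed_swap t ts u : parsed 0 [::] (t :: ts) u ->
  parsed 0 [::] (Swap t :: ts) (Ls :: u).
Proof.
move=> [-> /= /andP [gt gts] H]; split=> [//||i j iN jN]; first by rewrite /= gts andbT.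
rewrite [ev _ _ _ _]/= H //= /swap_item /item_of /=.
by have := GRA2_ar (asboolW gt); case: (ar t) => [|[|[|k]]].
Qed.

Lemma parsed_cap t t' ts u : parsed 0 [::] [:: t, t' & ts] u ->
  parsed 0 [::] (Cap t t' :: ts) (Lcap :: u).
Proof.
move=> [-> /= /and3P [gt gt' gts] H]; split=> [||i j iN jN]; first by rewrite /= catA.
  by rewrite /= gts andbT; apply/asboolP/GRA2_Cap; split; exact: asboolW.
rewrite [ev _ _ _ _]/= H //= /cap_item /item_of /= !asbool_and.
by have := GRA2_ar (asboolW gt); have := GRA2_ar (asboolW gt');
  case: (ar t) => [|[|[|k]]]; case: (ar t') => [|[|[|k']]].
Qed.

Lemma parsed_ex t ts u : h_ex u -> parsed 0 [::] (t :: ts) u ->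
  parsed 0 [::] (Ex t :: ts) (Lex :: u).
Proof.
move=> hx [eu /= /andP [gt gts] H]; split=> [||i j iN jN]; first by rewrite eu.
  by rewrite /= gts andbT.
rewrite [ev _ _ _ _]/= H //= !(hx t ts) //; try exact: asboolW.
rewrite /item_of /=; congr (EState _ _ ((_, _, _) :: _) _).
by have := GRA2_ar (asboolW gt); case: (ar t) => [|[|[|k]]].
Qed.

Lemma parsed_bit b w ts u : parsed 0 w ts u -> parsed 0 (b :: w) ts (bit_letter b :: u).
Proof.
case=> eu gts H; split=> [||i j iN jN] //; first by rewrite /= eu.
by rewrite [ev _ _ _ _]/= H //; case: b.
Qed.

Lemma parsed_bar k w ts u : parsed k w ts u -> parsed k.+1 w ts (Lbar :: u).
Proof.
case=> eu gts H; split=> [||i j iN jN] //; first by rewrite eu.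
by rewrite [ev _ _ _ _]/= H.
Qed.

Lemma has_top t ts u i : parsed 0 [::] (t :: ts) u -> i < N ->
  has (fun c => top (ev h i c u)) (iota 0 N) = `[< exists c, sem t (e i) c >].
Proof.
case=> _ _ H iN; apply/hasP/asboolP => [[c]|[c sc]].
  by rewrite mem_iota /= => cN; rewrite H // /top /= => /asboolP; exists (e c).
have [c' cN ec] := e_surj c; exists c'; first by rewrite mem_iota.
by rewrite H // /top /=; apply/asboolP; rewrite ec.
Qed.

Lemma eerror_suffix i j u v : eerror (ev h i j (u ++ v)) = false ->
  eerror (ev h i j v) = false.
Proof.
elim: u => //= g u IH H; apply: IH; move: H.
case: (ev _ _ _ _) => w b st [] //; case: g => //=; case: st => [|a [|a' st]] //=.
all: by case: b => [|[|[|b]]].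
Qed.

(** The flag acts as the syntax check: its absence at a single pair yields a parse of [u], and the
    parse gives the values at all pairs. *)
Lemma ev_parsed i0 j0 u : i0 < N -> j0 < N -> (forall v, suffix (Lex :: v) u -> h_ex v) ->
  eerror (ev h i0 j0 u) = false -> exists k w ts, parsed k w ts u.
Proof.
move=> iN jN; elim: u => [|g u IH] hx err; first by exists 0, [::], [::].
have [|//|k [w [ts P]]] := IH.
- by move=> v sv; apply: hx; apply: suffix_trans sv _; rewrite -cat1s; exact: suffix_suffix.
- exact: (@eerror_suffix i0 j0 [:: g] u).
case: (P) => eu gts H; move: err; rewrite /= H //.
have bits b : (0 < k) = false -> parsed k (b :: w) ts (bit_letter b :: u).
  by case: k P H eu => // P H eu _; exact: parsed_bit.
have empty : nseq k Lbar ++ map bit_letter w != [::] = false -> k = 0 /\ w = [::].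
  by case: (k) => //; case: (w).
case: g hx => hx.
- case: k P H eu bits empty => [|[|[|k]]] P H eu _ _ err.
  + by exists 0, [::], (Rel (RelSym 0 w) :: ts); apply: parsed_rel.
  + by exists 0, [::], (Rel (RelSym 1 w) :: ts); apply: parsed_rel.
  + by exists 0, [::], (Rel (RelSym 2 w) :: ts); apply: parsed_rel.
  + by [].
- move=> _; exists k.+1, w, ts; exact: parsed_bar.
- by move/(bits false); exists k, (false :: w), ts.
- by move/(bits true); exists k, (true :: w), ts.
- move=> /empty [k0 w0]; subst k w; exists 0, [::], (Eqt :: ts); exact: parsed_eqt.
- case: ts P H eu gts {bits} => [|t ts] P H eu gts //= /empty [k0 w0]; subst k w.
  exists 0, [::], (Swap t :: ts); exact: parsed_swap.
- case: ts P H eu gts {bits} => [|t ts] P H eu gts //= /empty [k0 w0]; subst k w.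
  exists 0, [::], (Neg t :: ts); exact: parsed_neg.
- case: ts P H eu gts {bits} => [|t [|t' ts]] P H eu gts //= /empty [k0 w0]; subst k w.
  exists 0, [::], (Cap t t' :: ts); exact: parsed_cap.
- case: ts P H eu gts {bits} => [|t ts] P H eu gts //= /empty [k0 w0]; subst k w.
  exists 0, [::], (Ex t :: ts); apply: parsed_ex => //; apply: hx; exact: suffix_refl.
Qed.

(** The guessed values of existential subterms are right by induction on the length of the suffix:
    evaluating the argument consults them only at shorter suffixes, and [check_ex] then settles the
    longer one. *)
Lemma check_sound i0 j0 : i0 < N -> j0 < N -> check_ex h N x ->
  accepted (ev h i0 j0 x) -> sat_problem GRA2 x.
Proof.
move=> iN jN cx /and4P [/eqP e0 e1 e2 /negbTE err].
have hx n v : size v < n -> suffix (Lex :: v) x -> h_ex v.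
  elim: n v => // n IH v sv svx t ts0 i gt ev' iN'; rewrite cx //.
  have svx' : suffix v x.
    by apply: suffix_trans svx; rewrite -cat1s; exact: suffix_suffix.
  have [|//|k [w [ts P]]] := @ev_parsed i0 j0 v iN jN.
  - move=> v2 sv2; apply: IH; last exact: suffix_trans sv2 svx'.
    by have := size_suffix sv2; rewrite /=; lia.
  - by case/suffixP: svx' err => s -> /eerror_suffix.
  have nb s : no_bit_ahead (flatten (map encode s)) /\ head LR (flatten (map encode s)) <> Lbar.
    by case: s => //= t2 s; split; [exact: encode_no_bit_ahead | exact: encode_head].
  (* Encodings are prefix-free, so the parse found by the evaluation begins with the given term
     [t]. *)
  have [k0 [w0 [ts' ets]]] : k = 0 /\ w = [::] /\ exists ts', ts = t :: ts'.
    case: P => ev2 _ _; move: ev'; rewrite ev2; case: k {ev2} => [|k]; last first.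
      by move=> e'; have := @encode_head t (flatten (map encode ts0)); rewrite -e'.
    case: w => [|[] w]; try by
      move=> e'; have := @encode_no_bit_ahead t (flatten (map encode ts0)); rewrite -e'.
    case: ts => [|t1 ts] /=; first by case: (t).
    have [n1 b1] := nb ts; have [n2 b2] := nb ts0.
    by case/(encode_cat_inj n1 n2 b1 b2) => -> _; split=> //; split=> //; exists ts.
  by apply: (@has_top _ ts') => //; rewrite -ets -k0 -w0.
have [|//|k [w [ts [ex gts H]]]] := @ev_parsed i0 j0 x iN jN; first by move=> v; apply: hx (ltnSn _).
move: e0 e1 e2; rewrite H //= /top /=; case: ts ex gts {H} => [|t [|t' ts]] //= ex /andP [gt _].
case: k ex => // ex; case: w ex => //= ex _ /asboolP sa _.
exists t; split=> //; last by rewrite ex cats0.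
  exact: asboolW.
by apply/(satisfiable_sem (asboolW gt)); exists M, (e i0), (e j0).
Qed.

Hypothesis all_ex : forall u, h_ex u.

Lemma encode_parsed t ts u : GRA2 t -> parsed 0 [::] ts u ->
  parsed 0 [::] (t :: ts) (encode t ++ u).
Proof.
elim: t ts u => [R||t IH|t IH|t1 IH1 t2 IH2|t IH] ts u gt P.
- rewrite [encode _]/= cat_cons -catA; apply: parsed_rel; first by move: gt; rewrite /GRA2 /= andbT.
  elim: (symarity R) => [|k IHk]; last exact: parsed_bar.
  by elim: (symname R) => [|b w IHw] //; exact: parsed_bit.
- exact: parsed_eqt.
- exact/parsed_swap/IH.
- exact/parsed_neg/IH.
- have [g1 g2] := (GRA2_Cap t1 t2).1 gt.
  by rewrite /= -catA; apply/parsed_cap/IH1/IH2.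
- exact/parsed_ex/IH.
Qed.

Lemma check_complete T i0 j0 : GRA2 T -> x = encode T -> i0 < N -> j0 < N ->
  sem T (e i0) (e j0) -> check_ex h N x /\ accepted (ev h i0 j0 x).
Proof.
move=> gT ex iN jN sT.
have [|_ _ H] := @encode_parsed T [::] [::] gT; first by split.
rewrite cats0 -ex /= in H; split; last first.
  by rewrite H // /accepted /top /= andbT; apply/asboolP.
move=> i u iN' su; have [|//|k [w [ts P]]] := @ev_parsed i0 j0 u iN jN.
- by move=> v _; exact: all_ex.
- case/suffixP: su H => s -> H; apply: (@eerror_suffix i0 j0 (s ++ [:: Lex])).
  by rewrite -catA H.
have : eerror (ev h i0 j0 (Lex :: u)) = false.
  by case/suffixP: su H => s -> H; apply: (@eerror_suffix i0 j0 s); rewrite H.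
case: (P) => eu gts Hu; rewrite /= Hu //.
case: ts P eu gts Hu => [|t ts] P eu gts Hu //=.
case: k P eu Hu => [|k] P eu Hu //; case: w P eu Hu => // P eu Hu _.
have gt : GRA2 t by move: gts => /= /andP [/asboolW].
by rewrite (has_top P) // (@all_ex u t ts).
Qed.

End Correctness.

Lemma size_encode T : size (subterms T) <= size (encode T).
Proof. by elim: T => //= t1 IH1 t2 IH2; rewrite !size_cat ltnS leq_add. Qed.

Lemma rel_letters_inj : injective rel_letters.
Proof.
move=> [k w] [k' w'] /=; rewrite /rel_letters /= -(cats0 (map _ w)) -(cats0 (map _ w')).
by case/bars_cat_inj => // -> ->.
Qed.

Theorem sat_complete (x : seq letter) : sat_problem GRA2 x ->
  exists N h, [/\ N <= 2 ^ (2 * size x + 4), check_ex h N x & check_acc h N x].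
Proof.
move=> [T [gT /(satisfiable_sem gT) sT eT]].
have [D [d0 [I [cD [a [b sab]]]]]] := small_model gT sT.
set M := Model _ I in sab; pose e i : dom M := nth d0 (enum D) i.
have e_inj i j : i < #|D| -> j < #|D| -> e i = e j -> i = j.
  rewrite cardE => iD jD /eqP; rewrite /e nth_uniq ?enum_uniq //.
  by move/eqP.
have e_surj (c : dom M) : exists2 i, i < #|D| & e i = c.
  exists (index (c : D) (enum D)); first by rewrite cardE index_mem mem_enum.
  by rewrite /e nth_index // mem_enum.
(* The truthful oracle. After [Lex] it speaks of the first term encoded there, which is unique
   because encodings are prefix-free. *)
pose h (u : seq letter) i j := match u with
  | LR :: w => `[< exists R, w = rel_letters R /\ @sem M (Rel R) (e i) (e j) >]
  | Lex :: v => `[< exists t ts, [/\ GRA2 t, v = encode t ++ flatten (map encode ts) &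
      exists c, @sem M t (e i) c] >]
  | _ => false end.
have hR R i j : h (LR :: rel_letters R) i j <-> @sem M (Rel R) (e i) (e j).
  by split=> [/asboolP [R' [/rel_letters_inj ->]]|s] //; apply/asboolP; exists R.
have h_rel R i j : symarity R <= 2 -> i < #|D| -> j < #|D| ->
  @sem M (Rel R) (e i) (e j) <->
  match symarity R with
  | 0 => h (LR :: rel_letters R) 0 0
  | 1 => h (LR :: rel_letters R) j j
  | _ => h (LR :: rel_letters R) i j
  end.
  move=> R2 _ _; have := hR R 0 0; have := hR R j j; have := hR R i j.
  by rewrite /=; case: R {hR} R2 => [[|[|[|k]]] w] //= _ H0 H1 H2; apply: iff_sym.
have hx u : h_ex h #|D| e u.
  move=> t ts i gt eu iD; apply/asboolP/asboolP => [[t' [ts' [gt' eu' H]]]|H]; last by exists t, ts.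
  have nb s : no_bit_ahead (flatten (map encode s)) /\ head LR (flatten (map encode s)) <> Lbar.
    by case: s => //= t2 s; split; [exact: encode_no_bit_ahead | exact: encode_head].
  have [n1 b1] := nb ts; have [n2 b2] := nb ts'.
  by move: eu'; rewrite eu => /(encode_cat_inj n1 n2 b1 b2) [->].
have [ia iaD ea] := e_surj a; have [ib ibD eb] := e_surj b.
have [|cx ca] := check_complete e_inj e_surj h_rel hx gT (esym eT) iaD ibD.
  by rewrite ea eb.
exists #|D|, h; split=> //; last by exists ia, ib.
apply: leq_trans cD _; rewrite leq_exp2l //.
by have := size_encode T; rewrite eT; lia.
Qed.

Theorem sat_sound (x : seq letter) N h : check_ex h N x -> check_acc h N x -> sat_problem GRA2 x.
Proof.
case: N => [|N] cx [i0 [j0 [iN jN ca]]] //.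
pose val (R : relsym) (u : seq 'I_N.+1) : Prop := match u with
  | [:: a; b] => h (LR :: rel_letters R) a b
  | [:: a] => h (LR :: rel_letters R) a a
  | _ => h (LR :: rel_letters R) 0 0 end.
pose M := @Model 'I_N.+1 (inhabits ord0) (fun R u => val R u).
pose e i : dom M := inord i.
have e_inj i j : i < N.+1 -> j < N.+1 -> e i = e j -> i = j.
  by move=> iN' jN' /(congr1 (@nat_of_ord _)); rewrite /e !inordK.
have e_surj (c : dom M) : exists2 i, i < N.+1 & e i = c.
  by exists (c : 'I_N.+1); [exact: ltn_ord | rewrite /e inord_val].
apply: (check_sound e_inj e_surj _ iN jN cx ca) => R i j R2 iN' jN'.
rewrite [X in X <-> _]/= (ad_memE _ (val R)) size_drop2 //.
case: R R2 => [[|[|[|k]]] w] //= _; rewrite ?inordK //; by split=> // -[].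
Qed.

(** * Specifications of programs *)

Notation "c1 ;; c2" := (Seq c1 c2) (at level 62, right associativity).

Lemma updE (X : Type) (s : nat -> X) i v j : upd s i v j = if j == i then v else s j.
Proof. by []. Qed.

(** Compares stores stack by stack; 31 is the number of stacks of the verifier, the larger of the
    two programs. *)
Ltac store_eq :=
  let r := fresh "r" in
  apply: funext => r; rewrite /upd /=;
  do 31 (case: r => [|r]; [by rewrite /= ?cats0 ?rev_rcons | ]); done.

Ltac wf_tac := repeat match goal with
  | |- is_true _ => done
  | |- _ = true => reflexivity
  | |- True => exact I
  | |- _ /\ _ => split
  | |- forall _, _ => intro
  | |- wf _ (match ?x with _ => _ end) => destruct x
  | |- frozen _ (match ?x with _ => _ end) => destruct x
  | |- wf ?K ?c => let c' := eval hnf in c in change (wf K c'); progress hnf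
  | |- frozen ?K ?c => let c' := eval hnf in c in change (frozen K c'); progress hnf
  | |- wf ?K ?c => let c' := eval hnf in c in progress change (wf K c')
  | |- frozen ?K ?c => let c' := eval hnf in c in progress change (frozen K c')
  end.

Section Triples.
Variables (G : finType) (B : nat).
Implicit Types (s : store G).

Definition ok (c : cmd G) s s' := safe B c s /\ run c s = s'.

Lemma ok_eq c s s1 s2 : ok c s s1 -> s1 = s2 -> ok c s s2.
Proof. by move=> H <-. Qed.

Lemma ok_skip s : ok (Skip G) s s.
Proof. by []. Qed.

Lemma ok_push i g s : ok (Push i g) s (upd s i (g :: s i)).
Proof. by []. Qed.

Lemma ok_pop i s : ok (Pop G i) s (upd s i (behead (s i))).
Proof. by []. Qed.

Lemma ok_seq c1 c2 s s1 s2 : ok c1 s s1 -> ok c2 s1 s2 -> ok (c1 ;; c2) s s2.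
Proof. by case=> a1 e1 [a2 e2]; rewrite /ok /= e1. Qed.

Lemma ok_case i f s s' : ok (f (ohead (s i))) s s' -> ok (Case i f) s s'.
Proof. by []. Qed.

(** [P c l] is the loop invariant: the store when [c] has been consumed and [l] remains. *)
Lemma ok_for (P : seq G -> seq G -> store G) i f s s' :
  size (s i) <= B -> P [::] (s i) = s -> P (s i) [::] = s' ->
  (forall c g l, s i = c ++ g :: l -> ok (f g) (upd (P c (g :: l)) i l) (P (rcons c g) l)) ->
  ok (For i f) s s'.
Proof.
move=> sB P0 <- H; rewrite /ok safeFor runFor.
suff gen l c : s i = c ++ l ->
    lsafe B i f l (P c l) /\ loop i f l (P c l) = P (s i) [::].
  by have [|A E] := gen (s i) [::] => //; rewrite P0 in A E.
elim: l c => [|g l IH] c e; first by rewrite e cats0.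
have [sf rf] := H _ _ _ e.
have [|A E] := IH (rcons c g); first by rewrite cat_rcons.
by rewrite /= rf.
Qed.

Definition mv a b : cmd G := For a (fun g => Push b g).
Definition clr a : cmd G := For a (fun=> Skip G).
(** Reading a stack empties it, so a copy goes through the scratch stack [t], which also undoes the
    reversal. *)
Definition cp t a b : cmd G := mv a t ;; For t (fun g => Push a g ;; Push b g).

Lemma ok_mv a b s : a != b -> size (s a) <= B ->
  ok (mv a b) s (upd (upd s a [::]) b (rev (s a) ++ s b)).
Proof.
move=> ab sB; have ba : b != a by rewrite eq_sym.
apply: (@ok_for (fun c l => upd (upd s a l) b (rev c ++ s b))) => //=.
  by rewrite !upd_id.
move=> c g l _; apply: ok_eq (ok_push _ _ _) _.
apply: funext => r; rewrite /upd !eqxx (negbTE ba) rev_rcons.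
by case: eqP => // _; case: eqP.
Qed.

Lemma ok_clr a s : size (s a) <= B -> ok (clr a) s (upd s a [::]).
Proof.
move=> sB; apply: (@ok_for (fun c l => upd s a l)) => //=; first by rewrite upd_id.
by move=> c g l _; apply: ok_eq (ok_skip _) _; rewrite upd_upd.
Qed.

Lemma ok_cp t a b s : a != b -> t != a -> t != b -> s t = [::] -> size (s a) <= B ->
  ok (cp t a b) s (upd s b (s a ++ s b)).
Proof.
move=> ab ta tb st sB; have [ba at' bt] : [/\ b != a, a != t & b != t].
  by split; rewrite eq_sym.
apply: ok_seq (ok_mv _ sB) _ => //.
set s1 := upd _ _ _.
have s1t : s1 t = rev (s a) by rewrite /s1 upd_same st cats0.
apply: (@ok_for (fun c l => upd (upd (upd s t l) a (rev c)) b (rev c ++ s b))).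
- by rewrite s1t size_rev.
- rewrite s1t /s1 st cats0 /=; apply: funext => r; rewrite /upd.
  by case: eqP => [->|_]; [rewrite (negbTE bt) (negbTE ba) | case: eqP => // ->; rewrite (negbTE at')].
- rewrite s1t revK; apply: funext => r; rewrite /upd.
  by case: eqP => // _; case: eqP => [->|_] //; case: eqP => [->|_].
move=> c g l _; apply: ok_seq (ok_push _ _ _) _; apply: ok_eq (ok_push _ _ _) _.
apply: funext => r; rewrite /upd !eqxx (negbTE ab) (negbTE ba) (negbTE at') (negbTE bt) rev_rcons.
by case: eqP => // _; case: eqP => // _; case: eqP.
Qed.

Variable one : G.

Definition flag (b : bool) : seq G := if b then [:: one] else [::].

Definition raise r : cmd G := Case r (fun o => if o is Some _ then Skip G else Push r one).

Lemma ok_raise r b s : s r = flag b -> ok (raise r) s (upd s r (flag true)).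
Proof.
move=> e; apply: ok_case; rewrite e; case: b e => /= e.
  by apply: ok_eq (ok_skip _) _; rewrite -e upd_id.
by apply: ok_eq (ok_push _ _ _) _; rewrite e.
Qed.

End Triples.

(** * The verifier *)

Module Verifier.

Definition sym : finType := (letter + (bool * bool * option bool))%type.

Definition lsym (g : letter) : sym := inl g.
Definition isym (a : item) : sym := inr a.
(** Items double as marks: the values of terms occur only on [rS], which never holds a mark. *)
Definition one : sym := isym (false, false, None).
Definition sep : sym := isym (true, false, None).
Definition dollar : sym := isym (true, true, None).
Definition dommark : sym := isym (false, true, None).
Definition junk : sym := isym (false, false, Some false).

Notation flag := (flag one).
Notation raise := (raise one).

(* [rX] holds the input and [rXR] its reverse, [rY] the guess, [rA] the number of
   elements in unary, [rD] the keys of the guessed facts, each followed by [dollar]; [rI]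
   and [rJ] hold the current pair in unary, [rU] the current suffix of the input,
   [rV] its part that has been read; [rW], [rB], [rS], [rE] hold the fields of
   [estate]. *)
Notation rX := 0. Notation rXR := 1. Notation rC := 2. Notation rC2 := 3.
Notation rY := 4. Notation rA := 5. Notation rD := 6. Notation rT := 7.
Notation rD2 := 8. Notation rKEY := 9. Notation rKC := 10. Notation rMM := 11.
Notation rFD := 12. Notation rU := 13. Notation rI := 14. Notation rJ := 15.
Notation rZ := 16. Notation rV := 17. Notation rW := 18. Notation rB := 19.
Notation rS := 20. Notation rE := 21. Notation rR := 22. Notation rA1 := 23.
Notation rA2 := 24. Notation rXR2 := 25. Notation rACC := 26. Notation rBAD := 27.
Notation rOK := 28. Notation rT2 := 29. Notation rI2 := 30.

Notation cp := (cp sym rT).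
Notation clr := (clr sym).
Notation mv := (mv sym).

(** State of the search for [key]: the part of it still to be matched, whether the current word has
    deviated, and whether some word has matched. *)
Definition mstep (key : seq sym) (s : seq sym * bool * bool) (g : sym) :=
  let: (kc, o, f) := s in
  if g == dollar then (key, false, f || (~~ o && (kc == [::])))
  else if kc is c :: kc' then if c == g then (kc', o, f) else (kc, true, f)
  else ([::], true, f).

Definition memD (D key : seq sym) : bool := (foldl (mstep key) (key, false, false) D).2.

Definition mem_body (g : sym) : cmd sym :=
  if g == dollar then
    Case rMM (fun o => if o is Some _ then Skip _ else
      Case rKC (fun o => if o is Some _ then Skip _ else raise rFD)) ;;
    clr rMM ;; clr rKC ;; cp rKEY rKC
  else Case rKC (fun o => if o is Some c then
    if c == g then Pop _ rKC else raise rMM else raise rMM).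

Definition mem : cmd sym :=
  cp rKEY rKC ;; cp rD rD2 ;; For rD2 mem_body ;; clr rKC ;; clr rMM ;; clr rKEY.

Section Specs.
Variable B : nat.
Hypothesis B_gt0 : 0 < B.
Notation ok := (@ok sym B).

Lemma size_flag b : size (flag b) <= B.
Proof. by case: b. Qed.

Lemma mstep_size key D : size (foldl (mstep key) (key, false, false) D).1.1 <= size key.
Proof.
elim/last_ind: D => // D g; rewrite -cats1 foldl_cat /=.
case: (foldl _ _ _) => [[kc o] f] /= H; case: eqP => //= _.
by case: kc H => [|c kc] //= H; case: eqP => //= _; exact: ltnW.
Qed.

Lemma ok_mem s : s rT = [::] -> s rD2 = [::] -> s rKC = [::] -> s rMM = [::] ->
  s rFD = [::] -> size (s rD) <= B -> size (s rKEY) <= B ->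
  ok mem s (upd (upd s rKEY [::]) rFD (flag (memD (s rD) (s rKEY)))).
Proof.
move=> hT hD2 hKC hMM hFD sD sK.
set key := s rKEY; set D := s rD.
apply: ok_seq (ok_cp _ _ _ _ _) _ => //.
apply: ok_seq (ok_cp _ _ _ _ _) _ => //.
rewrite !updE /= hKC hD2 !cats0.
pose F c := foldl (mstep key) (key, false, false) c.
pose P c l := upd (upd (upd (upd s rKC (F c).1.1) rD2 l) rMM (flag (F c).1.2)) rFD (flag (F c).2).
have szF c : size (F c).1.1 <= B := leq_trans (mstep_size key c) sK.
apply: (@ok_seq _ _ _ _ _ (P D [::])).
  apply: (@ok_for _ _ P); rewrite ?updE //.
    by rewrite /P /=; store_eq.
  move=> c g l _; rewrite /P; have := szF c.
  have -> : F (rcons c g) = mstep key (F c) g by rewrite /F -cats1 foldl_cat.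
  case: (F c) => [[kc o] f] /= sF; rewrite /mem_body; case: eqP => [_|ng].
    apply: (@ok_seq _ _ _ _ _ (upd (upd (upd (upd s rKC kc) rD2 l) rMM (flag o)) rFD
        (flag (f || ~~ o && (kc == [::]))))).
      apply: ok_case; rewrite !updE /=.
      case: o => /=; first by apply: ok_eq (ok_skip _ _) _; rewrite orbF; store_eq.
      apply: ok_case; rewrite !updE /=.
      case: kc sF => [|k kc] sF /=.
        by apply: ok_eq (ok_raise (b := f) _ _) _; rewrite ?updE // orbT; store_eq.
      by apply: ok_eq (ok_skip _ _) _; rewrite orbF; store_eq.
    apply: ok_seq (ok_clr _) _; first by rewrite !updE /= size_flag.
    apply: ok_seq (ok_clr _) _; first by rewrite !updE /=.
    apply: ok_eq (ok_cp _ _ _ _ _) _; rewrite ?updE //.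
    by rewrite /=; store_eq.
  apply: ok_case; rewrite !updE /=.
  case: kc sF => [|k kc] sF /=.
    by apply: ok_eq (ok_raise (b := o) _ _) _; rewrite ?updE //; store_eq.
  case: eqP => _.
    by apply: ok_eq (ok_pop _ _ _) _; rewrite ?updE /=; store_eq.
  by apply: ok_eq (ok_raise (b := o) _ _) _; rewrite ?updE //; store_eq.
rewrite /P; apply: ok_seq (ok_clr _) _; first by rewrite !updE /=.
apply: ok_seq (ok_clr _) _; first by rewrite !updE /= size_flag.
apply: ok_eq (ok_clr _) _; first by rewrite !updE.
by store_eq.
Qed.

End Specs.

Definition lookup u i j : cmd sym :=
  cp j rKEY ;; Push rKEY sep ;; cp i rKEY ;; Push rKEY sep ;; cp u rKEY ;; mem.

Definition isS (o : option sym) : bool := if o is Some _ then true else false.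

(** Both answers pass into the control, and the flag is cleared, so [k] starts from the stacks as
    they were before the lookups. *)
Definition look2 u i1 j1 i2 j2 (k : bool -> bool -> cmd sym) : cmd sym :=
  lookup u i1 j1 ;; Case rFD (fun o => clr rFD ;;
    lookup u i2 j2 ;; Case rFD (fun o' => clr rFD ;; k (isS o) (isS o'))).

Definition eqtest (k : bool -> cmd sym) : cmd sym :=
  cp rI rT2 ;; cp rJ rI2 ;;
  For rT2 (fun=> Case rI2 (fun o => if o is Some _ then Pop _ rI2 else raise rMM)) ;;
  Case rI2 (fun o => clr rI2 ;; Case rMM (fun o' => clr rMM ;; k (~~ isS o && ~~ isS o'))).

Definition name_check : cmd sym :=
  Case rW (fun o => if o is Some _ then raise rE else Skip _).

Definition estep_cmd (g : letter) : cmd sym :=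
  match g with
  | L0 | L1 =>
      Case rB (fun o => if o is Some _ then raise rE else Skip _) ;; Push rW (lsym g)
  | Lbar => Push rB one ;; Push rW (lsym g)
  | LR => Push rW (lsym g) ;;
      Case rB (fun o => if o is None then
        look2 rW rZ rZ rZ rZ (fun b b' => Push rS (isym (b, b', None)))
      else Pop _ rB ;; Case rB (fun o => if o is None then
        look2 rW rJ rJ rI rI (fun b b' => Push rS (isym (b, b', Some false)))
      else Pop _ rB ;; Case rB (fun o => if o is None then
        look2 rW rI rJ rJ rI (fun b b' => Push rS (isym (b, b', Some true)))
      else clr rB ;; raise rE))) ;; clr rW
  | Le => name_check ;; eqtest (fun b => Push rS (isym (b, b, Some true)))
  | Ls => Case rS (fun o => if o is Some (inr a) then
        name_check ;; Pop _ rS ;; Push rS (isym (swap_item a)) else raise rE)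
  | Lneg => Case rS (fun o => if o is Some (inr a) then
        name_check ;; Pop _ rS ;; Push rS (isym (neg_item a)) else raise rE)
  | Lcap => Case rS (fun o => if o is Some (inr a) then
        Pop _ rS ;; Case rS (fun o => if o is Some (inr a') then
          name_check ;; Pop _ rS ;; Push rS (isym (cap_item a a')) else raise rE)
      else raise rE)
  | Lex => Case rS (fun o => if o is Some (inr a) then
        name_check ;; Pop _ rS ;; Push rV (lsym g) ;;
        look2 rV rJ rJ rI rI (fun b b' => Push rS (isym (b, b', pred_arity a.2))) ;;
        Pop _ rV
      else raise rE)
  end.

Definition ev_cmd : cmd sym :=
  cp rU rT2 ;; mv rT2 rR ;;
  For rR (fun x => if x is inl g then estep_cmd g ;; Push rV (lsym g) else Skip _) ;;
  clr rV.

Definition clean (s : store sym) : Prop :=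
  [/\ s rT = [::], s rD2 = [::], s rKEY = [::] & s rKC = [::]] /\
  [/\ s rMM = [::], s rFD = [::], s rZ = [::], s rT2 = [::] & s rI2 = [::]].

Definition keystr (u : seq letter) i j : seq sym :=
  map lsym u ++ sep :: nseq i one ++ sep :: nseq j one.

Definition oracle (D : seq sym) u i j : bool := memD D (keystr u i j).

Section Specs.
Variable B : nat.
Hypothesis B_gt0 : 0 < B.
Notation ok := (@ok sym B).

Lemma ok_lookup u i j w a b s : clean s ->
  s u = map lsym w -> s i = nseq a one -> s j = nseq b one ->
  all (fun r => r \notin [:: rKEY; rT]) [:: u; i; j] ->
  size w + a + b + 2 <= B -> size (s rD) <= B ->
  ok (lookup u i j) s (upd s rFD (flag (oracle (s rD) w a b))).
Proof.
move=> [[hT hD2 hK hKC] [hMM hFD _ _ _]] eu ei ej.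
rewrite /= andbT !inE !negb_or => /and3P [/andP [u9 u7] /andP [i9 i7] /andP [j9 j7]] sB sD.
have szu : size (s u) = size w by rewrite eu size_map.
have szi : size (s i) = a by rewrite ei size_nseq.
have szj : size (s j) = b by rewrite ej size_nseq.
apply: ok_seq (ok_cp _ _ _ _ _) _; rewrite ?[7 == _]eq_sym //; first by lia.
apply: ok_seq (ok_push _ _ _ _) _.
apply: ok_seq (ok_cp _ _ _ _ _) _; rewrite ?updE ?[7 == _]eq_sym //=; first by rewrite (negbTE i9) szi; lia.
apply: ok_seq (ok_push _ _ _ _) _.
apply: ok_seq (ok_cp _ _ _ _ _) _; rewrite ?updE ?[7 == _]eq_sym //=; first by rewrite (negbTE u9) szu; lia.
apply: ok_eq (ok_mem _ _ _ _ _ _ _ _) _; rewrite ?updE //=.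
  by rewrite (negbTE u9) (negbTE i9) hK cats0 !size_cat /= !size_cat /= szu szi szj; lia.
rewrite (negbTE u9) (negbTE i9) hK cats0 eu ei ej -/(keystr w a b) -/(oracle _ _ _ _).
by store_eq.
Qed.

Lemma ok_look2 u i1 j1 i2 j2 w a1 b1 a2 b2 k s s' : clean s ->
  s u = map lsym w -> s i1 = nseq a1 one -> s j1 = nseq b1 one ->
  s i2 = nseq a2 one -> s j2 = nseq b2 one ->
  all (fun r => r \notin [:: rKEY; rT]) [:: u; i1; j1; i2; j2] ->
  size w + a1 + b1 + 2 <= B -> size w + a2 + b2 + 2 <= B -> size (s rD) <= B ->
  ok (k (oracle (s rD) w a1 b1) (oracle (s rD) w a2 b2)) s s' ->
  ok (look2 u i1 j1 i2 j2 k) s s'.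
Proof.
move=> cl eu ei1 ej1 ei2 ej2 /= /and5P [hu h1 h2 h3 /andP [h4 _]] B1 B2 sD Hk.
have FD : s rFD = [::] by case: cl => _ [].
have back b : upd (upd s rFD (flag b)) rFD [::] = s by rewrite upd_upd -FD upd_id.
have step b (c : cmd sym) : ok c s s' -> ok (clr rFD ;; c) (upd s rFD (flag b)) s'.
  move=> H; apply: ok_seq (ok_clr _) _; first by rewrite updE /= size_flag.
  by rewrite back.
apply: ok_seq (ok_lookup cl eu ei1 ej1 _ B1 sD) _; first by rewrite /= hu h1 h2.
apply: ok_case; rewrite updE /=; apply: (step _ _).
apply: ok_seq (ok_lookup cl eu ei2 ej2 _ B2 sD) _; first by rewrite /= hu h3 h4.
apply: ok_case; rewrite updE /=; apply: (step _ _).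
by move: Hk; do 2 case: (oracle _ _ _ _).
Qed.

Lemma ok_eqtest i j k s s' : clean s ->
  s rI = nseq i one -> s rJ = nseq j one -> i <= B -> j <= B ->
  ok (k (i == j)) s s' -> ok (eqtest k) s s'.
Proof.
move=> cl ei ej iB jB Hk; case: (cl) => [[hT _ _ _] [hMM _ _ hT2 hI2]].
apply: ok_seq (ok_cp _ _ _ _ _) _; rewrite ?ei ?size_nseq //.
apply: ok_seq (ok_cp _ _ _ _ _) _; rewrite ?updE /= ?ej ?size_nseq // hT2 hI2 !cats0.
pose P (c l : seq sym) := upd (upd (upd s rT2 l) rI2 (nseq (j - size c) one)) rMM (flag (j < size c)).
apply: (@ok_seq _ _ _ _ _ (P (nseq i one) [::])).
  apply: (@ok_for _ _ P); rewrite ?updE /= ?size_nseq //.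
    by rewrite /P /= subn0; store_eq.
  move=> c g l e; apply: ok_case; rewrite /P !updE /= size_rcons.
  have [le|lt] := leqP j (size c).
    have -> : j - size c = 0 by lia.
    have -> : j - (size c).+1 = 0 by lia.
    apply: ok_eq (ok_raise (b := j < size c) _ _) _; rewrite ?updE //=; rewrite ltnS le /=.
    by store_eq.
  have -> : j - size c = (j - (size c).+1).+1 by lia.
  have -> : j < (size c).+1 = false by lia.
  have -> : j < size c = false by lia.
  by apply: ok_eq (ok_pop _ _ _) _; rewrite !updE /=; store_eq.
rewrite /P size_nseq; apply: ok_case; rewrite !updE /=.
apply: ok_seq (ok_clr _) _; first by rewrite updE /= size_nseq; lia.
apply: ok_case; rewrite !updE /=.
apply: ok_seq (ok_clr _) _; first by rewrite !updE /= size_flag.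
have -> : upd (upd (upd (upd (upd s rT2 [::]) rI2 (nseq (j - i) one)) rMM (flag (j < i))) rI2 [::]) rMM [::] = s.
  by store_eq.
suff -> : ~~ isS (ohead (nseq (j - i) one)) && ~~ isS (ohead (flag (j < i))) = (i == j) by [].
case: (ltngtP i j) => [lt|lt|->].
- by have -> : j - i = (j - i).-1.+1 by lia.
- by rewrite andbF.
- by rewrite subnn.
Qed.

Definition put (s : store sym) (v : seq letter) (t : estate) : store sym :=
  upd (upd (upd (upd (upd s rV (map lsym v)) rW (map lsym (ename t)))
    rB (nseq (ebars t) one)) rS (map isym (estack t))) rE (flag (eerror t)).

Lemma ok_name_check s v t : ok name_check (put s v t)
  (put s v (EState (ename t) (ebars t) (estack t) (eerror t || (ename t != [::])))).
Proof.
apply: ok_case; rewrite /put !updE /=; case: t => [[|x w] b st e] /=.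
  by apply: ok_eq (ok_skip _ _) _; rewrite orbF.
by apply: ok_eq (ok_raise (b := e) _ _) _; rewrite ?updE // orbT; store_eq.
Qed.

Lemma put_S s v t : put s v t rS = map isym (estack t).
Proof. by []. Qed.

Ltac put_eq := rewrite /put; store_eq.

Lemma ok_estep s i j g v t : clean s -> s rI = nseq i one -> s rJ = nseq j one ->
  size v + i + i + j + j + 3 <= B -> size (ename t) <= size v -> ebars t <= size v ->
  size (s rD) <= B ->
  ok (estep_cmd g) (put s v t) (put s v (estep (oracle (s rD)) i j g v t)).
Proof.
move=> cl ei ej sB sW sb sD.
have clp v' t' : clean (put s v' t') by [].
case: t sW sb => w b st e /= sW sb; case: g => /=.
- apply: ok_seq (ok_push _ _ _ _) _.
  apply: (@ok_seq _ _ _ _ _ (upd (put s v (estep (oracle (s rD)) i j LR v (EState w b st e))) rW (map lsym (LR :: w)))); last first.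
    by apply: ok_eq (ok_clr _) _; [rewrite updE /= size_map; lia | case: b sb => [|[|[|b]]] _; put_eq].
  apply: ok_case; rewrite /put ?updE /=; case: b sb => [|b] sb /=.
    apply: (ok_look2 (w := LR :: w) (a1 := 0) (b1 := 0) (a2 := 0) (b2 := 0)); rewrite ?updE //=; try lia; try by case: cl => _ [].
    by apply: ok_eq (ok_push _ _ _ _) _; rewrite ?updE /=; put_eq.
  apply: ok_seq (ok_pop _ _ _) _; apply: ok_case; rewrite /put ?updE /=; case: b sb => [|b] sb /=.
    apply: (ok_look2 (w := LR :: w) (a1 := j) (b1 := j) (a2 := i) (b2 := i)); rewrite ?updE //=; try lia.
    by apply: ok_eq (ok_push _ _ _ _) _; rewrite ?updE /=; put_eq.
  apply: ok_seq (ok_pop _ _ _) _; apply: ok_case; rewrite /put ?updE /=; case: b sb => [|b] sb /=.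
    apply: (ok_look2 (w := LR :: w) (a1 := i) (b1 := j) (a2 := j) (b2 := i)); rewrite ?updE //=; try lia.
    by apply: ok_eq (ok_push _ _ _ _) _; rewrite ?updE /=; put_eq.
  apply: ok_seq (ok_clr _) _; first by rewrite /put ?updE /= size_nseq; lia.
  by apply: ok_eq (ok_raise (b := e) _ _) _; rewrite ?updE //=; put_eq.
- apply: ok_seq (ok_push _ _ _ _) _.
  by apply: ok_eq (ok_push _ _ _ _) _; rewrite ?updE /=; put_eq.
- apply: (@ok_seq _ _ _ _ _ (put s v (EState w b st (e || (0 < b))))); last first.
    by apply: ok_eq (ok_push _ _ _ _) _; rewrite ?updE /=; put_eq.
  apply: ok_case; rewrite /put ?updE /=; case: b {sb} => [|b] /=.
    by apply: ok_eq (ok_skip _ _) _; rewrite orbF.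
  by apply: ok_eq (ok_raise (b := e) _ _) _; rewrite ?updE // orbT; put_eq.
- apply: (@ok_seq _ _ _ _ _ (put s v (EState w b st (e || (0 < b))))); last first.
    by apply: ok_eq (ok_push _ _ _ _) _; rewrite ?updE /=; put_eq.
  apply: ok_case; rewrite /put ?updE /=; case: b {sb} => [|b] /=.
    by apply: ok_eq (ok_skip _ _) _; rewrite orbF.
  by apply: ok_eq (ok_raise (b := e) _ _) _; rewrite ?updE // orbT; put_eq.
- apply: ok_seq (ok_name_check _ _ _) _.
  apply: (ok_eqtest (i := i) (j := j)); rewrite ?updE //; try lia.
  by apply: ok_eq (ok_push _ _ _ _) _; rewrite ?updE /=; put_eq.
- apply: ok_case; rewrite put_S; case: st => [|a st]; rewrite /= /isym /=.
    by apply: ok_eq (ok_raise (b := e) _ _) _; rewrite ?updE //=; put_eq.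
  apply: ok_seq (ok_name_check _ _ _) _; apply: ok_seq (ok_pop _ _ _) _.
  by apply: ok_eq (ok_push _ _ _ _) _; rewrite ?updE /=; put_eq.
- apply: ok_case; rewrite put_S; case: st => [|a st]; rewrite /= /isym /=.
    by apply: ok_eq (ok_raise (b := e) _ _) _; rewrite ?updE //=; put_eq.
  apply: ok_seq (ok_name_check _ _ _) _; apply: ok_seq (ok_pop _ _ _) _.
  by apply: ok_eq (ok_push _ _ _ _) _; rewrite ?updE /=; put_eq.
- apply: ok_case; rewrite put_S; case: st => [|a st]; rewrite /= /isym /=.
    by apply: ok_eq (ok_raise (b := e) _ _) _; rewrite ?updE //=; put_eq.
  apply: (@ok_seq _ _ _ _ _ (put s v (EState w b st e))).
    by apply: ok_eq (ok_pop _ _ _) _; rewrite ?updE /=; put_eq.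
  apply: ok_case; rewrite put_S; case: st => [|a' st]; rewrite /= /isym /=.
    by apply: ok_eq (ok_raise (b := e) _ _) _; rewrite ?updE //=; put_eq.
  apply: ok_seq (ok_name_check _ _ _) _; apply: ok_seq (ok_pop _ _ _) _.
  by apply: ok_eq (ok_push _ _ _ _) _; rewrite ?updE /=; put_eq.
- apply: ok_case; rewrite put_S; case: st => [|a st]; rewrite /= /isym /=.
    by apply: ok_eq (ok_raise (b := e) _ _) _; rewrite ?updE //=; put_eq.
  apply: ok_seq (ok_name_check _ _ _) _; apply: ok_seq (ok_pop _ _ _) _.
  apply: ok_seq (ok_push _ _ _ _) _; set s1 := upd _ rV _.
  pose O := oracle (s rD) (Lex :: v).
  apply: (@ok_seq _ _ _ _ _ (upd s1 rS (isym (O j j, O i i, pred_arity a.2) :: s1 rS))).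
    apply: (ok_look2 (w := Lex :: v) (a1 := j) (b1 := j) (a2 := i) (b2 := i)) => //=; try lia.
  by apply: ok_eq (ok_pop _ _ _) _; rewrite /s1 ?updE /=; put_eq.
Qed.

End Specs.

(* [size] may appear at two convertible types of symbols. *)
Ltac slia := unfold sym in *; simpl in *; lia.

Definition dec (x : sym) : letter := if x is inl g then g else LR.

Lemma lsymK : cancel lsym dec.
Proof. by []. Qed.

Lemma rev_lsym u c g l : rev (map lsym u) = c ++ g :: l ->
  map lsym (map dec c) = c /\ lsym (dec g) = g.
Proof.
move=> e; have : all (fun x => lsym (dec x) == x) (c ++ g :: l).
  rewrite -e all_rev all_map; apply/allP => y _ /=; exact: eqxx.
rewrite all_cat => /andP [hc /= /andP [/eqP hg _]].
split=> //; rewrite -[RHS]map_id -map_comp; apply/eq_in_map => y yc.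
by apply/eqP; move/allP: hc; apply.
Qed.

Definition evclear : cmd sym := clr rW ;; clr rB ;; clr rS ;; clr rE.

Definition ev_top (k : bool -> cmd sym) : cmd sym :=
  ev_cmd ;; Case rS (fun o =>
    evclear ;; k (if o is Some (inr a) then a.1.1 else false)).

Definition ev_acc (k : bool -> cmd sym) : cmd sym :=
  ev_cmd ;; Case rW (fun w => Case rS (fun o => Pop _ rS ;; Case rS (fun o' =>
    Case rE (fun e => evclear ;;
      k [&& ~~ isS w, (if o is Some (inr a) then a.1.1 else false), ~~ isS o' & ~~ isS e])))).

Definition ex_test : cmd sym :=
  cp rA rA2 ;;
  For rA2 (fun=> ev_top (fun b => if b then raise rACC else Skip _) ;; Push rJ one) ;;
  clr rJ ;; Push rU (lsym Lex) ;; lookup rU rI rI ;; Pop _ rU ;;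
  Case rFD (fun o => clr rFD ;; Case rACC (fun o' => clr rACC ;;
    if isS o == isS o' then Skip _ else raise rBAD)).

(** Consuming the reversed input rebuilds the input on [rU] from the right, so at a letter [Lex]
    stack [rU] holds exactly the suffix after it. *)
Definition chk_ex : cmd sym :=
  cp rA rA1 ;;
  For rA1 (fun=> cp rXR rXR2 ;;
    For rXR2 (fun x => (if x == lsym Lex then ex_test else Skip _) ;; Push rU x) ;;
    clr rU ;; Push rI one) ;;
  clr rI.

Definition chk_acc : cmd sym :=
  cp rXR rT2 ;; mv rT2 rU ;; cp rA rA1 ;;
  For rA1 (fun=> cp rA rA2 ;;
    For rA2 (fun=> ev_acc (fun b => if b then raise rOK else Skip _) ;; Push rJ one) ;;
    clr rJ ;; Push rI one) ;;
  clr rI ;; clr rU.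

Lemma ev_size h i j u :
  size (ename (ev h i j u)) <= size u /\ ebars (ev h i j u) <= size u /\
  size (estack (ev h i j u)) <= size u.
Proof.
elim: u => //= g u; case: (ev _ _ _ _) => w b st e /=.
case: g => /=; try by lia.
- by case: b => [|[|[|b]]] /=; lia.
- by case: st => [|a st] /=; lia.
- by case: st => [|a st] /=; lia.
- by case: st => [|a [|a' st]] /=; lia.
- by case: st => [|a st] /=; lia.
Qed.

Section Specs.
Variable B : nat.
Hypothesis B_gt0 : 0 < B.
Notation ok := (@ok sym B).

Definition idle (s : store sym) : Prop :=
  clean s /\ [/\ s rV = [::], s rW = [::], s rB = [::], s rS = [::] & s rE = [::]] /\ s rR = [::].

Lemma ok_ev s u i j : idle s -> s rI = nseq i one -> s rJ = nseq j one ->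
  s rU = map lsym u -> size u + i + i + j + j + 3 <= B -> size (s rD) <= B ->
  ok ev_cmd s (put s [::] (ev (oracle (s rD)) i j u)).
Proof.
move=> [cl [[hV hW hB hS hE] hR]] ei ej eu sB sD.
have [[hT _ _ _] [_ _ _ hT2 _]] := cl.
apply: ok_seq (ok_cp _ _ _ _ _) _; rewrite ?eu ?size_map //; try lia.
apply: ok_seq (ok_mv _ _) _; rewrite ?updE //=.
  by rewrite size_cat size_map hT2 /=; lia.
rewrite hT2 hR !cats0.
set F := fun c => ev (oracle (s rD)) i j (rev (map dec c)).
pose P (c l : seq sym) := upd (put s (rev (map dec c)) (F c)) rR l.
have sF (c : seq sym) : size c <= size u -> [/\ size (ename (F c)) <= size (map dec c), ebars (F c) <= size (map dec c) &
    size (estack (F c)) <= size (map dec c)].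
  by have := ev_size (oracle (s rD)) i j (rev (map dec c)); rewrite size_rev => -[? [? ?]].
apply: (@ok_seq _ _ _ _ _ (P (rev (map lsym u)) [::])).
  apply: (@ok_for _ _ P); rewrite ?updE //=.
  - by rewrite size_rev size_map; lia.
  - by rewrite /P /put /=; store_eq.
  move=> c x l e; have [ec eg] := rev_lsym e; rewrite -eg /=.
  have szc : size c < size u.
    by have := congr1 size e; rewrite size_rev size_map size_cat /=; lia.
  have [s1 s2 s3] := sF c (ltnW szc); rewrite size_map in s1 s2 s3.
  have -> : upd (P c (lsym (dec x) :: l)) rR l = put (upd s rR l) (rev (map dec c)) (F c).
    by rewrite /P /put; store_eq.
  apply: ok_seq.
    by apply: (@ok_estep B _ (upd s rR l) i j) => //; rewrite ?size_rev ?size_map //; slia.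
  apply: ok_eq (ok_push _ _ _ _) _.
  rewrite /P /F map_rcons rev_rcons /= -/(F c).
  by rewrite /put /=; store_eq.
rewrite /P /F map_rev revK (mapK lsymK).
apply: ok_eq (ok_clr _) _; first by rewrite updE /= size_map; lia.
by rewrite /put; store_eq.
Qed.

Lemma ok_evclear s t : idle s -> size (ename t) <= B -> ebars t <= B ->
  size (estack t) <= B -> ok evclear (put s [::] t) s.
Proof.
move=> [_ [[hV hW hB hS hE] hR]] s1 s2 s3.
apply: ok_seq (ok_clr _) _; first by rewrite /= size_map.
apply: ok_seq (ok_clr _) _; first by rewrite /= size_nseq.
apply: ok_seq (ok_clr _) _; first by rewrite /= size_map.
apply: ok_eq (ok_clr _) _; first by rewrite /= size_flag.
by rewrite /put; store_eq.
Qed.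

Lemma ok_ev_top s u i j k s' : idle s -> s rI = nseq i one -> s rJ = nseq j one ->
  s rU = map lsym u -> size u + i + i + j + j + 3 <= B -> size (s rD) <= B ->
  ok (k (top (ev (oracle (s rD)) i j u))) s s' -> ok (ev_top k) s s'.
Proof.
move=> id ei ej eu sB sD Hk; apply: ok_seq (ok_ev id ei ej eu sB sD) _.
have [s1 [s2 s3]] := ev_size (oracle (s rD)) i j u.
move: Hk s1 s2 s3; set t := ev _ _ _ _ => Hk s1 s2 s3.
apply: ok_case; apply: ok_seq (ok_evclear id _ _ _) _; try by lia.
by rewrite put_S; move: Hk; rewrite /top; case: (estack t).
Qed.

Lemma ok_ev_acc s u i j k s' : idle s -> s rI = nseq i one -> s rJ = nseq j one ->
  s rU = map lsym u -> size u + i + i + j + j + 3 <= B -> size (s rD) <= B ->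
  ok (k (accepted (ev (oracle (s rD)) i j u))) s s' -> ok (ev_acc k) s s'.
Proof.
move=> id ei ej eu sB sD Hk; apply: ok_seq (ok_ev id ei ej eu sB sD) _.
have [s1 [s2 s3]] := ev_size (oracle (s rD)) i j u.
move: Hk s1 s2 s3; case: (ev _ _ _ _) => w b st e Hk /= s1 s2 s3.
apply: ok_case; apply: ok_case; apply: ok_seq (ok_pop _ _ _) _.
have -> : upd (put s [::] (EState w b st e)) rS (behead (put s [::] (EState w b st e) rS)) =
    put s [::] (EState w b (behead st) e).
  by rewrite /put; case: st {Hk s3} => [|a st]; store_eq.
do 2 apply: ok_case; apply: ok_seq (ok_evclear id _ _ _) _ => /=; try by lia.
  by rewrite size_behead; lia.
by move: Hk; rewrite /accepted /top /=; case: w {s1} => [|? ?] //=; case: st {s3} => [|a [|a' st]] //=; case: e.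
Qed.

Variables (x : seq letter) (N : nat) (D : seq sym).
Hypothesis B_big : size x + 4 * N + 4 <= B.
Hypothesis D_B : size D <= B.
Let O := oracle D.

Definition ready (s : store sym) : Prop :=
  [/\ idle s, s rD = D, s rA = nseq N one & s rXR = map lsym (rev x)] /\
  [/\ s rJ = [::], s rA2 = [::] & s rACC = [::]].

Definition ex_ok i u : bool := O (Lex :: u) i i == has (fun c => top (ev O i c u)) (iota 0 N).

Lemma iota_rcons m : iota 0 m.+1 = rcons (iota 0 m) m.
Proof. by rewrite -cats1 -(iotaD 0 m 1) addn1. Qed.

Lemma has_iota_rcons (p : pred nat) m : has p (iota 0 m.+1) = has p (iota 0 m) || p m.
Proof. by rewrite iota_rcons has_rcons orbC. Qed.

Lemma ok_ex_test s u i bad : ready s -> s rU = map lsym u -> s rI = nseq i one ->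
  size u < size x -> i < N -> s rBAD = flag bad ->
  ok ex_test s (upd s rBAD (flag (bad || ~~ ex_ok i u))).
Proof.
move=> [[id hD hA hXR] [hJ hA2 hACC]] eu ei su iN hbad.
have [cl _] := id; have [[hT _ hKEY _] [_ hFD _ hT2 _]] := cl.
apply: ok_seq (ok_cp _ _ _ _ _) _; rewrite ?hA ?size_nseq //; first by lia.
rewrite hA2 cats0.
pose H m := has (fun c => top (ev O i c u)) (iota 0 m).
pose P (c l : seq sym) := upd (upd (upd s rA2 l) rJ (nseq (size c) one)) rACC (flag (H (size c))).
apply: (@ok_seq _ _ _ _ _ (P (nseq N one) [::])).
  apply: (@ok_for _ _ P); rewrite ?updE ?size_nseq //=; first by lia.
    by rewrite /P /=; store_eq.
  move=> c g l e; have cN : size c < N.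
    by have := congr1 size e; rewrite size_nseq size_cat /=; lia.
  rewrite /P size_rcons; apply: (@ok_seq _ _ _ _ _ (upd (upd (upd s rA2 l) rJ (nseq (size c) one)) rACC (flag (H (size c).+1)))).
    have id' : idle (upd (upd (upd (upd s rA2 (g :: l)) rJ (nseq (size c) one)) rACC (flag (H (size c)))) rA2 l) by [].
    apply: (ok_ev_top (u := u) (i := i) (j := size c) id'); rewrite ?updE //=; try lia.
      by rewrite hD.
    rewrite hD -/O /H has_iota_rcons -/(H _); case: (top _).
      by apply: ok_eq (ok_raise (b := H (size c)) _ _) _; rewrite ?updE // orbT; store_eq.
    by apply: ok_eq (ok_skip _ _) _; rewrite orbF; store_eq.
  by apply: ok_eq (ok_push _ _ _ _) _; rewrite ?updE /=; store_eq.
rewrite /P size_nseq.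
apply: ok_seq (ok_clr _) _; first by rewrite ?updE /= size_nseq; lia.
apply: ok_seq (ok_push _ _ _ _) _.
apply: ok_seq.
  apply: (ok_lookup _ (w := Lex :: u) (a := i) (b := i)); rewrite ?updE //=; try lia.
    by rewrite eu.
  by rewrite hD.
apply: ok_seq (ok_pop _ _ _) _; apply: ok_case; rewrite !updE /=.
apply: ok_seq (ok_clr _) _; first by rewrite !updE /= size_flag.
apply: ok_case; rewrite !updE /=.
apply: ok_seq (ok_clr _) _; first by rewrite !updE /= size_flag.
rewrite hD -/O /ex_ok -/(H N).
have iS b : isS (ohead (flag b)) = b by case: b.
rewrite !iS; case: eqP => _.
  by apply: ok_eq (ok_skip _ _) _; rewrite orbF; store_eq.
by apply: ok_eq (ok_raise (b := bad) _ _) _; rewrite ?updE // orbT; store_eq.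
Qed.

Lemma suffix_consE (X : eqType) (s u : seq X) g :
  suffix s (g :: u) = (s == g :: u) || suffix s u.
Proof.
apply/suffixP/orP => [[[|y w] /= e]|[/eqP ->|/suffixP [w ->]]].
- by left; rewrite e.
- by case: e => _ ->; right; apply/suffixP; exists w.
- by exists [::].
- by exists (g :: w).
Qed.

Fixpoint bad_in i (u : seq letter) : bool :=
  if u is g :: v then bad_in i v || (g == Lex) && ~~ ex_ok i v else false.

Lemma bad_inP : (forall i, i < N -> ~~ bad_in i x) <-> check_ex O N x.
Proof.
have gen i u : ~~ bad_in i u <-> forall v, suffix (Lex :: v) u -> ex_ok i v.
  elim: u => [|g u [IH1 IH2]] /=; first by split=> // _ v; rewrite suffixs0.
  rewrite negb_or negb_and negbK; split=> [/andP [/IH1 H1 H2] v|H].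
    rewrite suffix_consE => /orP [/eqP [e ->]|]; last exact: H1.
    by move: H2; rewrite -e eqxx.
  apply/andP; split; first by apply: IH2 => v sv; apply: H; rewrite suffix_consE sv orbT.
  by case: eqP => //= e; apply: H; rewrite e suffix_refl.
split=> [H i u iN /((gen i x).1 (H i iN)) /eqP //|H i iN].
by apply/gen => v sv; apply/eqP/H.
Qed.

Lemma ok_chk_ex s : ready s -> s rU = [::] -> s rI = [::] -> s rA1 = [::] ->
  s rXR2 = [::] -> s rBAD = [::] ->
  ok chk_ex s (upd s rBAD (flag (has (bad_in^~ x) (iota 0 N)))).
Proof.
move=> rd hU hI hA1 hXR2 hB; have [[id hD hA hXR] [hJ hA2 hACC]] := rd.
have [cl _] := id; have [[hT _ hKEY _] [_ hFD _ hT2 _]] := cl.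
apply: ok_seq (ok_cp _ _ _ _ _) _; rewrite ?hA ?size_nseq //; first by lia.
rewrite hA1 cats0.
pose H m := has (bad_in^~ x) (iota 0 m).
pose P (c l : seq sym) := upd (upd (upd s rA1 l) rI (nseq (size c) one)) rBAD (flag (H (size c))).
apply: (@ok_seq _ _ _ _ _ (P (nseq N one) [::])); last first.
  rewrite /P size_nseq; apply: ok_eq (ok_clr _) _; first by rewrite !updE /= size_nseq; lia.
  by store_eq.
apply: (@ok_for _ _ P); rewrite ?updE ?size_nseq //=; first by lia.
  by rewrite /P /=; store_eq.
move=> c g l e; have cN : size c < N.
  by have := congr1 size e; rewrite size_nseq size_cat /=; lia.
rewrite /P size_rcons; set i := size c; set b := H i.
have -> : upd (upd (upd (upd s rA1 (g :: l)) rI (nseq i one)) rBAD (flag b)) rA1 l =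
  upd (upd (upd s rA1 l) rI (nseq i one)) rBAD (flag b) by store_eq.
apply: ok_seq (ok_cp _ _ _ _ _) _; rewrite ?updE //=.
  by rewrite hXR size_map size_rev; lia.
rewrite hXR hXR2 cats0.
pose Q (c l' : seq sym) := upd (upd (upd (upd (upd s rA1 l) rI (nseq i one)) rXR2 l')
  rU (map lsym (rev (map dec c)))) rBAD (flag (b || bad_in i (rev (map dec c)))).
apply: (@ok_seq _ _ _ _ _ (Q (map lsym (rev x)) [::])).
  apply: (@ok_for _ _ Q); rewrite ?updE /= ?size_map ?size_rev //; first by lia.
    by rewrite /Q /= orbF; store_eq.
  move=> c' y l'; rewrite map_rev => e'; have [ec eg] := rev_lsym e'.
  have sc' : size c' < size x.
    by have := congr1 size e'; rewrite size_rev size_map size_cat /=; lia.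
  rewrite -eg {1}/Q.
  apply: (@ok_seq _ _ _ _ _ (upd (upd (upd (upd (upd s rA1 l) rI (nseq i one)) rXR2 l')
    rU (map lsym (rev (map dec c')))) rBAD (flag (b || bad_in i (rev (map dec (rcons c' (lsym (dec y))))))))).
    rewrite map_rcons rev_rcons ?lsymK /=.
    have -> : (lsym (dec y) == lsym Lex) = (dec y == Lex).
      by apply/eqP/eqP => [[]|->].
    case: eqP => [->|_] /=.
      rewrite orbA; apply: ok_eq.
        apply: (@ok_ex_test _ (rev (map dec c')) i (b || bad_in i (rev (map dec c')))); rewrite ?updE //.
        by rewrite size_rev size_map.
      by store_eq.
    by apply: ok_eq (ok_skip _ _) _; rewrite orbF; store_eq.
  by apply: ok_eq (ok_push _ _ _ _) _; rewrite /Q map_rcons rev_rcons ?updE /= ?lsymK; store_eq.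
rewrite /Q (mapK lsymK) revK.
apply: ok_seq (ok_clr _) _; first by rewrite !updE /= size_map; lia.
apply: ok_eq (ok_push _ _ _ _) _; rewrite /H has_iota_rcons -/(H _) -/b.
by rewrite !updE /=; store_eq.
Qed.

End Specs.

(** Every guess has a meaning: [dommark] counts elements, [junk] is padding up to the prescribed
    length, and the remaining letters form the list of facts. *)
Definition split_cmd : cmd sym :=
  For rY (fun y => if y == dommark then Push rA one else
    if y == junk then Skip _ else Push rD y).

Definition verdict : cmd sym :=
  Case rBAD (fun o => if o is Some _ then clr rOK else Skip _).

Definition checker : cmd sym := split_cmd ;; chk_ex ;; chk_acc ;; verdict.

Definition double : cmd sym := For rC (fun=> Push rC2 one ;; Push rC2 one) ;; mv rC2 rC.

Definition doubles (a : nat) : cmd sym := iter a (fun c => double ;; c) (Skip _).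

(** Doubling [a] times per letter turns a single mark into [2 ^ (a * n)] marks, the length of the
    guess; the same pass reverses the input. *)
Definition counter (a : nat) : cmd sym :=
  Push rC one ;; For rX (fun g => Push rXR g ;; doubles a).

Definition acc_all (O : seq letter -> nat -> nat -> bool) (N : nat) x : bool :=
  has (fun i => has (fun j => accepted (ev O i j x)) (iota 0 N)) (iota 0 N).

Lemma acc_allP O N x : acc_all O N x <-> check_acc O N x.
Proof.
split=> [/hasP [i]|[i [j [iN jN a]]]].
  by rewrite mem_iota /= => iN /hasP [j]; rewrite mem_iota => jN a; exists i, j.
by apply/hasP; exists i; rewrite ?mem_iota //; apply/hasP; exists j; rewrite ?mem_iota.
Qed.

Definition domsize (y : seq sym) : nat := count_mem dommark y.
Definition keys_of (y : seq sym) : seq sym :=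
  rev [seq z <- y | (z != dommark) && (z != junk)].

Lemma size_parts y : domsize y <= size y /\ size (keys_of y) <= size y.
Proof. by rewrite /keys_of size_rev size_filter !count_size. Qed.

Section Specs.
Variable B : nat.
Hypothesis B_gt0 : 0 < B.
Notation ok := (@ok sym B).

Lemma ok_chk_acc x N D s : size x + 4 * N + 4 <= B -> size D <= B ->
  ready x N D s -> s rU = [::] -> s rI = [::] -> s rA1 = [::] -> s rOK = [::] ->
  ok chk_acc s (upd s rOK (flag (acc_all (oracle D) N x))).
Proof.
move=> sB sD [[id hD hA hXR] [hJ hA2 hACC]] hU hI hA1 hOK.
have [cl _] := id; have [[hT _ hKEY _] [_ hFD _ hT2 _]] := cl.
apply: ok_seq (ok_cp _ _ _ _ _) _; rewrite ?hXR ?size_map ?size_rev //; first by lia.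
apply: ok_seq (ok_mv _ _) _; rewrite ?updE //= ?size_cat ?size_map ?size_rev hT2 /=; first by lia.
rewrite hU !cats0 -map_rev revK.
apply: ok_seq (ok_cp _ _ _ _ _) _; rewrite ?updE //= ?hA ?size_nseq; first by lia.
rewrite hA1 cats0; set O := oracle D.
pose acc i j := accepted (ev O i j x).
pose H m := has (fun i => has (acc i) (iota 0 N)) (iota 0 m).
pose P (c l : seq sym) := upd (upd (upd (upd s rU (map lsym x)) rA1 l) rI (nseq (size c) one)) rOK (flag (H (size c))).
apply: (@ok_seq _ _ _ _ _ (P (nseq N one) [::])); last first.
  rewrite /P size_nseq; apply: ok_seq (ok_clr _) _; first by rewrite !updE /= size_nseq; lia.
  apply: ok_eq (ok_clr _) _; first by rewrite !updE /= size_map; lia.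
  by store_eq.
apply: (@ok_for _ _ P); rewrite ?updE ?size_nseq //=; first by lia.
  by rewrite /P /=; store_eq.
move=> c g l e; have cN : size c < N.
  by have := congr1 size e; rewrite size_nseq size_cat /=; lia.
rewrite /P size_rcons; set i := size c; set b := H i.
have -> : upd (upd (upd (upd (upd s rU (map lsym x)) rA1 (g :: l)) rI (nseq i one)) rOK (flag b)) rA1 l =
  upd (upd (upd (upd s rU (map lsym x)) rA1 l) rI (nseq i one)) rOK (flag b) by store_eq.
apply: ok_seq (ok_cp _ _ _ _ _) _; rewrite ?updE //= ?hA ?size_nseq; first by lia.
rewrite hA2 cats0.
pose Hi m := has (acc i) (iota 0 m).
pose Q (c l' : seq sym) := upd (upd (upd (upd (upd (upd s rU (map lsym x)) rA1 l) rI (nseq i one)) rA2 l')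
  rJ (nseq (size c) one)) rOK (flag (b || Hi (size c))).
apply: (@ok_seq _ _ _ _ _ (Q (nseq N one) [::])).
  apply: (@ok_for _ _ Q); rewrite ?updE /= ?size_nseq //; first by lia.
    by rewrite /Q /= orbF; store_eq.
  move=> c' y l' e'; have jN : size c' < N.
    by have := congr1 size e'; rewrite size_nseq size_cat /=; lia.
  rewrite /Q size_rcons; apply: (@ok_seq _ _ _ _ _ (upd (upd (upd (upd (upd (upd s rU (map lsym x)) rA1 l) rI (nseq i one)) rA2 l')
      rJ (nseq (size c') one)) rOK (flag (b || Hi (size c').+1)))).
    have -> : Hi (size c').+1 = Hi (size c') || acc i (size c') by exact: has_iota_rcons.
    set s1 := upd _ rA2 l'; have id1 : idle s1 by [].
    have hD1 : s1 rD = D by [].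
    apply: (ok_ev_acc B_gt0 (u := x) (i := i) (j := size c') id1); rewrite ?updE //=; try lia.
      by rewrite hD1.
    rewrite hD1 -/O -/(acc i _) /s1 orbA; case: (acc i _).
      by apply: ok_eq (ok_raise (b := b || Hi (size c')) _ _) _; rewrite ?updE // orbT; store_eq.
    by apply: ok_eq (ok_skip _ _) _; rewrite orbF; store_eq.
  by apply: ok_eq (ok_push _ _ _ _) _; rewrite ?updE /=; store_eq.
rewrite /Q size_nseq.
apply: ok_seq (ok_clr _) _; first by rewrite !updE /= size_nseq; lia.
apply: ok_eq (ok_push _ _ _ _) _; rewrite /H has_iota_rcons -/(H _) -/b.
by rewrite !updE /=; store_eq.
Qed.

Definition start_store (x : seq letter) (y : seq sym) : store sym :=
  upd (upd (input_store [::]) rXR (rev (map lsym x))) rY y.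

Lemma ok_checker x y : size x + 4 * size y + 4 <= B ->
  exists s', ok checker (start_store x y) s' /\
    s' rOK = flag (acc_all (oracle (keys_of y)) (domsize y) x &&
                   ~~ has (fun i => bad_in (domsize y) (keys_of y) i x) (iota 0 (domsize y))).
Proof.
move=> sB; have [p1 p2] := size_parts y.
set N := domsize y in p1 *; set D := keys_of y in p2 *.
pose s1 := upd (upd (upd (start_store x y) rY [::]) rA (nseq N one)) rD D.
have o1 : ok split_cmd (start_store x y) s1.
  apply: (@ok_for _ _ (fun c l => upd (upd (upd (start_store x y) rY l) rA (nseq (domsize c) one)) rD (keys_of c))) => //.
  - by rewrite /start_store updE /=; slia.
  - by rewrite /start_store; store_eq.
  move=> c g l _; rewrite /domsize /keys_of -!cats1 filter_cat count_cat /= rev_cat.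
  case: eqP => [->|/eqP nd] /=.
    by apply: ok_eq (ok_push _ _ _ _) _; rewrite !updE addn1 /=; store_eq.
  case: eqP => [->|/eqP nj] /=.
    by apply: ok_eq (ok_skip _ _) _; rewrite !addn0; store_eq.
  by apply: ok_eq (ok_push _ _ _ _) _; rewrite !updE !addn0 /=; store_eq.
have rd : ready x N D s1 by split; split=> //; rewrite /s1 /start_store /= map_rev.
have sBN : size x + 4 * N + 4 <= B by lia.
have sDB : size D <= B by lia.
have o2 := ok_chk_ex B_gt0 sBN sDB rd (erefl _) (erefl _) (erefl _) (erefl _) (erefl _).
set bad := has _ _ in o2 *; pose s2 := upd s1 rBAD (flag bad).
have rd2 : ready x N D s2 by case: rd => -[h1 h2 h3 h4] h5.
have o3 := ok_chk_acc sBN sDB rd2 (erefl _) (erefl _) (erefl _) (erefl _).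
set a := acc_all _ _ _ in o3 *.
pose s3 := upd s2 rOK (flag a).
have [s4 [o4 e4]] : exists s4, ok verdict s3 s4 /\ s4 rOK = flag (a && ~~ bad).
  exists (if bad then upd s3 rOK [::] else s3); split; last by case: (bad); rewrite ?andbF ?andbT.
  apply: ok_case; rewrite /s3 /s2 !updE /=; case: (bad) => /=.
    by apply: ok_clr; rewrite updE /= size_flag.
  exact: ok_skip.
exists s4; split=> //.
exact: ok_seq o1 (ok_seq o2 (ok_seq o3 o4)).
Qed.

Lemma ok_double m s : s rC = nseq m one -> s rC2 = [::] -> 2 * m <= B ->
  ok double s (upd s rC (nseq (2 * m) one)).
Proof.
move=> hC hC2 mB.
pose P (c l : seq sym) := upd (upd s rC l) rC2 (nseq (2 * size c) one).
apply: (@ok_seq _ _ _ _ _ (P (nseq m one) [::])).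
  apply: (@ok_for _ _ P); rewrite ?hC ?size_nseq //; first by lia.
    by rewrite /P /=; store_eq.
  move=> c g l _; apply: ok_seq (ok_push _ _ _ _) _; apply: ok_eq (ok_push _ _ _ _) _.
  by rewrite /P size_rcons !updE mulnS; store_eq.
rewrite /P size_nseq; apply: ok_eq (ok_mv _ _) _; rewrite ?updE //= ?size_nseq //.
by rewrite ?updE /= rev_nseq; store_eq.
Qed.

Lemma ok_doubles a m s : s rC = nseq m one -> s rC2 = [::] -> 2 ^ a * m <= B ->
  ok (doubles a) s (upd s rC (nseq (2 ^ a * m) one)).
Proof.
elim: a m s => [|a IH] m s hC hC2 mB.
  by rewrite mul1n; apply: ok_eq (ok_skip _ _) _; rewrite -hC upd_id.
have e : 2 ^ a * (2 * m) = 2 ^ a.+1 * m by rewrite expnS mulnA (mulnC (2 ^ a)).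
have p : 0 < 2 ^ a by rewrite expn_gt0.
rewrite /= -/(doubles a); apply: ok_seq (ok_double hC hC2 _) _; first by nia.
by apply: ok_eq (IH (2 * m) _ _ _ _) _; rewrite ?updE // e // upd_upd.
Qed.

Lemma ok_counter a x : size x <= B -> 2 ^ (a * size x) <= B ->
  ok (counter a) (input_store (map lsym x))
    (upd (upd (input_store [::]) rXR (rev (map lsym x))) rC (nseq (2 ^ (a * size x)) one)).
Proof.
move=> xB aB; apply: ok_seq (ok_push _ _ _ _) _; set s1 := upd _ _ _.
have hX : s1 rX = map lsym x by [].
pose P (c l : seq sym) := upd (upd (upd (input_store [::]) rX l) rXR (rev c)) rC (nseq (2 ^ (a * size c)) one).
apply: (@ok_for _ _ P); rewrite ?hX ?size_map //.
- by rewrite /P /s1 /= muln0 /= /input_store; store_eq.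
- by rewrite /P /= size_map /input_store; store_eq.
move=> c g l e; have sc : size c < size x by have := congr1 size e; rewrite size_map size_cat /=; lia.
apply: ok_seq (ok_push _ _ _ _) _.
apply: ok_eq (@ok_doubles a (2 ^ (a * size c)) _ _ _ _) _; rewrite ?updE //.
  rewrite -expnD -mulnS; apply: leq_trans aB.
  by rewrite leq_exp2l // leq_mul2l sc orbT.
by rewrite /P size_rcons mulnS expnD; store_eq.
Qed.

End Specs.

Lemma wf_counter : wf 31 (counter 26).
Proof. wf_tac. Qed.

Lemma wf_checker : wf 31 checker.
Proof. wf_tac. Qed.

(** * Oracles as guesses of exponential length *)

Lemma mstep_word key k kc o f : dollar \notin k ->
  let s := foldl (mstep key) (kc, o, f) k in
  (~~ s.1.2 && (s.1.1 == [::]) = ~~ o && (kc == k)) /\ s.2 = f.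
Proof.
elim: k kc o => [|g k IH] kc o /=; first by [].
rewrite inE negb_or eq_sym => /andP [/negbTE -> dk].
case: kc => [|c kc]; first by have [-> ->] := IH [::] true dk; rewrite andbF.
rewrite eqseq_cons; case: (eqVneq c g) => [_|ne] /=; first by have [-> ->] := IH kc o dk.
by have [-> ->] := IH (c :: kc) true dk; rewrite andbF.
Qed.

Lemma memD_keys keys key : all (fun k => dollar \notin k) keys ->
  memD (flatten [seq rcons k dollar | k <- keys]) key = (key \in keys).
Proof.
rewrite /memD => H; suff gen f : foldl (mstep key) (key, false, f)
    (flatten [seq rcons k dollar | k <- keys]) = (key, false, f || (key \in keys)) by rewrite gen.
elim: keys f H => [|k keys IH] f /=; first by rewrite orbF.
case/andP=> dk /IH H; rewrite foldl_cat -cats1 foldl_cat.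
have := mstep_word key key false f dk; case: (foldl _ _ k) => [[kc o] f'] /= [e ->].
by rewrite in_cons e H orbA.
Qed.

Lemma keystr_inj u i j u' i' j' : keystr u i j = keystr u' i' j' ->
  [/\ u = u', i = i' & j = j'].
Proof.
rewrite /keystr; elim: u u' => [|g u IH] [|g' u'] //=; last first.
  by case=> <- /IH [-> -> ->].
case=> e; suff [-> ->] : i = i' /\ j = j' by [].
elim: i i' e => [|i IH] [|i'] //=.
  by case=> /(congr1 size); rewrite !size_nseq.
by case=> /IH [-> ->].
Qed.

Lemma keystr_word u i j : (dollar \notin keystr u i j) && all (fun z => (z != dommark) && (z != junk)) (keystr u i j).
Proof.
rewrite /keystr mem_cat all_cat !inE /= !mem_cat !all_cat !inE /= !mem_nseq !andbF /= all_map.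
rewrite (negbTE (_ : dollar \notin map lsym u)) /=; last by apply/mapP => -[].
by rewrite !all_nseq !orbT /= !andbT; apply/allP => g _.
Qed.

Fixpoint words (n : nat) : seq (seq letter) :=
  [::] :: if n is n'.+1 then [seq g :: w | g <- letters, w <- words n'] else [::].

Lemma words_cons n g u : (g :: u \in words n.+1) = (u \in words n).
Proof.
rewrite -[words n.+1]/([::] :: [seq g :: w | g <- letters, w <- words n]) in_cons (_ : (g :: u == [::]) = false) // orFb.
by apply/allpairsP/idP => [[[a w] [_ h [_ ->]]] //|h]; exists (g, u); split=> //; case: (g).
Qed.

Lemma mem_words n u : size u <= n -> u \in words n.
Proof.
by elim: n u => [|n IH] [|g u] // un; rewrite words_cons; apply: IH.
Qed.

Lemma size_words n u : u \in words n -> size u <= n.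
Proof. by elim: n u => [|n IH] [|g u] //; rewrite words_cons => /IH. Qed.

(** There are 9 letters; 16 leaves room for the empty word and is a power of 2, which suits the
    final estimate. *)
Lemma card_words n : size (words n) <= 16 ^ n.
Proof.
elim: n => // n IH; have -> : size (words n.+1) = (9 * size (words n)).+1.
  by rewrite -(size_allpairs (fun g w => g :: w) letters).
rewrite expnS.
have : 0 < 16 ^ n by rewrite expn_gt0.
by move: (16 ^ n) IH => X; lia.
Qed.

(** An evaluation consults the oracle only at strings no longer than the input and at pairs among
    the [N] elements, so a finite table determines the outcome. *)
Lemma ev_ext h h' n N i j u :
  (forall w a b, size w <= n -> a < N -> b < N -> h w a b = h' w a b) ->
  i < N -> j < N -> size u <= n -> ev h i j u = ev h' i j u.
Proof.
move=> H iN jN; elim: u => //= g u IH un; rewrite -IH; last exact: ltnW.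
have N0 : 0 < N by exact: leq_ltn_trans iN.
have [] := ev_size h i j u; case: (ev _ _ _ _) => w b st e /= sw _.
case: g un => //= un; first by case: b => [|[|[|b]]] //; rewrite !H //= (leq_ltn_trans sw).
by case: st => // a st; rewrite !H.
Qed.

Lemma check_ext h h' n N (x : seq letter) : size x <= n ->
  (forall w a b, size w <= n -> a < N -> b < N -> h w a b = h' w a b) ->
  check_ex h N x -> check_acc h N x -> check_ex h' N x /\ check_acc h' N x.
Proof.
move=> xn H ce [i [j [iN jN a]]]; split=> [k u kN su|].
  have un := leq_trans (size_suffix su) xn; rewrite /= in un.
  rewrite -H // ce //; apply: eq_in_has => c; rewrite mem_iota => cN.
  by rewrite (ev_ext H) //; exact: ltnW.
by exists i, j; split=> //; rewrite -(ev_ext H).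
Qed.

Lemma realize h n N : exists D,
  [/\ size D <= 16 ^ n * N * N * (n + 2 * N + 3),
    all (fun z => (z != dommark) && (z != junk)) D &
    forall w a b, size w <= n -> a < N -> b < N -> oracle D w a b = h w a b].
Proof.
pose trips := [seq (p, b) | p <- [seq (w, a) | w <- words n, a <- iota 0 N], b <- iota 0 N].
pose keys := [seq keystr t.1.1 t.1.2 t.2 | t <- trips & h t.1.1 t.1.2 t.2].
have tripsP t : t \in trips -> [/\ size t.1.1 <= n, t.1.2 < N & t.2 < N].
  case/allpairsP=> -[[w a] b] /= [/allpairsP [[w' a'] /= [/size_words h1 h2 [-> ->]]] h3 ->] /=.
  by move: h2 h3; rewrite !mem_iota.
have dk : all (fun k => dollar \notin k) keys.
  by apply/allP => k /mapP [t _ ->]; case/andP: (keystr_word t.1.1 t.1.2 t.2).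
exists (flatten [seq rcons k dollar | k <- keys]); split.
- have st : size keys <= 16 ^ n * N * N.
    rewrite size_map size_filter (leq_trans (count_size _ _)) //.
    by rewrite !size_allpairs !size_iota !leq_mul2r card_words !orbT.
  apply: (@leq_trans (size keys * (n + 2 * N + 3))); last by rewrite leq_mul2r st orbT.
  have : all (fun k => size k < n + 2 * N + 3) keys.
    apply/allP => k /mapP [t]; rewrite mem_filter => /andP [_ /tripsP [h1 h2 h3]] ->.
    rewrite /keystr !size_cat /= !size_cat /= size_map !size_nseq; slia.
  elim: (keys) => //= k ks IH /andP [h1 /IH h2].
  by rewrite size_cat size_rcons mulSn; lia.
- apply/allP => z /flattenP [s /mapP [k /mapP [t _ ->] ->]].
  rewrite mem_rcons inE => /orP [/eqP -> //|zk].
  by case/andP: (keystr_word t.1.1 t.1.2 t.2) => _ /allP; apply.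
move=> w a b wn aN bN; rewrite /oracle memD_keys //; apply/mapP/idP => [[[[w' a'] b']]|hw].
  by rewrite mem_filter => /andP [/= hw _] /keystr_inj [-> -> ->].
exists (w, a, b) => //; rewrite mem_filter /= hw /=.
apply/allpairsP; exists ((w, a), b) => /=; split=> //; last by rewrite mem_iota.
by apply/allpairsP; exists (w, a) => /=; rewrite mem_words ?mem_iota.
Qed.

(** With [X = 2 ^ n] the factors of the product are bounded by [X ^ 4], [X ^ 6], [X ^ 6] and
    [X ^ 8], hence the product by [X ^ 24]. Adding [N] gives at most [2 * X ^ 24], which is below
    [X ^ 26] because a nonempty input makes [X] at least 2. *)
Lemma guess_size n N : 0 < n -> N <= 2 ^ (2 * n + 4) ->
  N + 16 ^ n * N * N * (n + 2 * N + 3) <= 2 ^ (26 * n).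
Proof.
move=> n0 NB; have en : n <= 2 ^ n by apply: ltnW; exact: ltn_expl.
set X := 2 ^ n in en *.
have X2 : 2 <= X by rewrite -[2]expn1 leq_exp2l.
have e16 : 16 ^ n = X ^ 4 by rewrite -expnM mulnC (expnM 2 4).
have eN : N <= X ^ 2 * 16 by rewrite -expnM mulnC (expnD 2 _ 4) in NB *.
have -> : 2 ^ (26 * n) = X ^ 26 by rewrite -expnM mulnC.
rewrite e16.
have h1 : n + 2 * N + 3 <= X ^ 8.
  have : X * 2 ^ 7 <= X * X ^ 7 by rewrite leq_mul2l leq_exp2r ?X2 ?orbT.
  have : X ^ 2 * 2 ^ 6 <= X ^ 2 * X ^ 6 by rewrite leq_mul2l leq_exp2r ?X2 ?orbT.
  rewrite -expnS -expnD; have : X <= X ^ 2 by rewrite expnS expn1; nia.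
  by move: (X ^ 2) (X ^ 8) eN => Y Z; lia.
have h2 : N <= X ^ 6.
  apply: leq_trans eN _; rewrite (expnD X 2 4) leq_mul2l (@leq_exp2r 2 _ 4) //.
  by rewrite X2 orbT.
apply: (@leq_trans (X ^ 6 + X ^ 4 * X ^ 6 * X ^ 6 * X ^ 8)).
  by rewrite leq_add // !leq_mul.
rewrite -!expnD /=; apply: (@leq_trans (X ^ 24 + X ^ 24)).
  by rewrite leq_add2r leq_exp2l.
rewrite addnn -mul2n (expnD X 2 24) leq_mul2r -mulnn; apply/orP; right.
by move: X2; clear; move: X => Y; nia.
Qed.

Theorem sat_NEXPTIME : NEXPTIME (sat_problem GRA2).
Proof.
(* The guess has length [2 ^ (26 * n)]; 32 leaves room for the input and several unary counters
   bounded by that length. *)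
pose B n := 2 ^ (32 * n.+1).
have B0 (x : seq letter) : 0 < B (size x) by rewrite expn_gt0.
have st x : size x <= B (size x) /\ 2 ^ (26 * size x) <= B (size x) ->
    run (counter 26) (input_store (map lsym x)) =
    upd (upd (input_store [::]) rXR (rev (map lsym x))) rC (nseq (2 ^ (26 * size x)) one).
  by case=> h1 h2; have [] := ok_counter (B0 x) h1 h2.
have sz (x : seq letter) : size x + 4 * 2 ^ (26 * size x) + 4 <= B (size x).
  have h1 : size x <= 2 ^ (26 * size x).
    by apply: leq_trans (ltnW (ltn_expl (size x) (isT : 1 < 2))) _; rewrite leq_exp2l // leq_pmull.
  have h2 : 2 ^ (26 * size x) * 2 ^ 4 <= B (size x).
    by rewrite -expnD leq_exp2l //; lia.
  have h3 : 0 < 2 ^ (26 * size x) by rewrite expn_gt0.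
  by move: h1 h2 h3; move: (2 ^ (26 * _)) => Y; lia.
have szx (x : seq letter) : size x <= B (size x) /\ 2 ^ (26 * size x) <= B (size x).
  by have := sz x; lia.
have gs (x : seq letter) : size (run (counter 26) (input_store (map lsym x)) rC) = 2 ^ (26 * size x).
  by rewrite (st x (szx x)) updE size_nseq.
have gst (x : seq letter) y : guess_store rC rY (run (counter 26) (input_store (map lsym x))) y =
    start_store x y.
  by rewrite /guess_store (st x (szx x)) /start_store; store_eq.
apply: (@NEXPTIME_program letter sym lsym (can_inj lsymK) (sat_problem GRA2) 29
  (counter 26) rC rY checker rOK 32).
- by split; [exact: wf_counter | exact: wf_checker |].
- by [].
- by move=> x; have [h1 h2] := szx x; have [] := ok_counter (B0 x) h1 h2.
- by move=> x; rewrite gs; case: (szx x).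
- move=> x y; rewrite gs => sy; rewrite gst.
  have [|s' [[sf _] _]] := @ok_checker (B (size x)) (B0 x) x y; last exact: sf.
  by rewrite sy.
move=> x.
have res y : size y = 2 ^ (26 * size x) ->
    final (counter 26) rC rY checker (map lsym x) y rOK <> [::] <->
    check_ex (oracle (keys_of y)) (domsize y) x /\ check_acc (oracle (keys_of y)) (domsize y) x.
  move=> sy; rewrite /final gst.
  have [|s' [[_ ->] ->]] := @ok_checker (B (size x)) (B0 x) x y; first by rewrite sy.
  rewrite -acc_allP -bad_inP.
  case a: (acc_all _ _ _); last by split=> // -[].
  case b: (has _ _) => /=; split=> //.
    by case=> H _; case/hasP: b => i; rewrite mem_iota => /H /negbTE ->.
  move=> _; split=> // i iN; apply: contraFN b => bi; apply/hasP; exists i => //.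
  by rewrite mem_iota.
split=> [/[dup] sx /sat_complete [N [h [NB ce ca]]]|[y]]; last first.
  by rewrite gs => sy /(res y sy) [ce ca]; exact: sat_sound ce ca.
have x0 : 0 < size x by case: sx => T [_ _ <-]; case: T.
have [D [sD gD oD]] := realize h (size x) N.
have := guess_size x0 NB; set m := 2 ^ _ => gm.
have sND : N + size D <= m by apply: leq_trans gm; rewrite leq_add2l.
(* [split_cmd] reverses the facts, hence [rev D]; [N] marks give the elements and [junk] completes
   the length [m]. *)
pose y := rev D ++ nseq N dommark ++ nseq (m - N - size D) junk.
have sy : size y = m by rewrite !size_cat size_rev !size_nseq; lia.
have dy : domsize y = N.
  rewrite /domsize !count_cat !count_nseq /= mul1n mul0n addn0.
  rewrite (_ : count _ (rev D) = 0) //; apply/eqP; rewrite -leqn0 leqNgt -has_count.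
  by rewrite has_rev; apply/hasPn => z /(allP gD) /andP [].
have ky : keys_of y = D.
  rewrite /keys_of !filter_cat !filter_nseq /= cats0 filter_rev revK.
  by apply/all_filterP.
exists y; first by rewrite gs.
apply/(res y sy); rewrite dy ky.
by apply: check_ext ce ca; [exact: leqnn | move=> w a b wn aN bN; rewrite oD].
Qed.

End Verifier.

(** * A schema of two-variable sentences *)

(* [PAtom s f b d] is the unary predicate number [b] of the field [f], or
   number [b + j] at the index [j] if [d], of [x] if [s] and of [y] otherwise. *)
Inductive pf :=
| PAtom of bool & nat & nat & bool
| PTrue
| PNeg of pf
| PAnd of pf & pf.

(** Appending [true] raises the index, so the printer reaches index [j] by copying a unary counter
    behind a fixed word. *)
Definition pname (f j : nat) : seq bool := nseq f false ++ true :: nseq j true.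

Lemma pname_inj f j f' j' : pname f j = pname f' j' -> f = f' /\ j = j'.
Proof.
rewrite /pname; elim: f f' => [|f IH] [|f'] //=; last by case=> /IH [-> ->].
by case=> /(congr1 size); rewrite !size_nseq.
Qed.

Lemma pnameD f b j : pname f b ++ nseq j true = pname f (b + j).
Proof. by rewrite /pname -catA /= -nseqD. Qed.

Definition pred_term (f j : nat) : term := Rel (RelSym 1 (pname f j)).
(** A valid term of arity 2. Intersecting a unary atom with it raises the arity to 2, so that [Swap]
    moves the atom to the first variable instead of acting as the identity. *)
Definition true2 : term := Neg (Cap Eqt (Neg Eqt)).

Fixpoint pinst (p : pf) (j : nat) : term :=
  match p with
  | PAtom s f b d =>
    let a := pred_term f (b + (if d then j else 0)) in
    if s then Swap (Cap a true2) else a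
  | PTrue => true2
  | PNeg p => Neg (pinst p j)
  | PAnd p q => Cap (pinst p j) (pinst q j)
  end.

Definition valuation := nat -> nat -> bool.

Fixpoint peval (p : pf) (j : nat) (u v : valuation) : bool :=
  match p with
  | PAtom s f b d => (if s then u else v) f (b + (if d then j else 0))
  | PTrue => true
  | PNeg p => ~~ peval p j u v
  | PAnd p q => peval p j u v && peval q j u v
  end.

(* [None] stands for the index in unary. *)
Definition chunk := option (seq letter).

Definition chunk_str (j : nat) (o : chunk) : seq letter :=
  if o is Some s then s else nseq j L1.

Definition chunks_str (j : nat) (l : seq chunk) : seq letter :=
  flatten (map (chunk_str j) l).

Lemma chunks_str_cat j l1 l2 : chunks_str j (l1 ++ l2) = chunks_str j l1 ++ chunks_str j l2.
Proof. by rewrite /chunks_str map_cat flatten_cat. Qed.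

Lemma chunks_str_cons j o l : chunks_str j (o :: l) = chunk_str j o ++ chunks_str j l.
Proof. by []. Qed.

Fixpoint pchunks (p : pf) : seq chunk :=
  match p with
  | PAtom s f b d =>
    (if s then [:: Some [:: Ls; Lcap]] else [::]) ++
    Some (encode (pred_term f b)) :: (if d then [:: None] else [::]) ++
    (if s then [:: Some (encode true2)] else [::])
  | PTrue => [:: Some (encode true2)]
  | PNeg p => Some [:: Lneg] :: pchunks p
  | PAnd p q => Some [:: Lcap] :: pchunks p ++ pchunks q
  end.

Lemma encode_pinst p j : encode (pinst p j) = chunks_str j (pchunks p).
Proof.
elim: p => [s f b d||p IH|p IHp q IHq] //.
- have e : encode (pred_term f (b + (if d then j else 0))) =
      encode (pred_term f b) ++ nseq (if d then j else 0) L1.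
    by rewrite /= -pnameD map_cat map_nseq.
  have -> : encode (pinst (PAtom s f b d) j) = (if s then [:: Ls; Lcap] else [::]) ++
      encode (pred_term f (b + (if d then j else 0))) ++ (if s then encode true2 else [::]).
    by case: s; rewrite ?cats0.
  rewrite e [pchunks _]/=.
  by case: s; case: d {e}; rewrite /chunks_str /= ?cats0 -?catA.
- by rewrite /= IH.
- by rewrite /= chunks_str_cons chunks_str_cat IHp IHq.
Qed.

Section Schema.
Variable X : Type.

(** Layers of a context. The hole is always the last argument, so in Polish notation a context is a
    prefix, and an iterated context is printed by a loop. *)
Inductive frame := FNeg | FAnd of pf.

Inductive qf :=
| QP of pf
| QNeg of qf
| QAnd of qf & qf
| QBits of seq frame & qf
| QInput of (X -> seq frame) & qf.

Definition finst (fs : seq frame) (j : nat) (t : term) : term :=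
  foldr (fun f t => if f is FAnd p then Cap (pinst p j) t else Neg t) t fs.

Definition feval (fs : seq frame) (j : nat) (u v : valuation) (b : bool) : bool :=
  foldr (fun f b => if f is FAnd p then peval p j u v && b else ~~ b) b fs.

Definition fchunks (fs : seq frame) : seq chunk :=
  flatten [seq if f is FAnd p then Some [:: Lcap] :: pchunks p else [:: Some [:: Lneg]] | f <- fs].

Lemma encode_finst fs j t : encode (finst fs j t) = chunks_str j (fchunks fs) ++ encode t.
Proof.
elim: fs => //= -[|p] fs /= ->; rewrite /fchunks //=.
by rewrite map_cat flatten_cat encode_pinst -catA.
Qed.

Variables (m : nat) (l : seq X).

Fixpoint bits_fold (T : Type) (g : nat -> T -> T) (m : nat) (t : T) : T :=
  if m is j.+1 then g j (bits_fold g j t) else t.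

(** The index of a letter is the number of letters after it: the initial steps of a run write the
    input from its end, so the last letter belongs to time 0. *)
Fixpoint input_fold (T : Type) (g : X -> nat -> T -> T) (l : seq X) (t : T) : T :=
  if l is a :: l' then g a (size l') (input_fold g l' t) else t.

Fixpoint qinst (q : qf) : term :=
  match q with
  | QP p => pinst p 0
  | QNeg q => Neg (qinst q)
  | QAnd q1 q2 => Cap (qinst q1) (qinst q2)
  | QBits fs q => bits_fold (finst fs) m (qinst q)
  | QInput fs q => input_fold (fun a => finst (fs a)) l (qinst q)
  end.

Fixpoint qeval (q : qf) (u v : valuation) : bool :=
  match q with
  | QP p => peval p 0 u v
  | QNeg q => ~~ qeval q u v
  | QAnd q1 q2 => qeval q1 u v && qeval q2 u v
  | QBits fs q => bits_fold (fun j => feval fs j u v) m (qeval q u v)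
  | QInput fs q => input_fold (fun a j => feval (fs a) j u v) l (qeval q u v)
  end.

Inductive segment :=
| GConst of seq letter
| GBits of seq chunk
| GInput of (X -> seq chunk).

Definition segment_str (g : segment) : seq letter :=
  match g with
  | GConst s => s
  | GBits its => bits_fold (fun j s => chunks_str j its ++ s) m [::]
  | GInput its => input_fold (fun a j s => chunks_str j (its a) ++ s) l [::]
  end.

Fixpoint segments (q : qf) : seq segment :=
  match q with
  | QP p => [:: GConst (encode (pinst p 0))]
  | QNeg q => GConst [:: Lneg] :: segments q
  | QAnd q1 q2 => GConst [:: Lcap] :: segments q1 ++ segments q2
  | QBits fs q => GBits (fchunks fs) :: segments q
  | QInput fs q => GInput (fun a => fchunks (fs a)) :: segments q
  end.

Lemma encode_qinst q : encode (qinst q) = flatten (map segment_str (segments q)).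
Proof.
elim: q => [p|q IH|q1 IH1 q2 IH2|fs q IH|fs q IH] /=.
- by rewrite cats0.
- by rewrite IH.
- by rewrite map_cat flatten_cat IH1 IH2.
- by elim: (m) => //= j IHj; rewrite encode_finst IHj catA.
- by elim: (l) => //= a l' IHl; rewrite encode_finst IHl catA.
Qed.

Section Semantics.
Variable M : model.
Definition val_of (a : dom M) : valuation := fun f j => `[< sem (pred_term f j) a a >].

Lemma sem_pred f j (a b : dom M) : sem (pred_term f j) a b <-> val_of b f j.
Proof. by split=> [h|/asboolP //]; apply/asboolP. Qed.

Lemma sem_true2 (a b : dom M) : sem true2 a b.
Proof. by case. Qed.

Lemma sem_pinst p j (a b : dom M) : sem (pinst p j) a b <-> peval p j (val_of a) (val_of b).
Proof.
elim: p => [s f c d||p IH|p IHp q IHq].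
- case: s; last exact: sem_pred.
  rewrite [pinst _ _]/= [peval _ _ _ _]/=; move: (c + _) => k.
  have -> : sem (Swap (Cap (pred_term f k) true2)) a b <->
            sem (pred_term f k) b a /\ sem true2 b a by [].
  by rewrite sem_pred; split=> [[]|] // h; split=> //; exact: sem_true2.
- by split=> // _; exact: sem_true2.
- by rewrite /= IH; split=> /negP.
- by rewrite /= IHp IHq; split=> /andP.
Qed.

Lemma sem_finst fs j t (a b : dom M) (c : bool) : (sem t a b <-> c) ->
  sem (finst fs j t) a b <-> feval fs j (val_of a) (val_of b) c.
Proof.
move=> tc; elim: fs => //= -[|p] fs IH /=; first by rewrite IH; split=> /negP.
by rewrite IH sem_pinst; split=> /andP.
Qed.

Lemma sem_qinst q (a b : dom M) : sem (qinst q) a b <-> qeval q (val_of a) (val_of b).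
Proof.
elim: q => [p|q IH|q1 IH1 q2 IH2|fs q IH|fs q IH] /=.
- exact: sem_pinst.
- by rewrite IH; split=> /negP.
- by rewrite IH1 IH2; split=> /andP.
- by elim: (m) => //= j IHj; exact: sem_finst.
- by elim: (l) => //= x l' IHl; exact: sem_finst.
Qed.

End Semantics.

Lemma GRA2_pinst p j : GRA2 (pinst p j).
Proof.
elim: p => [[] f b d||p IH|p IHp q IHq] //.
by apply/GRA2_Cap.
Qed.

Lemma GRA2_qinst q : GRA2 (qinst q).
Proof.
have F fs j t : GRA2 t -> GRA2 (finst fs j t).
  move=> gt; elim: fs => //= -[|p] fs IH //=.
  by apply/GRA2_Cap; split=> //; exact: GRA2_pinst.
elim: q => [p|q IH|q1 IH1 q2 IH2|fs q IH|fs q IH] //=.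
- exact: GRA2_pinst.
- exact/GRA2_Cap.
- by elim: (m) => //= j IHj; exact: F.
- by elim: (l) => //= x l' IHl; exact: F.
Qed.

(* There is [y] with [Z], every [x] has some [y] with [I], all [x], [y] satisfy [C]. *)
Definition sentence (Z I C : qf) : term :=
  Cap (Ex (qinst Z)) (Cap (Neg (Ex (Neg (Ex (qinst I))))) (Neg (Ex (Ex (Neg (qinst C)))))).

Definition sentence_segments (Z I C : qf) : seq segment :=
  GConst [:: Lcap; Lex] :: segments Z ++
  GConst [:: Lcap; Lneg; Lex; Lneg; Lex] :: segments I ++
  GConst [:: Lneg; Lex; Lex; Lneg] :: segments C.

Lemma encode_sentence Z I C :
  encode (sentence Z I C) = flatten (map segment_str (sentence_segments Z I C)).
Proof.
rewrite /sentence_segments /= map_cat flatten_cat /= map_cat flatten_cat /=.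
by rewrite !encode_qinst.
Qed.

Lemma GRA2_sentence Z I C : GRA2 (sentence Z I C).
Proof.
apply/GRA2_Cap; split; first exact: GRA2_qinst.
by apply/GRA2_Cap; split; exact: GRA2_qinst.
Qed.

Lemma satisfiable_sentence Z I C :
  satisfiable (sentence Z I C) <->
  exists (A : Type) (w : A -> valuation), [/\ exists a b, qeval Z (w a) (w b),
    forall a, exists b, qeval I (w a) (w b) & forall a b, qeval C (w a) (w b)].
Proof.
rewrite (satisfiable_sem (GRA2_sentence Z I C)); split=> [[M [a [b [[c zc] [hI hC]]]]]|[A [w [[a [b zab]] hI hC]]]].
  exists (dom M), (@val_of M); split.
  - by exists b, c; apply/sem_qinst.
  - move=> a'; apply: contrapT => no; apply: hI; exists a' => -[d /sem_qinst hd].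
    by apply: no; exists d.
  - move=> a' b'; apply: contrapT => no; apply: hC; exists a', b' => /sem_qinst.
    exact: no.
pose val (R : relsym) (u : seq A) : Prop :=
  exists c f j, [/\ u = [:: c], symname R = pname f j & w c f j].
pose M := @Model A (inhabits a) (fun R u => val R u).
have wE (c : dom M) : val_of c = w c.
  apply: funext => f; apply: funext => j; apply/asboolP/idP.
    by case=> u [c' [f' [j' [/= eu /pname_inj [-> ->] h]]]] /= e; move: eu; rewrite e => -[->].
  by move=> h; exists [tuple c] => //; exists c, f, j.
exists M, a, a; split; first by exists b; apply/sem_qinst; rewrite !wE.
split.
  move=> [c no]; have [d h] := hI c; apply: no; exists d; apply/sem_qinst.
  by rewrite !wE.
by move=> [c [d no]]; apply: no; apply/sem_qinst; rewrite !wE.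
Qed.

End Schema.

(** * Binary counters *)

Fixpoint num (b : nat -> bool) (m : nat) : nat :=
  if m is j.+1 then b j * 2 ^ j + num b j else 0.

Lemma num_lt b m : num b m < 2 ^ m.
Proof. by elim: m => //= m IH; rewrite expnS; case: (b m); lia. Qed.

Lemma num_eq b b' m : num b m = num b' m <-> forall j, j < m -> b j = b' j.
Proof.
split=> [|H]; last first.
  by elim: m H => //= m IH H; rewrite H // IH // => j jm; apply: H; exact: ltnW.
elim: m => //= m IH e j; have h := num_lt b m; have h' := num_lt b' m.
have bm : b m = b' m by move: e; case: (b m); case: (b' m) => //; lia.
rewrite ltnS leq_eqVlt => /orP [/eqP -> //|]; apply: IH.
by move: e; rewrite bm; lia.
Qed.

Lemma num_ltS b b' m : (num b m.+1 < num b' m.+1) =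
  (~~ b m && b' m) || ((b m == b' m) && (num b m < num b' m)).
Proof.
have := num_lt b m; have := num_lt b' m => /=.
by case: (b m); case: (b' m) => /=; lia.
Qed.

(** The carries of adding 1. Storing them makes the increment a condition on each index separately,
    with two adjacent indices in the recursion. *)
Definition carries (b c : nat -> bool) (m : nat) : Prop :=
  c 0 /\ forall j, j < m -> c j.+1 = c j && b j.

(** On the lowest [k] bits, the sum and the outgoing carry together make up the number plus one; at
    [k = m] the reduction modulo [2 ^ m] drops the carry. *)
Lemma num_inc b c m b' : carries b c m ->
  (forall j, j < m -> b' j = b j (+) c j) <-> num b' m = (num b m).+1 %% 2 ^ m.
Proof.
move=> [c0 cS]; pose s j := b j (+) c j.
have step k : k <= m -> num s k + c k * 2 ^ k = (num b k).+1.
  elim: k => [|k IH] km /=; first by rewrite c0.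
  have := IH (ltnW km); rewrite expnS cS // /s.
  by case: (b k); case: (c k) => /=; lia.
have -> : (num b m).+1 %% 2 ^ m = num s m.
  rewrite -(step _ (leqnn m)); have h := num_lt s m.
  by case: (c m); rewrite ?mul1n ?modnDr ?addn0 modn_small.
by rewrite num_eq.
Qed.

Definition bit (n j : nat) : bool := odd (n %/ 2 ^ j).

Lemma num_bit n m : num (bit n) m = n %% 2 ^ m.
Proof.
elim: m => [|m IH] /=; first by rewrite modn1.
rewrite IH /bit expnS; have en := divn_eq n (2 ^ m).
have rl : n %% 2 ^ m < 2 ^ m by rewrite ltn_mod expn_gt0.
move: (2 ^ m) (n %% 2 ^ m) (n %/ 2 ^ m) en rl => p r q en rl.
have e : n = q./2 * (2 * p) + (odd q * p + r).
  have := odd_double_half q; rewrite en -mul2n; clear.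
  by move: (nat_of_bool (odd q)) q./2 => o h <-; nia.
by rewrite e modnMDl modn_small //; case: (odd q); lia.
Qed.

(** A carry enters position [j] when all lower bits are 1. *)
Definition carry_bit (n j : nat) : bool := n %% 2 ^ j == (2 ^ j).-1.

Lemma carries_bit n m : carries (bit n) (carry_bit n) m.
Proof.
split=> [|j _]; first by rewrite /carry_bit modn1.
rewrite /carry_bit -!num_bit /=; have := num_lt (bit n) j.
by rewrite expnS; case: (bit n j); rewrite ?andbT ?andbF; lia.
Qed.

Definition POr p q := PNeg (PAnd (PNeg p) (PNeg q)).
Definition PImp p q := PNeg (PAnd p (PNeg q)).
Definition PIff p q := PAnd (PImp p q) (PImp q p).
Definition PXor p q := PNeg (PIff p q).

Lemma peval_imp p q j u v : peval (PImp p q) j u v = (peval p j u v ==> peval q j u v).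
Proof. by rewrite /= negb_and negbK implybE. Qed.

Lemma peval_iff p q j u v : peval (PIff p q) j u v = (peval p j u v == peval q j u v).
Proof. by rewrite /=; case: (peval p j u v); case: (peval q j u v). Qed.

Lemma peval_xor p q j u v : peval (PXor p q) j u v = peval p j u v (+) peval q j u v.
Proof. by rewrite /=; case: (peval p j u v); case: (peval q j u v). Qed.

Section Folds.
Variables (X : Type) (m : nat) (l : seq X) (d : X).
Notation qf := (qf X).
Notation qev q u v := (qeval m l q u v).
Implicit Types (u v : valuation).

Definition qtrue : qf := QP X PTrue.
Definition qimp (a b : qf) : qf := QNeg (QAnd a (QNeg b)).
Definition qall (s : seq qf) : qf := foldr (@QAnd X) qtrue s.
Definition qforall (T : finType) (P : pred T) (F : T -> qf) : qf :=
  qall [seq F a | a <- enum T & P a].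
Definition qbits (p : pf) : qf := QBits [:: FAnd p] qtrue.
Definition qeq (p q : pf) : qf := qbits (PIff p q).
Definition qzero (p : pf) : qf := qbits (PNeg p).
(** Lexicographic comparison with the most significant bit outermost: each layer unfolds to [q]
    without [p], or [p] equivalent to [q] and the rest. The innermost value is false. *)
Definition qless (p q : pf) : qf :=
  QBits [:: FNeg; FAnd (PNeg (PAnd (PNeg p) q)); FNeg; FAnd (PIff p q)] (QP X (PNeg PTrue)).
Definition qinc (p c q : pf) : qf := qbits (PIff q (PXor p c)).
Definition qinput (p : X -> pf) : qf := QInput (fun a => [:: FAnd (p a)]) qtrue.

Lemma qimpP a b u v : qev (qimp a b) u v <-> (qev a u v -> qev b u v).
Proof. by rewrite /= negb_and negbK -implybE; split=> /implyP. Qed.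

Lemma qandP a b u v : qev (QAnd a b) u v <-> qev a u v /\ qev b u v.
Proof. by split=> /andP. Qed.

Lemma qforallP (T : finType) P (F : T -> qf) u v :
  qev (qforall P F) u v <-> forall a, P a -> qev (F a) u v.
Proof.
have -> : qev (qforall P F) u v = all (fun a => qev (F a) u v) [seq a <- enum T | P a].
  by rewrite /qforall; elim: (filter _ _) => //= a s ->.
split=> [/allP H a Pa|H]; first by apply: H; rewrite mem_filter Pa mem_enum.
by apply/allP => a; rewrite mem_filter => /andP [/H].
Qed.

Lemma qbitsP p u v : qev (qbits p) u v <-> forall j, j < m -> peval p j u v.
Proof.
rewrite /=; elim: (m) => [|k IH]; first by [].
rewrite [bits_fold _ _ _]/=; split=> [/andP [h /IH H] j|H].
  by rewrite ltnS leq_eqVlt => /orP [/eqP -> //|]; exact: H.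
by apply/andP; split; [exact: H | apply/IH => j jk; apply/H/ltnW].
Qed.

Definition pnum p u v := num (fun j => peval p j u v) m.

Lemma qeqP p q u v : qev (qeq p q) u v <-> pnum p u v = pnum q u v.
Proof.
rewrite qbitsP /pnum num_eq.
by split=> H j /H; rewrite peval_iff => /eqP.
Qed.

Lemma num0 b k : num b k = 0 <-> forall j, j < k -> ~~ b j.
Proof.
have -> : 0 = num (fun=> false) k by elim: k => //= k <-.
by rewrite num_eq; split=> H j /H; [move=> -> | move/negbTE].
Qed.

Lemma qzeroP p u v : qev (qzero p) u v <-> pnum p u v = 0.
Proof. by rewrite qbitsP /pnum num0. Qed.

Lemma num_ones b k : (num b k).+1 = 2 ^ k <-> forall j, j < k -> b j.
Proof.
have -> : 2 ^ k = (num (fun=> true) k).+1.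
  by elim: k => //= k IH; rewrite expnS; lia.
split=> [[/num_eq H] j /H ->|H] //; congr _.+1; apply/num_eq => j /H.
by [].
Qed.

Lemma qonesP p u v : qev (qbits p) u v <-> (pnum p u v).+1 = 2 ^ m.
Proof. by rewrite qbitsP /pnum num_ones. Qed.

Lemma qlessP p q u v : qev (qless p q) u v = (pnum p u v < pnum q u v).
Proof.
have F k b : feval [:: FNeg; FAnd (PNeg (PAnd (PNeg p) q)); FNeg; FAnd (PIff p q)] k u v b =
    (~~ peval p k u v && peval q k u v) || ((peval p k u v == peval q k u v) && b).
  rewrite -peval_iff [LHS]/= -/(peval (PImp p q) k u v) -/(peval (PImp q p) k u v).
  by rewrite -/(peval (PIff p q) k u v) negb_and !negbK.
rewrite /pnum /qless [qeval _ _ _ _ _]/=; elim: (m) => // k IH.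
by rewrite num_ltS -IH [bits_fold _ _ _]/= -F.
Qed.

Lemma qincP p c q u v : carries (fun j => peval p j u v) (fun j => peval c j u v) m ->
  qev (qinc p c q) u v <-> pnum q u v = (pnum p u v).+1 %% 2 ^ m.
Proof.
move=> cs; rewrite qbitsP /pnum -(num_inc _ cs).
by split=> H j /H; rewrite peval_iff peval_xor => /eqP.
Qed.

Lemma qinputP p u v : qev (qinput p) u v <->
  forall j, j < size l -> peval (p (nth d (rev l) j)) j u v.
Proof.
rewrite /=; elim: (l) => [|a s IH]; first by [].
rewrite [input_fold _ _ _]/= rev_cons; split=> [/andP [h /IH H] j|H].
  rewrite nth_rcons size_rev ltnS leq_eqVlt => /orP [/eqP ->|js].
    by rewrite ltnn eqxx.
  by rewrite js; exact: H.
apply/andP; split.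
  by have := H _ (ltnSn _); rewrite nth_rcons size_rev ltnn eqxx.
apply/IH => j js; have := H j (ltnW js); rewrite nth_rcons size_rev js.
exact.
Qed.

End Folds.

(** * Histories *)

Section History.
Variables (S Gm L : finType) (k : nat) (scn wr : L -> 'I_k -> option Gm)
  (dr : L -> 'I_k -> dir) (link : rel L) (ini : option S -> L).

(* Time, carries of the time, markers of the initial steps; for each tape the
   head position, its carries, the time of the previous visit of the scanned
   cell, absence of such a visit; the record of the step. *)
Definition field : finType := ('I_3 + 'I_k * 'I_4 + L)%type.

Definition fT : field := inl (inl (@Ordinal 3 0 isT)).
Definition fC : field := inl (inl (@Ordinal 3 1 isT)).
Definition fN : field := inl (inl (@Ordinal 3 2 isT)).
Definition fH (i : 'I_k) : field := inl (inr (i, @Ordinal 4 0 isT)).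
Definition fHC (i : 'I_k) : field := inl (inr (i, @Ordinal 4 1 isT)).
Definition fP (i : 'I_k) : field := inl (inr (i, @Ordinal 4 2 isT)).
Definition fF (i : 'I_k) : field := inl (inr (i, @Ordinal 4 3 isT)).
Definition fL (r : L) : field := inr r.

Definition code (f : field) : nat := enum_rank f.

Definition X f := PAtom true (code f) 0 true.
Definition Y f := PAtom false (code f) 0 true.
Definition YS f := PAtom false (code f) 1 true.
Definition X0 f := PAtom true (code f) 0 false.
Definition Y0 f := PAtom false (code f) 0 false.

Notation qf := (qf (option S)).
Notation qp := (@QP (option S)).

Definition conflict a b : qf := qp (PNeg (PAnd (X0 (fL a)) (Y0 (fL b)))).

Definition c_carry f c : qf :=
  QAnd (qp (Y0 c)) (qbits _ (PIff (YS c) (PAnd (Y c) (Y f)))).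

Definition c_record : qf := qp (foldr POr (PNeg PTrue) [seq Y0 (fL r) | r <- enum L]).

Definition c_fresh (i : 'I_k) : qf :=
  qforall (fun r => scn r i != None) (fun r => qp (PNeg (PAnd (Y0 (fF i)) (Y0 (fL r))))).

Definition c_start : qf :=
  qimp (qzero _ (Y fT)) (QAnd (qp (Y0 fN)) (qforall xpredT (fun i => qzero _ (Y (fH i))))).

(** The unary marker [fN] at index [j] holds at step [j], which ties a position of the input to a
    binary time without spelling out constants. *)
Definition c_init : qf := qinput (fun g => PImp (Y fN) (Y0 (fL (ini g)))).

(** A move to the left is an increment read from the later step to the earlier one, so the carries
    of an increment serve both directions. *)
Definition c_shift (d : dir) (i : 'I_k) : qf :=
  match d with
  | MStay => qeq _ (X (fH i)) (Y (fH i))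
  | MRight => qinc _ (X (fH i)) (X (fHC i)) (Y (fH i))
  | MLeft => qinc _ (Y (fH i)) (Y (fHC i)) (X (fH i))
  end.

Definition c_next : qf := qinc _ (X fT) (X fC) (Y fT).

(** Every element must have a successor, so [c_next] counts modulo [2 ^ m]; excluding the time with
    all bits 1 exempts the wrap-around from the conditions on consecutive steps. *)
Definition c_step : qf :=
  qimp (QAnd c_next (QNeg (qbits _ (X fT))))
  (QAnd (qforall (fun ab : L * L => ~~ link ab.1 ab.2) (fun ab => conflict ab.1 ab.2))
  (QAnd (qforall xpredT (fun r => qforall xpredT (fun i =>
           qimp (qp (X0 (fL r))) (c_shift (dr r i) i))))
        (qinput (fun g => if g is Some _ then PImp (X fN) (YS fN) else PTrue)))).

(** With [c_prev] this pins down [fP] as the time of the last visit: [c_prev] makes it the time of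
    an earlier visit, and [c_past] keeps every earlier visit from exceeding it. *)
Definition c_past (i : 'I_k) : qf :=
  qimp (QAnd (qless _ (Y fT) (X fT)) (qeq _ (Y (fH i)) (X (fH i))))
    (QAnd (qp (PNeg (X0 (fF i)))) (QNeg (qless _ (X (fP i)) (Y fT)))).

Definition c_prev (i : 'I_k) : qf :=
  qimp (QAnd (qp (PNeg (X0 (fF i)))) (qeq _ (Y fT) (X (fP i))))
    (QAnd (qless _ (Y fT) (X fT)) (QAnd (qeq _ (Y (fH i)) (X (fH i)))
      (qforall (fun ab : L * L => scn ab.1 i != wr ab.2 i) (fun ab => conflict ab.1 ab.2)))).

Definition c_zero : qf := qzero _ (Y fT).

Definition c_all : qf :=
  QAnd (c_carry fT fC) (QAnd (qforall xpredT (fun i => c_carry (fH i) (fHC i)))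
  (QAnd c_record (QAnd (qforall xpredT c_fresh) (QAnd c_start (QAnd c_init
  (QAnd c_step (QAnd (qforall xpredT c_past) (qforall xpredT c_prev)))))))).

Definition history_term m (x : seq S) : term :=
  sentence m (None :: map some x) c_zero c_next c_all.

Variables (m' : nat) (x : seq S).
Let m := m'.+1.
Let l := None :: map some x.
Let n := size x.
Hypothesis n_lt : n < 2 ^ m.
Notation qev q u v := (qeval m l q u v).

Definition letter_at (t : nat) : option S := nth None (rev l) t.

Fixpoint head_at (rs : nat -> L) (i : 'I_k) (t : nat) : int :=
  if t is t'.+1 then shift (head_at rs i t') (dr (rs t') i) else 0%R.

Fixpoint content (rs : nat -> L) (i : 'I_k) (t : nat) (z : int) : option Gm :=
  if t is t'.+1 then
    if z == head_at rs i t' then wr (rs t') i else content rs i t' z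
  else None.

Definition history (H : nat) (rs : nat -> L) : Prop :=
  [/\ forall t, t.+1 < H -> link (rs t) (rs t.+1),
      forall t, t <= n -> rs t = ini (letter_at t) &
      forall t i, t < H -> scn (rs t) i = content rs i t (head_at rs i t)].

Lemma head_at_bound rs i t : (`|head_at rs i t| <= t)%N.
Proof. by elim: t => //= t IH; case: (dr _ _) => /=; clear -IH; lia. Qed.

Lemma content_none rs i t z : (forall t', t' < t -> head_at rs i t' <> z) ->
  content rs i t z = None.
Proof.
elim: t => //= t IH H; case: eqP => [e|_]; first by case: (H t).
by apply: IH => t' tt; apply: H; exact: ltnW.
Qed.

Lemma content_some rs i t z t' : t' < t -> head_at rs i t' = z ->
  (forall t2, t' < t2 -> t2 < t -> head_at rs i t2 <> z) ->
  content rs i t z = wr (rs t') i.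
Proof.
elim: t => //= t IH; rewrite ltnS leq_eqVlt => /orP [/eqP -> <- _|lt e H].
  by rewrite eqxx.
case: eqP => [e'|_]; first by case: (H t).
by apply: IH => // t2 h1 h2; apply: H => //; exact: ltnW.
Qed.

Definition res (z : int) : nat := `|(z %% (2 ^ m)%:Z)%Z|%N.

Lemma pow_gt0 : 0 < 2 ^ m. Proof. by rewrite expn_gt0. Qed.

Lemma res_lt z : res z < 2 ^ m.
Proof.
have P : (0 < (2 ^ m)%:Z)%R by rewrite ltz_nat pow_gt0.
have := modz_ge0 z (lt0r_neq0 P); have := ltz_pmod z P.
by rewrite /res; lia.
Qed.

Lemma resP z : ((res z)%:Z = z %% (2 ^ m)%:Z)%Z.
Proof.
rewrite /res gez0_abs // modz_ge0 //.
by have := pow_gt0; lia.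
Qed.

(** The positions differ by less than [2 * 2 ^ m' = 2 ^ m]; this is why [m] exceeds [m'] by one. *)
Lemma res_inj z z' : (`|z| < 2 ^ m')%N -> (`|z'| < 2 ^ m')%N -> res z = res z' -> z = z'.
Proof.
move=> h h' e; have : (z == z' %[mod (2 ^ m)%:Z])%Z by rewrite -!resP e.
rewrite eqz_mod_dvd dvdzE absz_nat => d.
case: (posnP `|z - z'|%N) => [/eqP|p]; first by rewrite absz_eq0 subr_eq0 => /eqP.
by have := dvdn_leq p d; rewrite /m expnS; lia.
Qed.

Lemma resS z : res (z + 1) = (res z).+1 %% 2 ^ m.
Proof.
apply/eqP; rewrite -eqz_nat resP -modz_nat.
have -> : (Posz (res z).+1 = Posz (res z) + 1)%R by lia.
by rewrite resP modzDml.
Qed.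

Lemma res_pred z a : a < 2 ^ m -> res z = a.+1 %% 2 ^ m -> a = res (z - 1).
Proof.
move=> am e; apply/eqP; rewrite -eqz_nat resP.
rewrite -modzDml -(resP z) e -modz_nat modzDml.
have -> : (Posz a.+1 + -1 = Posz a)%R by lia.
by rewrite modz_nat modn_small.
Qed.

Definition nm (u : valuation) (f : field) : nat := num (u (code f)) m.
Definition fl (u : valuation) (f : field) : bool := u (code f) 0.
Definition carried (u : valuation) (f c : field) : Prop := carries (u (code f)) (u (code c)) m.

Lemma c_carryP f c u v : qev (c_carry f c) u v <-> carried v f c.
Proof.
rewrite qandP qbitsP; split=> -[h H]; split=> // j /H; rewrite peval_iff.
  by move/eqP.
by move=> e; apply/eqP.
Qed.

Lemma c_recordP u v : qev c_record u v <-> exists r, fl v (fL r).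
Proof.
have -> : qev c_record u v = has (fun r => fl v (fL r)) (enum L).
  rewrite /c_record /=; elim: (enum L) => //= r s <-.
  by rewrite negb_and !negbK.
split=> [/hasP [r _ h]|[r h]]; first by exists r.
by apply/hasP; exists r; rewrite ?mem_enum.
Qed.

Lemma c_freshP i u v : qev (c_fresh i) u v <->
  forall r, scn r i != None -> fl v (fF i) -> ~~ fl v (fL r).
Proof.
rewrite qforallP; split=> H r /H; first by rewrite /= negb_and => /orP [/negP|].
by rewrite /=; case f: (v _ _) => // h; apply: h; rewrite /fl f.
Qed.

Lemma c_startP u v : qev c_start u v <->
  (nm v fT = 0 -> fl v fN /\ forall i, nm v (fH i) = 0).
Proof.
rewrite qimpP qandP qzeroP qforallP; split=> H e; have [h1 h2] := H e; split=> // i.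
  by have := h2 i isT; rewrite qzeroP.
by move=> _; rewrite qzeroP; exact: h2.
Qed.

Lemma size_l : size l = n.+1.
Proof. by rewrite /= size_map. Qed.

Lemma c_initP u v : qev c_init u v <->
  forall j, j <= n -> v (code fN) j -> fl v (fL (ini (letter_at j))).
Proof.
rewrite (qinputP _ _ None) size_l.
by split=> H j /H; rewrite peval_imp => /implyP.
Qed.

Lemma c_shiftP d i u v z : carried u (fH i) (fHC i) -> carried v (fH i) (fHC i) ->
  nm u (fH i) = res z -> qev (c_shift d i) u v <-> nm v (fH i) = res (shift z d).
Proof.
move=> cu cv e; case: d.
- rewrite /= (@qincP _ m l _ _ _ u v) // -/(nm v _).
  change (nm u (fH i) = (nm v (fH i)).+1 %% 2 ^ m <-> nm v (fH i) = res (z - 1)).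
  rewrite e; split=> [/res_pred h|->]; first by apply: h; exact: num_lt.
  by rewrite -resS subrK.
- by rewrite [shift _ _]/= -e qeqP; split=> /esym.
- rewrite /= (@qincP _ m l _ _ _ u v) //.
  change (nm v (fH i) = (nm u (fH i)).+1 %% 2 ^ m <-> nm v (fH i) = res (z + 1)).
  by rewrite e resS.
Qed.

Lemma c_nextP u v : carried u fT fC ->
  qev c_next u v <-> nm v fT = (nm u fT).+1 %% 2 ^ m.
Proof. by move=> cu; rewrite (@qincP _ m l _ _ _ u v). Qed.

Lemma nth_map_some (T : eqType) (s : seq T) j : j < size s -> nth None (map some s) j != None.
Proof. by elim: s j => //= a s IH [|j] //=; exact: IH. Qed.

Lemma c_stepP u v : qev c_step u v <->
  (qev c_next u v -> (nm u fT).+1 <> 2 ^ m ->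
   [/\ forall a b, fl u (fL a) -> fl v (fL b) -> link a b,
       forall r i, fl u (fL r) -> qev (c_shift (dr r i) i) u v &
       forall j, j < n -> u (code fN) j -> v (code fN) j.+1]).
Proof.
have lt j : j < n -> nth None (rev l) j != None.
  move=> jn; rewrite rev_cons nth_rcons size_rev size_map jn -map_rev.
  by apply: nth_map_some; rewrite size_rev.
have ltn' : nth None (rev l) n = None.
  by rewrite rev_cons nth_rcons size_rev size_map ltnn eqxx.
have onesE : ~~ qev (qbits _ (X fT)) u v <-> (nm u fT).+1 <> 2 ^ m.
  by split=> [/negP h e|h]; [apply: h | apply/negP => /qonesP]; first exact/qonesP.
rewrite qimpP qandP (qandP _ _ (qforall _ _)) (qandP _ _ (qforall _ _)) !qforallP (qinputP _ _ None) size_l.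
split=> [H h1 h2|H [h1 /onesE h2]].
  have [|H1 [H2 H3]] := H; first by split=> //; apply/onesE.
  split=> [a b ua vb|r i ur|j jn].
  - apply: contraT => nl; have := H1 (a, b) nl.
    by rewrite /= negb_and; rewrite /fl in ua vb; rewrite ua vb.
  - by have := H2 r isT; rewrite qforallP => /(_ i isT); rewrite qimpP; apply.
  - have := H3 j (ltnW jn); move: (lt j jn); case: (nth _ _ _) => // g _.
    by rewrite peval_imp => /implyP.
have [H1 H2 H3] := H h1 h2; split; last split.
- move=> [a b] /= nl; rewrite negb_and; apply/orP.
  case ua: (u _ _); last by left.
  by right; apply: contra nl => vb; exact: H1.
- by move=> r _; rewrite qforallP => i _; rewrite qimpP; exact: H2.
- move=> j; rewrite ltnS leq_eqVlt => /orP [/eqP ->|jn]; first by rewrite ltn'.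
  by case: (nth _ _ _) => // g; rewrite peval_imp; apply/implyP; exact: H3.
Qed.

Lemma c_pastP i u v : qev (c_past i) u v <->
  (nm v fT < nm u fT -> nm v (fH i) = nm u (fH i) ->
   ~~ fl u (fF i) /\ ~~ (nm u (fP i) < nm v fT)).
Proof.
rewrite qimpP !qandP qlessP qeqP.
have -> : qev (QNeg (qless _ (X (fP i)) (Y fT))) u v = ~~ (nm u (fP i) < nm v fT).
  exact: (congr1 negb (@qlessP _ m l _ _ u v)).
by split=> [H h1 h2|H [h1 h2]]; exact: H.
Qed.

Lemma c_prevP i u v : qev (c_prev i) u v <->
  (~~ fl u (fF i) -> nm v fT = nm u (fP i) ->
   [/\ nm v fT < nm u fT, nm v (fH i) = nm u (fH i) &
     forall a b, fl u (fL a) -> fl v (fL b) -> scn a i = wr b i]).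
Proof.
rewrite qimpP !qandP qlessP !qeqP qforallP.
split=> [H h1 h2|H [h1 h2]].
  have [h3 [h4 h5]] := H (conj h1 h2); split=> // a b ua vb.
  apply/eqP/contraT => ne; have := h5 (a, b) ne.
  by rewrite /= negb_and; rewrite /fl in ua vb; rewrite ua vb.
have [h3 h4 h5] := H h1 h2; split=> //; split=> // -[a b] /= ne.
rewrite negb_and; apply/orP; case ua: (u _ _); last by left.
by right; apply: contra ne => vb; apply/eqP; exact: h5.
Qed.

Lemma c_zeroP u v : qev c_zero u v <-> nm v fT = 0.
Proof. by rewrite qzeroP. Qed.

Lemma c_allP u v : qev c_all u v <->
  [/\ carried v fT fC, forall i, carried v (fH i) (fHC i), qev c_record u v,
      forall i, qev (c_fresh i) u v & qev c_start u v] /\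
  [/\ qev c_init u v, qev c_step u v, forall i, qev (c_past i) u v & forall i, qev (c_prev i) u v].
Proof.
split=> [/qandP [/c_carryP h1 /qandP [/qforallP h2 /qandP [h3 /qandP [/qforallP h4
    /qandP [h5 /qandP [h6 /qandP [h7 /qandP [/qforallP h8 /qforallP h9]]]]]]]]|].
  split; split=> // i; try by [exact: h4 | exact: h8 | exact: h9].
  by apply/(c_carryP _ _ u); exact: h2.
move=> [[h1 h2 h3 h4 h5] [h6 h7 h8 h9]].
apply/qandP; split; first exact/c_carryP.
apply/qandP; split; first by apply/qforallP => i _; exact/c_carryP.
apply/qandP; split=> //; apply/qandP; split; first by apply/qforallP.
do 3 (apply/qandP; split=> //).
by apply/qandP; split; apply/qforallP.
Qed.

(** * From a model to a history *)

Section Sound.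
Variables (A : Type) (w : A -> valuation).
Hypothesis zeroH : exists a b, qev c_zero (w a) (w b).
Hypothesis nextH : forall a, exists b, qev c_next (w a) (w b).
Hypothesis allH : forall a b, qev c_all (w a) (w b).

(** Several elements may bear the same time; starting at time 0 and choosing successors singles out
    one for each time below [2 ^ m]. *)
Lemma time_chain : exists e : nat -> A,
  (forall t, t < 2 ^ m -> nm (w (e t)) fT = t) /\
  forall t, qev c_next (w (e t)) (w (e t.+1)).
Proof.
have [a [z /c_zeroP z0]] := zeroH.
have [f fP] := choice nextH.
pose e t := iter t f z; exists e; split=> [|t]; last exact: fP.
elim=> [|t IH] tm //; have /(c_nextP _) h := fP (e t).
rewrite [e _]/= -/(e t) h; last first.
  by have [[]] := (c_allP _ _).1 (allH a (e t)).
by rewrite IH ?modn_small // ltnW.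
Qed.

(** During the first [2 ^ m'] times the heads stay close enough to the origin for equal residues to
    mean equal cells. At a fresh cell [c_past] excludes earlier visits; otherwise [c_prev] leads to
    the chain element at the recorded time, and [c_past] excludes visits in between. *)
Theorem history_sound : exists rs, history (2 ^ m') rs.
Proof.
have [e [eT eN]] := time_chain.
have mm : 2 ^ m' < 2 ^ m by rewrite ltn_exp2l.
have C a b := (c_allP (w a) (w b)).1 (allH a b).
have rec t : exists r, fl (w (e t)) (fL r).
  by have [[_ _ /c_recordP]] := C (e t) (e t).
have [g gP] := choice rec.
(* An element may carry several records, and the conditions hold for each of them; at the initial
   times the prescribed record is chosen. *)
pose rs t := if t <= n then ini (letter_at t) else g t.
have marker t : t <= n -> w (e t) (code fN) t.
  elim: t => [|t IH] tn.
    have [[_ _ _ _ /c_startP]] := C (e 0) (e 0).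
    by case; rewrite ?eT ?expn_gt0.
  have [_ [_ /c_stepP]] := C (e t) (e t.+1).
  case=> //; first by rewrite eT; [apply/eqP; rewrite ltn_eqF //|]; apply: leq_ltn_trans n_lt; rewrite // ltnW.
  by move=> _ _ /(_ t tn) h _ _; apply: h; apply: IH; exact: ltnW.
have rsP t : fl (w (e t)) (fL (rs t)).
  rewrite /rs; case: leqP => tn; last exact: gP.
  by have [_ [/c_initP h _ _ _]] := C (e t) (e t); apply: h => //; exact: marker.
have step t : t.+1 < 2 ^ m -> link (rs t) (rs t.+1) /\
    forall i, qev (c_shift (dr (rs t) i) i) (w (e t)) (w (e t.+1)).
  move=> tm; have [_ [_ /c_stepP h _ _]] := C (e t) (e t.+1).
  have [|h1 h2 _] := h (eN t); first by rewrite eT ?(ltnW tm) //; apply/eqP; rewrite ltn_eqF.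
  by split=> [|i]; [exact: h1 | exact: h2].
have headP i t : t < 2 ^ m -> nm (w (e t)) (fH i) = res (head_at rs i t).
  elim: t => [|t IH] tm.
    have [[_ _ _ _ /c_startP]] := C (e 0) (e 0).
    by rewrite eT ?expn_gt0 // => /(_ erefl) [_ ->]; rewrite /res /= mod0z.
  have [_ /(_ i) h] := step t tm.
  have [[_ c1 _ _ _] _] := C (e t) (e t); have [[_ c2 _ _ _] _] := C (e t) (e t.+1).
  by apply/(c_shiftP (dr (rs t) i) (c1 i) (c2 i) (IH (ltnW tm))).
have head_inj i t t' : t < 2 ^ m' -> t' < 2 ^ m' ->
    nm (w (e t)) (fH i) = nm (w (e t')) (fH i) -> head_at rs i t = head_at rs i t'.
  move=> tm tm'; rewrite !headP; try exact: ltn_trans mm.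
  by apply: res_inj; apply: leq_ltn_trans (head_at_bound _ _ _) _.
exists rs; split=> [t tm|t tn|t i tm].
- by have [] := step t (ltn_trans tm mm).
- by rewrite /rs tn.
case fr: (fl (w (e t)) (fF i)).
  have [[_ _ _ /(_ i) /c_freshP h _] _] := C (e t) (e t).
  rewrite content_none => [|t' tt' eh].
    by apply/eqP/contraT => ne; have := h _ ne fr; rewrite rsP.
  have [_ [_ _ /(_ i) /c_pastP p _]] := C (e t) (e t').
  have tm' : t' < 2 ^ m' by exact: ltn_trans tt' tm.
  have [||] := p; rewrite ?eT ?headP ?eh ?fr //; exact: ltn_trans mm.
have [_ [_ _ _ /(_ i) /c_prevP p]] := C (e t) (e (nm (w (e t)) (fP i))).
have [||] := p; rewrite ?fr ?eT ?num_lt //; try exact: ltn_trans mm.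
set t' := nm _ _ => tt' eh wE.
have tm' : t' < 2 ^ m' by exact: ltn_trans tt' tm.
rewrite (wE _ _ (rsP t) (rsP t')); apply/esym.
apply: content_some tt' (head_inj _ _ _ _ _ eh) _ => // t2 h1 h2 eh2.
have tm2 : t2 < 2 ^ m' by exact: ltn_trans h2 tm.
have [_ [_ _ /(_ i) /c_pastP q _]] := C (e t) (e t2).
have [||_] := q; rewrite ?eT ?headP ?eh2 // -?/t' ?h1 //; exact: ltn_trans mm.
Qed.

End Sound.

(** * From a history to a model *)

Section Complete.
Variable rs : nat -> L.
Hypothesis rsH : history (2 ^ m) rs.
Hypothesis rs_bound : forall i t, t < 2 ^ m -> (`|head_at rs i t| < 2 ^ m')%N.

Fixpoint visit (i : 'I_k) (t : nat) (z : int) : option nat :=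
  if t is t'.+1 then if z == head_at rs i t' then Some t' else visit i t' z else None.

Lemma content_visit i t z :
  content rs i t z = if visit i t z is Some t' then wr (rs t') i else None.
Proof. by elim: t => //= t ->; case: eqP. Qed.

Lemma visit_some i t z t' : visit i t z = Some t' -> t' < t /\ head_at rs i t' = z.
Proof.
elim: t => //= t IH; case: eqP => [-> [<-]|_ /IH [h ->]] //.
by split=> //; exact: ltnW.
Qed.

Lemma visit_last i t z t' : t' < t -> head_at rs i t' = z ->
  exists2 t2, visit i t z = Some t2 & t' <= t2.
Proof.
elim: t => //= t IH; rewrite ltnS leq_eqVlt => /orP [/eqP -> <-|h e].
  by rewrite eqxx; exists t.
case: eqP => [_|_]; first by exists t => //; exact: ltnW.
exact: IH.
Qed.

(** Without a previous visit its time defaults to 0, and the last flag of the tape tells this case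
    apart. *)
Definition field_val (t : nat) (f : field) (j : nat) : bool :=
  match f with
  | inl (inl o) => nth false [:: bit t j; carry_bit t j; j == t] o
  | inl (inr (i, o)) =>
    let v := visit i t (head_at rs i t) in
    nth false [:: bit (res (head_at rs i t)) j; carry_bit (res (head_at rs i t)) j;
                  bit (odflt 0 v) j; v == None] o
  | inr r => rs t == r
  end.

Definition time_val (t : 'I_(2 ^ m)) : valuation := fun c j =>
  if [pick f | code f == c] is Some f then field_val t f j else false.

Lemma time_valE t f : time_val t (code f) = field_val t f.
Proof.
apply: funext => j; rewrite /time_val; case: pickP => [f' /eqP|/(_ f)]; last by rewrite eqxx.
by move/val_inj/enum_rank_inj => ->.
Qed.

Lemma nm_bit (t : 'I_(2 ^ m)) f a : field_val t f = bit a -> nm (time_val t) f = a %% 2 ^ m.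
Proof. by move=> e; rewrite /nm time_valE e num_bit. Qed.

Lemma nmT (t : 'I_(2 ^ m)) : nm (time_val t) fT = t.
Proof. by rewrite (@nm_bit t fT t) // modn_small. Qed.

Lemma nmH (t : 'I_(2 ^ m)) i : nm (time_val t) (fH i) = res (head_at rs i t).
Proof. by rewrite (@nm_bit t (fH i) (res (head_at rs i t))) // modn_small // res_lt. Qed.

Lemma nmP (t : 'I_(2 ^ m)) i : nm (time_val t) (fP i) = odflt 0 (visit i t (head_at rs i t)).
Proof.
rewrite (@nm_bit t (fP i) (odflt 0 (visit i t (head_at rs i t)))) // modn_small //.
case e: (visit _ _ _) => [t'|] /=; last exact: pow_gt0.
by have [h _] := visit_some e; exact: ltn_trans h (ltn_ord t).
Qed.

Lemma flL (t : 'I_(2 ^ m)) r : fl (time_val t) (fL r) = (rs t == r).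
Proof. by rewrite /fl time_valE. Qed.

Lemma flF (t : 'I_(2 ^ m)) i : fl (time_val t) (fF i) = (visit i t (head_at rs i t) == None).
Proof. by rewrite /fl time_valE. Qed.

Lemma val_carryT t : carried (time_val t) fT fC.
Proof. by rewrite /carried !time_valE; exact: carries_bit. Qed.

Lemma val_carryH t i : carried (time_val t) (fH i) (fHC i).
Proof. by rewrite /carried !time_valE; exact: carries_bit. Qed.

Lemma val_head_inj (a b : 'I_(2 ^ m)) i :
  nm (time_val b) (fH i) = nm (time_val a) (fH i) -> head_at rs i b = head_at rs i a.
Proof. by rewrite !nmH; apply: res_inj; exact: rs_bound. Qed.

Lemma history_complete :
  [/\ exists a b, qev c_zero (time_val a) (time_val b),
      forall a, exists b, qev c_next (time_val a) (time_val b) &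
      forall a b, qev c_all (time_val a) (time_val b)].
Proof.
have [Hl Hi Hs] := rsH.
split.
- by exists (Ordinal pow_gt0), (Ordinal pow_gt0); apply/c_zeroP; rewrite nmT.
- move=> a; have h : a.+1 %% 2 ^ m < 2 ^ m by rewrite ltn_mod pow_gt0.
  by exists (Ordinal h); apply/c_nextP; rewrite ?nmT //; exact: val_carryT.
move=> a b; apply/c_allP; split; split.
- exact: val_carryT.
- by move=> i; exact: val_carryH.
- by apply/c_recordP; exists (rs b); rewrite flL.
- move=> i; apply/c_freshP => r ne; rewrite flF flL => /eqP v; apply: contra ne => /eqP <-.
  by rewrite Hs // content_visit v.
- apply/c_startP; rewrite nmT => b0; split; first by rewrite /fl time_valE /= b0.
  by move=> i; rewrite nmH b0 /res /= mod0z.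
- apply/c_initP => j jn; rewrite time_valE /= => /eqP e.
  by rewrite flL -e Hi.
- apply/c_stepP => /(c_nextP _ (val_carryT a)); rewrite !nmT => e ne.
  have am : a.+1 < 2 ^ m by rewrite ltn_neqAle ltn_ord andbT; exact/eqP.
  rewrite modn_small // in e; split.
  + by move=> r r'; rewrite !flL => /eqP <- /eqP <-; rewrite e; exact: Hl.
  + move=> r i; rewrite flL => /eqP <-.
    by apply/(c_shiftP _ (val_carryH a i) (val_carryH b i) (nmH a i)); rewrite nmH e.
  + by move=> j jn; rewrite !time_valE /= e eqSS.
- move=> i; apply/c_pastP; rewrite !nmT => ba /val_head_inj eh.
  have [t2 v le] := visit_last ba eh.
  by rewrite flF nmP v /= -leqNgt.
move=> i; apply/c_prevP; rewrite flF nmP !nmT.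
case v: (visit _ _ _) => [t'|] //= _ e; have [lt eh] := visit_some v.
split; first by rewrite e.
  by rewrite !nmH e eh.
move=> r r'; rewrite !flL => /eqP <- /eqP <-.
by rewrite Hs // content_visit v e.
Qed.

End Complete.

(** The model contains all [2 ^ m] times, twice as many as are used to extract a history. The bound
    on the heads keeps residues faithful throughout; a run that idles after halting satisfies it. *)
Theorem history_satisfiable rs : history (2 ^ m) rs ->
  (forall i t, t < 2 ^ m -> (`|head_at rs i t| < 2 ^ m')%N) ->
  satisfiable (history_term m x).
Proof.
move=> H b; have [z nx al] := history_complete H b.
by apply/satisfiable_sentence; exists 'I_(2 ^ m), (time_val rs).
Qed.

Theorem satisfiable_history : satisfiable (history_term m x) ->
  exists rs, history (2 ^ m') rs.
Proof. by case/satisfiable_sentence => A [w [z nx al]]; apply: (history_sound (w := w)). Qed.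

End History.

(** * Computations as histories *)

Section Computation.
Variables (S G : finType) (ii : S -> G) (M : machine G).
Let k := (ntapes M).+1.
Let scan_t := {ffun 'I_k -> option G}.
Let action_t := (state M * {ffun 'I_k -> option G * dir})%type.

(* A step writing a letter of the input to the left, or ([None]) the move from
   the input to the start state; a step of the machine, or ([None]) an idle
   step after halting. *)
Definition record : finType := (option G + state M * scan_t * option action_t)%type.

Definition r_scn (r : record) (i : 'I_k) : option G :=
  if r is inr (_, s, _) then s i else None.

Definition r_wr (r : record) (i : 'I_k) : option G :=
  match r with
  | inl o => if i == ord0 then o else None
  | inr (_, _, Some a) => (a.2 i).1
  | inr (_, s, None) => s i
  end.

Definition r_dr (r : record) (i : 'I_k) : dir :=
  match r with
  | inl o => if i == ord0 then (if o is Some _ then MLeft else MRight) else MStay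
  | inr (_, _, Some a) => (a.2 i).2
  | inr (_, _, None) => MStay
  end.

(** An idle record certifies that the machine has halted and accepts, so a computation that halts
    otherwise cannot be continued in a history. *)
Definition r_valid (r : record) : bool :=
  match r with
  | inl _ => true
  | inr (q, s, Some a) => trans (m := M) q s a
  | inr (q, s, None) => accepting (m := M) q && [forall a, ~~ trans (m := M) q s a]
  end.

Definition r_next (r r' : record) : bool :=
  match r, r' with
  | inl (Some _), _ => true
  | inl None, inr (q, _, _) => q == start M
  | inr (_, _, Some a), inr (q, _, _) => q == a.1
  | inr (_, _, None), _ => true
  | _, _ => false
  end.

Definition r_link (r r' : record) : bool := r_valid r && r_next r r'.

Definition r_ini (o : option S) : record := inl (omap ii o).

Definition run_term (m : nat) (x : seq S) : term :=
  history_term r_scn r_wr r_dr r_link r_ini m x.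

Variable x : seq S.
Let n := size x.
Notation head_at := (head_at r_dr).
Notation content := (content r_wr r_dr).
Notation letter_at := (letter_at x).
Let w := map ii x.

(** The letters are written on cells 0 down to [1 - n], and the move back to the right leaves the
    head on [1 - n], where the first letter stands; the machine calls this cell 0. *)
Definition off (i : 'I_k) : int := if i == ord0 then (1 - Posz n)%R else 0%R.

Definition matches (rs : nat -> record) t (c : config M) : Prop := forall i,
  (forall z, ctape c i z = content rs i t (z + off i)%R) /\
  chead c i = (head_at rs i t - off i)%R.

Lemma letter_atE t : t < n -> letter_at t = nth None (map some x) (n - t.+1).
Proof.
move=> tn; rewrite /letter_at rev_cons nth_rcons size_rev size_map tn.
by rewrite nth_rev ?size_map.
Qed.

Lemma letter_at_some t : t < n -> exists g, letter_at t = Some g.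
Proof.
move=> tn; rewrite letter_atE //; have : n - t.+1 < size x by rewrite /n; lia.
move/(nth_map_some (s := x)); case: (nth _ _ _) => // g _; by exists g.
Qed.

Lemma letter_at_end : letter_at n = None.
Proof. by rewrite /letter_at rev_cons nth_rcons size_rev size_map ltnn eqxx. Qed.

Section Initial.
Variable rs : nat -> record.
Hypothesis rs_ini : forall t, t <= n -> rs t = r_ini (letter_at t).

Lemma head_ini t : t <= n -> head_at rs ord0 t = (- Posz t)%R.
Proof.
elim: t => //= t IH tn; rewrite (IH (ltnW tn)) rs_ini ?(ltnW tn) //.
by have [g ->] := letter_at_some tn => /=; lia.
Qed.

Lemma head_ini_other i t : t <= n.+1 -> i != ord0 -> head_at rs i t = 0%R.
Proof.
move=> tn i0; elim: t tn => //= t IH tn; rewrite (IH (ltnW tn)) rs_ini //.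
by rewrite /= /r_dr (negbTE i0).
Qed.

Lemma content_ini_other i t z : t <= n.+1 -> i != ord0 -> content rs i t z = None.
Proof.
move=> tn i0; elim: t tn => //= t IH tn; rewrite (IH (ltnW tn)) rs_ini //.
by rewrite /= (negbTE i0) if_same.
Qed.

Lemma content_ini t z : t <= n -> content rs ord0 t z =
  if (z <= 0)%R && (`|z|%N < t) then omap ii (letter_at `|z|%N) else None.
Proof.
elim: t => [|t IH] tn /=; first by rewrite ltn0 andbF.
rewrite (IH (ltnW tn)) rs_ini ?(ltnW tn) // head_ini ?(ltnW tn) //.
case: eqP => [->|ne]; first by rewrite abszN absz_nat oppr_le0 lez_nat ltnSn.
by congr (if _ then _ else _); lia.
Qed.

Lemma matches_ini : matches rs n.+1 (init_config M w).
Proof.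
move=> i; rewrite /off; case: (eqVneq i ord0) => [->|i0]; last first.
  split=> [z|]; rewrite /= -/(head_at rs i n.+1) -/(content rs i n.+1 _).
    rewrite (negbTE i0) (@content_ini_other _ n.+1) //.
    by case: z => // j; rewrite /= nth_nil.
  by rewrite (@head_ini_other _ n.+1) // subr0.
have hn : head_at rs ord0 n.+1 = (1 - Posz n)%R.
  rewrite /= head_ini // rs_ini // letter_at_end /= addrC.
  by [].
split; last by rewrite hn subrr.
move=> z; rewrite /= rs_ini // letter_at_end /= head_ini // content_ini //.
case: eqP => [e|ne].
  have -> : z = Negz 0 by lia.
  by [].
case: z ne => [z|z] ne /=; last first.
  by rewrite (_ : (_ < n) = false) ?andbF //; lia.
case: (ltnP z n) => zn.
  rewrite (_ : (_ <= 0)%R && _ = true); last by lia.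
  have e : absz (Posz z + (1 - Posz n))%R = n - z.+1 by lia.
  rewrite e letter_atE; last by lia.
  rewrite (_ : n - (n - z.+1).+1 = z); last by lia.
  have zx : z < size x by [].
  rewrite /w; elim: (x) z zx {ne zn e} => //= a s IHs [|z] //= zs; exact: IHs.
rewrite (_ : (_ <= 0)%R && _ = false); last by lia.
by rewrite nth_default // !size_map.
Qed.

End Initial.

Lemma matches_step rs t c q s a :
  matches rs t c -> rs t = inr (q, s, Some a) -> matches rs t.+1 (apply_action c a).
Proof.
move=> H e i; have [Hz Hh] := H i; split=> [z|] /=.
  rewrite e /= Hz Hh; congr (if _ then _ else _).
  by apply/eqP/eqP => [->|<-]; rewrite ?subrK ?addrK.
by rewrite e /= Hh; move: (off i) => o; case: (a.2 i).2 => /=; lia.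
Qed.

Lemma matches_idle rs t c q s :
  matches rs t c -> rs t = inr (q, s, None) -> (forall i, s i = content rs i t (head_at rs i t)) ->
  matches rs t.+1 c.
Proof.
move=> H e sc i; have [Hz Hh] := H i; split=> [z|] /=; rewrite e //=.
by rewrite Hz; case: eqP => [->|//]; rewrite sc.
Qed.

Lemma matches_scanned rs t c i : matches rs t c ->
  scanned c i = content rs i t (head_at rs i t).
Proof. by move=> H; have [Hz Hh] := H i; rewrite ffunE Hz Hh subrK. Qed.

(** A history longer than any computation of the machine must contain an idle record, and the first
    one certifies an accepting computation. *)
Lemma history_accepts H T rs : halts_within M w T -> n + T + 3 < H ->
  history r_scn r_wr r_dr r_link r_ini x H rs -> accepts M w.
Proof.
move=> hT TH [Hl Hi Hs].
have base : exists s oa, rs n.+1 = inr (start M, s, oa).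
  have := Hl n; rewrite (Hi n) // letter_at_end /r_link /=.
  case: (rs n.+1) => [o|[[q s] oa]] h; first by move: (h ltac:(lia)).
  by exists s, oa; move: (h ltac:(lia)) => /eqP ->.
apply: contrapT => no.
suff go s : s <= T.+1 -> exists c s' oa, [/\ reaches (init_config M w) s c,
    matches rs (n.+1 + s) c & rs (n.+1 + s) = inr (cstate c, s', oa)].
  by have [c [s' [oa [/hT]]]] := go T.+1 (leqnn _); rewrite ltnn.
elim: s => [|s IH] sT.
  have [s' [oa e]] := base; exists (init_config M w), s', oa; rewrite addn0.
  by split; [exact: reaches0 | exact: matches_ini |].
have [c [s' [oa [R m e]]]] := IH (ltnW sT).
have scE : s' = scanned c.
  apply/ffunP => i; rewrite (matches_scanned i m).
  by have := Hs (n.+1 + s) i ltac:(lia); rewrite e.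
have := Hl (n.+1 + s) ltac:(lia); rewrite e /r_link /=.
case: oa e => [a|] e /andP [v nx].
  exists (apply_action c a); move: nx; rewrite addnS.
  case e': (rs _.+1) => [o|[[q s2] oa]] // /eqP qa; exists s2, oa; split=> //.
  - by apply: reachesS R _; rewrite -scE.
  - exact: matches_step m e.
  - by rewrite qa.
case: no; exists s, c; case/andP: v => ac /forallP h; split=> //.
by move=> a; rewrite -scE.
Qed.

(** A finite computation as an infinite sequence: after [N] steps the configuration is repeated,
    with [None] as the action. *)
Lemma reaches_path (c0 c : config M) N : reaches c0 N c ->
  exists (cs : nat -> config M) (acts : nat -> option action_t),
  [/\ cs 0 = c0,
      forall s, s < N -> exists a, [/\ acts s = Some a,
        trans (cstate (cs s)) (scanned (cs s)) a & cs s.+1 = apply_action (cs s) a] &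
      forall s, N <= s -> acts s = None /\ cs s = c].
Proof.
elim=> [|N' d a _ [cs [acts [c0E aS aN]]] tr].
  by exists (fun=> c0), (fun=> None).
exists (fun s => if s <= N' then cs s else apply_action d a),
  (fun s => if s == N' then Some a else acts s).
have csN : cs N' = d by have [] := aN N' (leqnn _).
split=> // s sN.
  case: (eqVneq s N') => [->|ne]; first by exists a; rewrite leqnn ltnn csN.
  have sN' : s < N' by rewrite ltn_neqAle ne.
  have [a' [e1 e2 e3]] := aS s sN'; exists a'.
  by rewrite (ltnW sN') sN'.
rewrite (gtn_eqF sN) leqNgt sN /=.
by have [-> _] := aN s (ltnW sN).
Qed.

Lemma accepts_history m' T : halts_within M w T -> n + T + 3 < 2 ^ m' -> accepts M w ->
  exists rs, (forall H, history r_scn r_wr r_dr r_link r_ini x H rs) /\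
    forall i t, (`|head_at rs i t| < 2 ^ m')%N.
Proof.
move=> hT TH [N [c [R hc ac]]]; have NT := hT _ _ R.
have [cs [acts [c0E aS aN]]] := reaches_path R.
pose rs t : record := if t <= n then r_ini (letter_at t) else
  inr (cstate (cs (t - n.+1)), scanned (cs (t - n.+1)), acts (t - n.+1)).
have rsI t : t <= n -> rs t = r_ini (letter_at t) by rewrite /rs => ->.
have rsS s : rs (n.+1 + s) = inr (cstate (cs s), scanned (cs s), acts s).
  by rewrite /rs (_ : _ <= n = false) ?addKn //; lia.
have mt s : matches rs (n.+1 + s) (cs s).
  elim: s => [|s IH]; first by rewrite addn0 c0E; exact: matches_ini.
  rewrite addnS; case: (ltnP s N) => sN.
    have [a [e1 e2 e3]] := aS s sN; rewrite e3.
    by apply: matches_step IH _; rewrite rsS e1.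
  have [e1 e2] := aN s sN; have [_ e3] := aN s.+1 (leqW sN).
  rewrite e3 -e2; apply: matches_idle (IH) _ _; first by rewrite rsS e1.
  by move=> i; rewrite (matches_scanned i IH).
exists rs; split=> [H|i t].
  split=> // [t tH|t i tH].
    case: (ltngtP t n) => tn.
    - by rewrite rsI ?(ltnW tn) //; have [g ->] := letter_at_some tn.
    - have -> : t = n.+1 + (t - n.+1) by lia.
      move: (t - n.+1) => s; rewrite -addnS !rsS /r_link.
      case: (ltnP s N) => sN.
        have [a [e1 e2 e3]] := aS s sN.
        by rewrite e1 /= e2 e3 /=.
      have [e1 e2] := aN s sN; rewrite e1 e2 /= ac andbT /=.
      by apply/forallP => a; exact: hc.
    - rewrite rsI ?tn // letter_at_end; have := rsS 0; rewrite addn0 => ->.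
      by rewrite /r_link /= c0E.
  case: (leqP t n) => tn.
    rewrite (rsI t tn) /=; case: (eqVneq i ord0) => [->|i0].
      by rewrite (head_ini rsI) // (content_ini rsI) // abszN absz_nat ltnn andbF.
    by rewrite (content_ini_other rsI) // ltnW.
  have -> : t = n.+1 + (t - n.+1) by lia.
  by rewrite rsS /= (matches_scanned i (mt _)).
(* A head moves by at most one cell per step until the machine halts, and not at all afterwards. *)
suff h : `|head_at rs i t| <= n.+1 + N by lia.
case: (leqP t (n.+1 + N)) => tN; first by apply: leq_trans (head_at_bound _ _ _ _) tN.
have -> : t = n.+1 + N + (t - (n.+1 + N)) by lia.
elim: (t - _) => [|s IH]; first by rewrite addn0; exact: head_at_bound.
have e : rs (n.+1 + N + s) = inr (cstate (cs (N + s)), scanned (cs (N + s)), None).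
  by rewrite -addnA rsS; have [-> _] := aN (N + s) (leq_addr _ _).
rewrite addnS; move: e IH; move: (n.+1 + N + s) => t' e IH; by rewrite /= e.
Qed.

Theorem run_term_accepts m' T : halts_within M w T -> n + T + 3 < 2 ^ m' ->
  satisfiable (run_term m'.+1 x) <-> accepts M w.
Proof.
move=> hT TH; have nm : n < 2 ^ m'.+1 by rewrite expnS; lia.
split=> [/(satisfiable_history nm) [rs h]|ac]; first exact: history_accepts hT TH h.
have [rs [h b]] := accepts_history hT TH ac.
by apply: (history_satisfiable nm (h _)) => i t _; exact: b.
Qed.

End Computation.

(** * Printing the schema *)

Section Printer.
Variable S : finType.
Let G : finType := (S + letter)%type.
Notation cmd := (cmd G).
Notation pX := 0. Notation pT := 1. Notation pM := 2. Notation pJ := 3.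
Notation pR := 4. Notation pXC := 5. Notation pM2 := 6. Notation pOUT := 8.

Definition tick : G := inr L1.
Definition osym (g : G) : option S := if g is inl a then Some a else None.

Definition print_str (s : seq letter) : cmd :=
  foldr (fun a c => Push pOUT (inr a : G) ;; c) (Skip G) s.

(** Printing the unary index consumes its counter [pJ], so the counter is rebuilt in the same
    pass. *)
Definition print_chunk (o : chunk) : cmd :=
  if o is Some s then print_str s
  else mv G pJ pT ;; For pT (fun g => Push pJ g ;; Push pOUT tick).

Definition print_chunks (its : seq chunk) : cmd :=
  foldr (fun o c => print_chunk o ;; c) (Skip G) its.

(** Stack [pJ] starts as high as [pR] and is popped at the start of each round, so it holds the
    number of letters that remain, which is the index of the current one. *)
Definition print_loop (its : G -> seq chunk) : cmd :=
  For pR (fun g => Pop G pJ ;; print_chunks (its g)).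

(** The letter [inr LR] is decoded by [osym] as [None], the mark at the head of the list; the
    additional tick on [pJ] accounts for it. *)
Definition print_segment (g : segment (option S)) : cmd :=
  match g with
  | GConst s => print_str s
  | GBits its => cp G pT pM pJ ;; cp G pT pM pR ;; print_loop (fun=> its)
  | GInput its => cp G pT pXC pJ ;; Push pJ tick ;;
      cp G pT pXC pR ;; Push pR (inr LR : G) ;; print_loop (fun g => its (osym g))
  end.

Definition print_segments (l : seq (segment (option S))) : cmd :=
  foldr (fun g c => print_segment g ;; c) (Skip G) l.

Definition times_input : cmd :=
  For pM (fun=> mv G pXC pT ;; For pT (fun g => Push pXC g ;; Push pM2 tick)) ;;
  mv G pM2 pM.

(** A single mark is multiplied [e] times by the length of the input, then [C] marks are added. *)
Definition bit_counter (e C : nat) : cmd :=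
  Push pM tick ;; iter e (fun c => times_input ;; c) (iter C (fun c => Push pM tick ;; c) (Skip G)).

Definition printer (e C : nat) (l : seq (segment (option S))) : cmd :=
  mv G pX pT ;; mv G pT pXC ;; bit_counter e C ;; print_segments l.

(** * Correctness of the printer *)

Section Specs.
Variable B : nat.
Notation ok := (@ok G B).
Implicit Type s : store G.

Definition out (s : store G) (w : seq letter) : store G :=
  upd s pOUT (rev (map inr w) ++ s pOUT).

Lemma out_nil s : out s [::] = s.
Proof. by rewrite /out upd_id. Qed.

Lemma out_cat s w w' : out (out s w) w' = out s (w ++ w').
Proof. by rewrite /out upd_upd upd_same map_cat rev_cat catA. Qed.

Lemma ok_print_str w s : ok (print_str w) s (out s w).
Proof.
elim: w s => [|a w IH] s; first by rewrite out_nil; exact: ok_skip.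
by apply: ok_seq (ok_push _ _ _ _) _; rewrite -[a :: w]/([:: a] ++ w) -out_cat; exact: IH.
Qed.

Lemma ok_print_chunk o s : s pT = [::] -> size (s pJ) <= B ->
  ok (print_chunk o) s (out s (chunk_str (size (s pJ)) o)).
Proof.
move=> hT sJ; case: o => [w|]; first exact: ok_print_str.
apply: ok_seq (ok_mv _ sJ) _ => //; rewrite hT cats0.
set s1 := upd _ _ _; have hT1 : s1 pT = rev (s pJ) by [].
apply: (@ok_for _ _ (fun c l => upd (upd (upd s pT l) pJ (rev c)) pOUT (nseq (size c) tick ++ s pOUT))).
- by rewrite hT1 size_rev.
- by rewrite hT1 /s1; store_eq.
- rewrite hT1 revK size_rev /out /= map_nseq rev_nseq.
  by apply: funext => r; rewrite /upd; case: eqP => // _; case: eqP => [->|_] //; case: eqP => [->|].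
move=> c g l _; apply: ok_seq (ok_push _ _ _ _) _; apply: ok_eq (ok_push _ _ _ _) _.
by rewrite !updE /= size_rcons; store_eq.
Qed.

Lemma ok_print_chunks its s : s pT = [::] -> size (s pJ) <= B ->
  ok (print_chunks its) s (out s (chunks_str (size (s pJ)) its)).
Proof.
elim: its s => [|o its IH] s hT sJ; first by rewrite out_nil; exact: ok_skip.
apply: ok_seq (ok_print_chunk _ hT sJ) _.
rewrite chunks_str_cons -out_cat; apply: (IH (out s _)) => //.
Qed.

(** What has been printed when the letters [c] of a list of length [N] have been read. The indices
    count down from the whole length, so this part of [input_fold] needs a definition of its own as
    loop invariant. *)
Fixpoint front_fold (N : nat) (its : G -> seq chunk) (c : seq G) : seq letter :=
  if c is g :: c' then chunks_str N.-1 (its g) ++ front_fold N.-1 its c' else [::].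

Lemma front_fold_rcons N its c g : front_fold N its (rcons c g) =
  front_fold N its c ++ chunks_str (N - (size c).+1) (its g).
Proof.
elim: c N => [|a c IH] N /=; first by rewrite cats0 subn1.
by rewrite IH catA -subn1 -subnDA add1n.
Qed.

Lemma front_fold_input its r : front_fold (size r) its r =
  input_fold (fun g j w => chunks_str j (its g) ++ w) r [::].
Proof. by elim: r => //= g r ->. Qed.

Lemma ok_print_loop its s : s pT = [::] -> size (s pJ) = size (s pR) -> size (s pR) <= B ->
  ok (print_loop its) s
    (out (upd (upd s pR [::]) pJ [::]) (input_fold (fun g j w => chunks_str j (its g) ++ w) (s pR) [::])).
Proof.
move=> hT eJ sR; set r := s pR in eJ sR *.
pose P c l := out (upd (upd s pR l) pJ (drop (size c) (s pJ))) (front_fold (size r) its c).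
apply: (@ok_for _ _ P) => //.
- by rewrite /P drop0 out_nil !upd_id.
- by rewrite /P drop_oversize ?eJ // front_fold_input.
move=> c g l e; have szr : size r = size c + (size l).+1 by rewrite /r e size_cat.
apply: ok_seq (ok_pop _ _ _) _; set s1 := upd _ pJ _.
have hJ1 : s1 pJ = drop (size c).+1 (s pJ).
  by rewrite /s1 upd_same /P /out !updE /= -drop1 drop_drop.
have sz1 : size (s1 pJ) = size r - (size c).+1 by rewrite hJ1 size_drop eJ.
apply: ok_eq; first by apply: ok_print_chunks; rewrite ?sz1 //; lia.
rewrite sz1 /P front_fold_rcons -out_cat size_rcons; congr out.
by rewrite /s1 -/(s1) -hJ1 /s1 updE /P /out /=; store_eq.
Qed.

Variables (m : nat) (x : seq S).
Let l := None :: map some x.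
Hypothesis B_big : m + size x + 1 <= B.

Definition prepared s : Prop :=
  [/\ s pT = [::], s pJ = [::], s pR = [::], s pM = nseq m tick & s pXC = map inl x].

Lemma bits_input (T : Type) (g : nat -> T -> T) j t :
  bits_fold g j t = input_fold (fun=> g) (nseq j tick) t.
Proof. by elim: j => //= j ->; rewrite size_nseq. Qed.

Lemma ok_print_segment g s : prepared s ->
  ok (print_segment g) s (out s (segment_str m l g)).
Proof.
move=> [hT hJ hR hM hX]; case: g => [w|its|its]; first exact: ok_print_str.
- apply: ok_seq (ok_cp _ _ _ _ _) _; rewrite ?hM ?size_nseq //; first by lia.
  apply: ok_seq (ok_cp _ _ _ _ _) _; rewrite ?updE //= ?hM ?size_nseq //; first by lia.
  rewrite hJ hR !cats0; apply: ok_eq.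
    by apply: ok_print_loop; rewrite ?updE //= ?size_nseq //; lia.
  by rewrite !updE /= bits_input /out; store_eq.
apply: ok_seq (ok_cp _ _ _ _ _) _; rewrite ?hX ?size_map //; first by lia.
apply: ok_seq (ok_push _ _ _ _) _.
apply: ok_seq (ok_cp _ _ _ _ _) _; rewrite ?updE //= ?hX ?size_map //; first by lia.
apply: ok_seq (ok_push _ _ _ _) _.
rewrite ?updE /= hJ hR !cats0; apply: ok_eq.
  by apply: ok_print_loop; rewrite ?updE //= ?size_map //; lia.
rewrite !updE /= size_map.
have -> : input_fold (fun (g : G) j w => chunks_str j (its (osym g)) ++ w) (map inl x) [::] =
    input_fold (fun a j w => chunks_str j (its a) ++ w) (map some x) [::].
  by elim: (x) => //= a y ->; rewrite !size_map.
by rewrite /out; store_eq.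
Qed.

Lemma ok_print_segments gs s : prepared s ->
  ok (print_segments gs) s (out s (flatten (map (segment_str m l) gs))).
Proof.
elim: gs s => [|g gs IH] s hs; first by rewrite out_nil; exact: ok_skip.
apply: ok_seq (ok_print_segment g hs) _.
by rewrite /= -out_cat; apply: IH; case: hs.
Qed.

Lemma ok_times_input a s : s pT = [::] -> s pM2 = [::] -> s pM = nseq a tick ->
  s pXC = map inl x -> a <= B -> a * size x <= B ->
  ok times_input s (upd s pM (nseq (a * size x) tick)).
Proof.
move=> hT hM2 hM hX aB axB.
pose P (c r : seq G) := upd (upd s pM r) pM2 (nseq (size c * size x) tick).
apply: (@ok_seq _ _ _ _ _ (P (nseq a tick) [::])).
  apply: (@ok_for _ _ P); rewrite ?hM ?size_nseq //.
    by rewrite /P /=; store_eq.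
  move=> c g r _; rewrite /P.
  apply: ok_seq (ok_mv _ _) _; rewrite ?updE //= ?hX ?size_map; first by lia.
  rewrite hT cats0; set s1 := upd _ pT _.
  have hT1 : s1 pT = rev (map inl x) by [].
  apply: (@ok_for _ _ (fun c' r' => upd (upd (upd (upd s pM r) pXC (rev c')) pM2
      (nseq (size c' + size c * size x) tick)) pT r')).
  - by rewrite hT1 size_rev size_map; lia.
  - by rewrite hT1 /s1; store_eq.
  - rewrite hT1 revK size_rev size_map size_rcons mulSn.
    by store_eq.
  move=> c' g' r' _; apply: ok_seq (ok_push _ _ _ _) _; apply: ok_eq (ok_push _ _ _ _) _.
  by rewrite !updE /= size_rcons addSn; store_eq.
rewrite /P size_nseq; apply: ok_eq (ok_mv _ _) _; rewrite ?updE //= ?size_nseq //.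
by rewrite rev_nseq; store_eq.
Qed.

Lemma ok_counter e C s : s pT = [::] -> s pM2 = [::] -> s pM = [::] ->
  s pXC = map inl x -> (size x).+1 ^ e <= B ->
  ok (bit_counter e C) s (upd s pM (nseq (C + size x ^ e) tick)).
Proof.
move=> hT hM2 hM hX eB; apply: ok_seq (ok_push _ _ _ _) _; rewrite hM.
have base c d : ok (iter c (fun c => Push pM tick ;; c) (Skip G))
    (upd s pM (nseq d tick)) (upd s pM (nseq (c + d) tick)).
  elim: c d => [|c IH] d; first exact: ok_skip.
  rewrite addSnnS; apply: ok_seq (ok_push _ _ _ _) _.
  by rewrite updE eqxx upd_upd; exact: (IH d.+1).
suff gen e' d : d * (size x).+1 ^ e' <= B ->
    ok (iter e' (fun c => times_input ;; c) (iter C (fun c => Push pM tick ;; c) (Skip G)))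
    (upd s pM (nseq d tick)) (upd s pM (nseq (C + d * size x ^ e') tick)).
  by have := gen e 1; rewrite !mul1n; apply.
elim: e' d => [|e' IH] d; first by rewrite !expn0 muln1 => _; exact: base.
rewrite expnS => dB.
have p : 0 < (size x).+1 ^ e' by rewrite expn_gt0.
apply: (@ok_seq _ _ _ _ _ (upd s pM (nseq (d * size x) tick))).
  apply: ok_eq; first by apply: (ok_times_input (a := d)); rewrite ?updE //; nia.
  by rewrite upd_upd.
rewrite expnS mulnA; apply: IH; apply: leq_trans dB.
by rewrite mulnA leq_mul2r leq_mul2l leqnSn !orbT.
Qed.

End Specs.

Lemma wf_print_str w : wf 9 (print_str w).
Proof. by elim: w. Qed.

Lemma frozen_print_str w : frozen pR (print_str w).
Proof. by elim: w. Qed.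

Lemma wf_print_chunks its : wf 9 (print_chunks its) /\ frozen pR (print_chunks its).
Proof.
elim: its => [|o its [h1 h2]] //.
have [w f] : wf 9 (print_chunk o) /\ frozen pR (print_chunk o); last by split; split.
case: o => [w|]; first by split; [exact: wf_print_str | exact: frozen_print_str].
by wf_tac.
Qed.

Lemma wf_print_segments gs : wf 9 (print_segments gs).
Proof.
elim: gs => [|g gs IH] //=; split=> //; case: g => [w|its|its] /=.
- exact: wf_print_str.
- by have [h1 h2] := wf_print_chunks its; wf_tac.
- have h g := wf_print_chunks (its (osym g)); wf_tac; exact: (h _).1 || exact: (h _).2.
Qed.

Lemma wf_printer e C gs : wf 9 (printer e C gs).
Proof.
have w0 : wf 9 (iter C (fun c => Push pM tick ;; c) (Skip G)) by elim: C.
have wt : wf 9 times_input by wf_tac.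
have w1 : wf 9 (iter e (fun c => times_input ;; c) (iter C (fun c => Push pM tick ;; c) (Skip G))).
  by elim: e => // e IH; split.
by have h := wf_print_segments gs; rewrite /printer; wf_tac.
Qed.

Theorem print_polytime e C gs : polytime_computable (fun x : seq S =>
  flatten (map (segment_str (C + size x ^ e) (None :: map some x)) gs)).
Proof.
pose B n := (C + 3) * n.+1 ^ e.+1.
have spec x : exists s, [/\ ok (B (size x)) (printer e C gs) (input_store (map inl x)) s,
    s pX = [::] & s pOUT = rev (map inr
      (flatten (map (segment_str (C + size x ^ e) (None :: map some x)) gs)))].
  have p1 : size x ^ e <= (size x).+1 ^ e by exact: leq_expl.
  have p2 : 0 < (size x).+1 ^ e by rewrite expn_gt0.
  have xB : C + size x ^ e + size x + 1 <= B (size x).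
    rewrite /B expnS; move: p1 p2; move: (size x ^ e) ((size x).+1 ^ e) (size x) => a b c; nia.
  have eB : (size x).+1 ^ e <= B (size x) by rewrite /B expnS; nia.
  eexists; split.
  - apply: ok_seq (ok_mv _ _) _; rewrite ?size_map //=; first by lia.
    apply: ok_seq (ok_mv _ _) _; rewrite ?updE //= ?cats0 ?size_rev ?size_map //; first by lia.
    rewrite revK; apply: ok_seq.
      by apply: (ok_counter xB); rewrite ?updE //= ?cats0.
    by apply: (ok_print_segments (m := C + size x ^ e) (x := x) xB); split; rewrite ?updE //= ?cats0.
  - by [].
  - by rewrite /out !updE /= cats0.
(* The parameter 7 yields the stacks 0 to 8, the last of which is [pOUT]. *)
apply: (@polytime_program S G inl _ letter inr _ _ 7 (printer e C gs) (C + 3) e.+1).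
- by move=> a b [].
- by move=> a b [].
- exact: wf_printer.
- by move=> x; have [s [[h _] _ _]] := spec x.
- by move=> x; have [s [[_ ->] h _]] := spec x.
- by move=> x; have [s [[_ ->] _ h]] := spec x.
Qed.

End Printer.

(** * Completeness *)

Lemma sat_problem_encode T : GRA2 T -> sat_problem GRA2 (encode T) <-> satisfiable T.
Proof.
by move=> g; split=> [[T' [_ s /encode_inj <-]]|s]; last exists T.
Qed.

(** The constant [C] absorbs the factor [c] and, through the sum, the finitely many lengths below
    [n0]. Passing to [k + 1] makes the exponent at least [n], which takes care of the summand
    [n]. *)
Lemma time_exponent (T : nat -> nat) k : bigO T (fun n => 2 ^ (n ^ k)) ->
  exists C, forall n, n + T n + 3 < 2 ^ (C + n ^ k.+1).
Proof.
case=> c [n0 H]; exists (2 * c + 4 + \sum_(n < n0) (n + T n + 3)) => n.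
set D := \sum_(_ < _) _; have hD : 2 * c + 4 + D < 2 ^ (2 * c + 4 + D) by exact: ltn_expl.
have pos e : 0 < 2 ^ e by rewrite expn_gt0.
rewrite expnD; case: (ltnP n n0) => nn.
  have : n + T n + 3 <= D by rewrite /D (bigD1 (Ordinal nn)) //= leq_addr.
  have := pos (n ^ k.+1); move: (2 ^ (n ^ _)) (2 ^ _) hD => X Y; nia.
have hn : n <= 2 ^ (n ^ k.+1).
  apply: leq_trans (ltnW (ltn_expl n (isT : 1 < 2))) _; rewrite leq_exp2l //.
  by case: (n) => // n'; rewrite expnS leq_pmulr // expn_gt0.
have hT : 2 ^ (n ^ k) <= 2 * 2 ^ (n ^ k.+1).
  rewrite -expnS leq_exp2l //; case: (n) => [|n'].
    by case: (k) => [|k'] //; rewrite exp0n.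
  by apply: leqW; rewrite leq_pexp2l.
have h := H n nn; have := pos (n ^ k.+1).
by move: (2 ^ (n ^ k.+1)) (2 ^ (n ^ k)) (2 ^ (2 * c + 4 + D)) hD hn hT h => X Z Y; nia.
Qed.

Theorem sat_NEXPTIME_hard : NEXPTIME_hard (sat_problem GRA2).
Proof.
move=> S L [k [G [ii [M [T [_ bT hT HL]]]]]].
have [C hC] := time_exponent bT.
(* The numbers have one bit more than the time bound requires, so that residues separate the head
   positions. *)
exists (fun x => encode (run_term ii M (C + size x ^ k.+1).+1 x)) => [|x].
  have E x : encode (run_term ii M (C + size x ^ k.+1).+1 x) =
      flatten (map (segment_str (C.+1 + size x ^ k.+1) (None :: map some x))
        (sentence_segments (c_zero S (record M) (ntapes M).+1) (c_next S (record M) (ntapes M).+1)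
          (c_all (@r_scn _ M) (@r_wr _ M) (@r_dr _ M) (@r_link _ M) (r_ini ii M)))).
    by rewrite -encode_sentence.
  by rewrite (funext E); exact: print_polytime.
rewrite HL -(run_term_accepts (hT x) (hC _)) sat_problem_encode //.
exact: GRA2_sentence.
Qed.

Theorem theorem3p5 : NEXPTIME_complete (sat_problem GRA2).
Proof. by split; [exact: Verifier.sat_NEXPTIME | exact: sat_NEXPTIME_hard]. Qed.
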